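(* Let $e^{\phi(r)} = e^r$, $r_0 = 0$ and fix $r_1 > 0$. One can find $\varphi \in C_0^\infty(\mathbb{R})$, $h_0>0$ and a family $(\psi_0^h)_{h\in(0,h_0]}$ of non zero functions in $C_0^\infty((r_0,\infty)\times\mathcal{A})$ such that, if we set $$ \Psi_h(t) = e^{it\Delta_0}\varphi(-h^2\Delta_0)\psi_0^h , $$ then, for any Schrödinger admissible pair $(p,q)$ in dimension $2$, i.e. $p,q\geq 2$, $(p,q)\neq(2,\infty)$, $\frac{1}{p}+\frac{1}{q}=\frac{1}{2}$, with $q>2$, and any $\sigma < \sigma_{\rm S} := \frac{1}{2}\left(\frac{1}{2}-\frac{1}{q}\right)$, we have $$ \lim_{h\to 0} \frac{\left\| \Pi^c\mathbf{1}_{[r_1,\infty)}(r)\Psi_h \right\|_{L^p([0,h]; L^q_{G_0})}}{\|\psi_0^h\|_{H^\sigma_{G_0}}} = +\infty . $$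
   Context: Setting. $(\mathcal{A}, g_{\mathcal{A}})$ is a compact Riemannian manifold of dimension $1$ (a finite disjoint union of circles) with line element $d\mathcal{A}$ and Laplacian $\Delta_{\mathcal{A}}$. With $r_0=0$ and $\phi(r)=r$, the cusp is $\mathcal{S}_0 = [r_0,+\infty)_r\times\mathcal{A}$ with metric $G_0 = dr^2 + e^{-2\phi(r)}g_{\mathcal{A}}$ and volume density $d\mathrm{vol}_0 = e^{-\phi(r)}dr\,d\mathcal{A}$; $L^q_{G_0} := L^q(\mathcal{S}_0,d\mathrm{vol}_0)$. $\Delta_0 = \partial_r^2 - \phi'(r)\partial_r + e^{2\phi(r)}\Delta_{\mathcal{A}}$ is the non-positive Laplace-Beltrami operator, realized as the Friedrichs extension from $C_0^\infty((r_0,\infty)\times\mathcal{A})$ (Dirichlet condition at $r_0$). For $\sigma\in\mathbb{R}$, $\|\psi\|_{H^\sigma_{G_0}} := \|(1-\Delta_0)^{\sigma/2}\psi\|_{L^2_{G_0}}$. $\pi_0$ is the orthogonal projection of $L^2(\mathcal{A},d\mathcal{A})$ onto $\mathrm{Ker}(\Delta_{\mathcal{A}})$, $\Pi = 1\otimes\pi_0$ is the corresponding operator on functions on $\mathcal{S}_0$, $\Pi^c = I-\Pi$, and $\mathbf{1}_{[r_1,\infty)}(r)$ is restriction to $[r_1,\infty)\times\mathcal{A}$. *)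

(* Defs.v *)
From HB Require Import structures.
From mathcomp Require Import all_boot all_order all_algebra.
From mathcomp Require Import all_classical all_reals all_analysis.
From mathcomp.real_closed Require Import complex.
Set Implicit Arguments.
Unset Strict Implicit.
Unset Printing Implicit Defensive.
Import Order.TTheory GRing.Theory Num.Theory.
Import numFieldNormedType.Exports.

Local Open Scope classical_set_scope.
Local Open Scope ring_scope.
Local Open Scope complex_scope.

Section smooth.
Context {R : realType}.

(* Every iterated directional derivative exists and is differentiable. *)
Definition smooth (V : normedModType R) (f : V -> R) : Prop :=
  forall (s : seq V) (x : V), differentiable (foldr (fun v g => 'D_v g) f s) x.

Definition csmooth (V : normedModType R) (f : V -> R[i]) : Prop :=
  smooth (fun x => complex.Re (f x)) /\ smooth (fun x => complex.Im (f x)).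

Definition cderive (f : R -> R[i]) (x : R) : R[i] :=
  derive1 (fun y => complex.Re (f y)) x
  +i* derive1 (fun y => complex.Im (f y)) x.

Definition test_line (f : R -> R[i]) : Prop :=
  csmooth f /\ exists B : R, forall x, f x != 0 -> `|x| <= B.

End smooth.

Section Lq.
Context {R : realType} {d : measure_display} {T : measurableType d}.
Variable mu : {measure set T -> \bar R}.

Definition cLnorm (q : \bar R) (f : T -> R[i]) : \bar R :=
  Lnorm mu q (fun x => (Normc.normc (f x))%:E).

Definition in_L2 (f : T -> R[i]) : Prop :=
  [/\ measurable_fun [set: T] (fun x => complex.Re (f x)),
      measurable_fun [set: T] (fun x => complex.Im (f x))
    & (cLnorm 2%:E f < +oo)%E].

Definition cint (f : T -> R[i]) : R[i] :=
  (\int[mu]_x complex.Re (f x)) +i* (\int[mu]_x complex.Im (f x)).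

Definition inner (f g : T -> R[i]) : R[i] := cint (fun x => f x * conjc (g x)).

Definition aeeq (f g : T -> R[i]) : Prop := {ae mu, forall x, f x = g x}.

(* Unbounded operators on [L^2] are given by their graph: [H u w] means that [u]
   is in the domain and [w = H u]. This is the Friedrichs extension of a
   nonnegative symmetric operator [A] with domain [D]: the restriction of the
   adjoint of [A] to the completion of [D] for the norm
   [(<A v, v> + |v|^2)^(1/2)], realised inside [L^2]. *)
Definition friedrichs (D : set (T -> R[i])) (A : (T -> R[i]) -> (T -> R[i]))
    (u w : T -> R[i]) : Prop :=
  [/\ in_L2 u, in_L2 w,
      (exists v : nat -> T -> R[i],
         [/\ forall n, D (v n),
             cLnorm 2%:E (v n \- u) @[n --> \oo] --> (0 : \bar R)
           & forall e : R, 0 < e -> exists N : nat, forall m n : nat,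
               (N <= m)%N -> (N <= n)%N ->
               complex.Re (inner (A (v m \- v n)) (v m \- v n)) < e])
    & forall v, D v -> inner u (A v) = inner w v].

End Lq.

(* A spectral representation of an operator [H]: a unitary [U] from [L^2(mu)]
   onto some [L^2(nu)] conjugating [H] to the multiplication by a real function
   [symb], domains included. By the spectral theorem there is one as soon as [H]
   is self-adjoint and [L^2(mu)] is separable. *)
Record spectral_rep (R : realType) (d : measure_display) (T : measurableType d)
    (mu : {measure set T -> \bar R})
    (H : (T -> R[i]) -> (T -> R[i]) -> Prop) := SpectralRep {
  sr_disp : measure_display;
  sr_space : measurableType sr_disp;
  sr_meas : {sigma_finite_measure set sr_space -> \bar R};
  symb : sr_space -> R;
  sr_U : (T -> R[i]) -> (sr_space -> R[i]);
  measurable_symb : measurable_fun [set: sr_space] symb;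
  sr_U_L2 : forall u, in_L2 mu u -> in_L2 sr_meas (sr_U u);
  sr_U_linear : forall (c : R[i]) u v, in_L2 mu u -> in_L2 mu v ->
    aeeq sr_meas (sr_U (fun x => c * u x + v x))
                 (fun y => c * sr_U u y + sr_U v y);
  sr_U_isometry : forall u, in_L2 mu u ->
    cLnorm sr_meas 2%:E (sr_U u) = cLnorm mu 2%:E u;
  sr_U_onto : forall g, in_L2 sr_meas g ->
    exists2 u, in_L2 mu u & aeeq sr_meas (sr_U u) g;
  sr_diag : forall u w, in_L2 mu u -> in_L2 mu w ->
    (H u w <-> aeeq sr_meas (sr_U w) (fun y => (symb y)%:C * sr_U u y))
}.
Arguments sr_space {R d T mu H} s.
Arguments sr_meas {R d T mu H} s.
Arguments symb {R d T mu H} s y.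
Arguments sr_U {R d T mu H} s u y.

(* [f(H) u = U^-1 ((f o symb) . U u)]; the value is a representative of this
   class when [u] is in the domain of [f(H)], and [0] otherwise. It does not
   depend on the chosen representation, up to almost everywhere equality. *)
Definition fcalc (R : realType) (d : measure_display) (T : measurableType d)
    (mu : {measure set T -> \bar R}) (H : (T -> R[i]) -> (T -> R[i]) -> Prop)
    (S : spectral_rep mu H) (f : R -> R[i]) (u : T -> R[i]) : T -> R[i] :=
  xget (fun=> 0) [set w | in_L2 mu w /\
    aeeq (sr_meas S) (sr_U S w) (fun y => f (symb S y) * sr_U S u y)].

(* The compact 1-manifold [A] is a disjoint union of [n.+1] circles;
   the point [(k, s)] is the point of arc length [s] (modulo [ell k]) on the
   [k]-th circle, which has length [ell k]. The measure only sees the fundamental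
   domain [0 <= s < ell k]; smooth functions are periodic in [s]. *)
HB.instance Definition _ (n : nat) := isPointed.Build 'I_n.+1 ord0.
HB.instance Definition _ (n : nat) :=
  @isMeasurable.Build default_measure_display 'I_n.+1
    discrete_measurable discrete_measurable0
    discrete_measurableC discrete_measurableU.

Section circle_measure.
Context {R : realType} {n : nat}.
Variable ell : 'I_n.+1 -> R.

Definition circle_measure : set ('I_n.+1 * R) -> \bar R := fun V =>
  (\sum_(k < n.+1) lebesgue_measure (xsection V k `&` `[0%R, ell k[))%E.

Let circle_measure0 : circle_measure set0 = 0%E.
Proof.
by rewrite /circle_measure big1// => k _; rewrite xsection0 set0I measure0.
Qed.

Let circle_measure_ge0 V : (0 <= circle_measure V)%E.
Proof. exact: sume_ge0. Qed.

Let circle_measure_sigma_additive : semi_sigma_additive circle_measure.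
Proof.
move=> F mF tF mUF; rewrite [X in _ --> X](_ : _ =
    lim ((fun m => \sum_(0 <= i < m) circle_measure (F i))%E @ \oo)).
  by apply: is_cvg_ereal_nneg_natsum => k _; exact: circle_measure_ge0.
rewrite nneseries_sum//; apply: eq_bigr => /= k _.
have mFk i : measurable (xsection (F i) k `&` `[0%R, ell k[).
  by apply: measurableI => //; exact: measurable_xsection.
rewrite xsection_bigcup setI_bigcupl; apply: measure_semi_bigcup => //.
- by apply: trivIset_setIr; exact: trivIset_xsection.
- by apply: bigcup_measurable => i _; exact: mFk.
Qed.

HB.instance Definition _ := isMeasure.Build _ _ _ circle_measure
  circle_measure0 circle_measure_ge0 circle_measure_sigma_additive.

Let circle_measure_fin : fin_num_fun circle_measure.
Proof.
move=> V mV; rewrite ge0_fin_numE//; apply: lte_sum_pinfty => k _.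
apply: (@le_lt_trans _ _ (lebesgue_measure (`[0%R, ell k[ : set R))).
  apply: le_measure => //; rewrite inE//.
  by apply: measurableI => //; exact: measurable_xsection.
by rewrite lebesgue_measure_itv/=; case: ifPn => _; rewrite ltry.
Qed.

HB.instance Definition _ :=
  Measure_isFinite.Build _ _ _ circle_measure circle_measure_fin.

End circle_measure.

Section circles.
Context {R : realType} {n : nat}.
Variable ell : 'I_n.+1 -> R.

Definition smooth_circles (g : 'I_n.+1 * R -> R[i]) : Prop :=
  forall k : 'I_n.+1, csmooth (fun s => g (k, s)) /\
    forall s, g (k, s + ell k) = g (k, s).

Definition laplacian_circles (g : 'I_n.+1 * R -> R[i]) (a : 'I_n.+1 * R) : R[i] :=
  cderive (cderive (fun s => g (a.1, s))) a.2.

Definition ker_laplacian_circles (g : 'I_n.+1 * R -> R[i]) : Prop :=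
  smooth_circles g /\ forall a, laplacian_circles g a = 0.

Definition pi0 (f : 'I_n.+1 * R -> R[i]) : 'I_n.+1 * R -> R[i] :=
  xget (fun=> 0) [set g | ker_laplacian_circles g /\
    forall e, ker_laplacian_circles e ->
      inner (circle_measure ell) (fun a => f a - g a) e = 0].

End circles.

(* The cusp [[0, +oo[ x A] with metric [dr^2 + e^(-2r) g_A]. Functions on it are
   defined for all real [r], but the measure only sees [r >= 0]. *)

Section radial_measure.
Context {R : realType}.

Definition radial_measure : set R -> \bar R := fun V =>
  (\int[lebesgue_measure]_(r in V `&` `[0%R, +oo[) (expR (- r))%:E)%E.

Let radial_measure0 : radial_measure set0 = 0%E.
Proof. by rewrite /radial_measure set0I integral_set0. Qed.

Let radial_measure_ge0 V : (0 <= radial_measure V)%E.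
Proof. by apply: integral_ge0 => r _; rewrite lee_fin expR_ge0. Qed.

Let radial_measure_sigma_additive : semi_sigma_additive radial_measure.
Proof.
move=> F mF tF mUF; rewrite /radial_measure setI_bigcupl.
apply: (@semi_sigma_additive_nng_induced _ _ _ lebesgue_measure
    (EFin \o (fun r : R => expR (- r)))).
- by apply/measurable_realfun.measurable_EFinP; exact: measurableT_comp.
- by move=> r; rewrite lee_fin expR_ge0.
- by move=> i; apply: measurableI => //; exact: mF.
- by apply: (@trivIset_setIr R nat); exact: tF.
- by apply: bigcup_measurable => i _; apply: measurableI => //; exact: mF.
Qed.

HB.instance Definition _ := isMeasure.Build _ _ _ radial_measure
  radial_measure0 radial_measure_ge0 radial_measure_sigma_additive.

End radial_measure.

Section cusp.
Context {R : realType} {n : nat}.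
Variable ell : 'I_n.+1 -> R.

Definition vol0 : {measure set (R * ('I_n.+1 * R)) -> \bar R} :=
  (radial_measure \x circle_measure ell)%E.

Implicit Type u : R * ('I_n.+1 * R) -> R[i].

Definition laplacian0 u (x : R * ('I_n.+1 * R)) : R[i] :=
  cderive (cderive (fun r => u (r, x.2))) x.1
  - cderive (fun r => u (r, x.2)) x.1
  + (expR (2 * x.1))%:C * laplacian_circles (fun a => u (x.1, a)) x.2.

(* [C_0^oo(]0, +oo[ x A)]; [A] being compact, compactness of the support only
   concerns [r]. *)
Definition test_cusp u : Prop :=
  [/\ forall k : 'I_n.+1, csmooth (fun z : R * R => u (z.1, (k, z.2))),
      forall r (k : 'I_n.+1) s, u (r, (k, s + ell k)) = u (r, (k, s))
    & exists a b : R, 0 < a /\ forall x, u x != 0 -> a <= x.1 <= b].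

(* [- Delta_0] with Dirichlet condition at [r = 0]. *)
Definition neg_Delta0 : (R * ('I_n.+1 * R) -> R[i]) ->
    (R * ('I_n.+1 * R) -> R[i]) -> Prop :=
  friedrichs vol0 test_cusp (fun u x => - laplacian0 u x).

Definition Pi u : R * ('I_n.+1 * R) -> R[i] :=
  fun x => pi0 ell (fun a => u (x.1, a)) x.2.

Definition Pic u : R * ('I_n.+1 * R) -> R[i] := fun x => u x - Pi u x.

Definition restrict_ge (r1 : R) u : R * ('I_n.+1 * R) -> R[i] :=
  fun x => if r1 <= x.1 then u x else 0.

Variable S : spectral_rep vol0 neg_Delta0.

(* [e^(i t Delta_0) u]; recall that [S] represents [- Delta_0]. *)
Definition schrodinger (t : R) u : R * ('I_n.+1 * R) -> R[i] :=
  fcalc S (fun l => cos (t * l) -i* sin (t * l)) u.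

Definition cutoff (phi : R -> R[i]) (h : R) u : R * ('I_n.+1 * R) -> R[i] :=
  fcalc S (fun l => phi (h ^+ 2 * l)) u.

Definition sobolev_norm (sigma : R) u : \bar R :=
  cLnorm vol0 2%:E (fcalc S (fun l => ((1 + l) `^ (sigma / 2))%:C) u).

End cusp.

Definition LpLq_norm (R : realType) (d : measure_display) (T : measurableType d)
    (mu : {measure set T -> \bar R}) (h : R) (p q : \bar R)
    (Psi : R -> T -> R[i]) : \bar R :=
  Lnorm (mrestr lebesgue_measure (measurable_itv `[0, h])) p
    (fun t => cLnorm mu q (Psi t)).

Definition admissible2 (R : realType) (p q : \bar R) : Prop :=
  [/\ 2%:E <= p, 2%:E <= q, ~ (p = 2%:E /\ q = +oo) & p^-1 + q^-1 = (2^-1)%:E]%E.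

(* Main.v *)
Require Import Defs.
From HB Require Import structures.
From mathcomp Require Import all_boot all_order all_algebra.
From mathcomp Require Import all_classical all_reals all_analysis.
From mathcomp.real_closed Require Import complex.
From mathcomp Require Import measurable_realfun.
From mathcomp Require Import ring lra.

(** On one circle of [A], with [lam] a nonzero frequency of that circle, a function
    [e^(r/2) f(r) e^(i lam s)] lies in the range of [Pic], and [- Delta_0] acts on
    [f] as the one-dimensional operator [- f'' + (1/4 + lam^2 e^(2r)) f]. At energy
    [mu^2 = h^-2] the exponential potential stops the classical motion at the
    turning point [r = ln (mu / lam)], which goes to infinity as [h] tends to [0].
    The cusp is so thin there that a packet of radial width [delta = h^(1/2)] only
    occupies a volume of order [h^(3/2)], and by Hoelder's inequality its [L^q] norm
    is much larger, for a given [L^2] norm, than that of a Euclidean packet.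

    The datum is such a packet at rest at the turning point, and the approximate
    solution carries it along the classical trajectory
    [lam e^(pos t) = mu / cosh (2 mu t)]. As position, momentum and phase solve
    Hamilton's equations exactly, the error made in the Schroedinger equation
    consists of the quadratic Taylor remainder of the potential on the width of the
    packet, of order [mu^2 delta^2 = mu], and of two derivatives of the profile, of
    order [delta^-2 = mu] ([residualE], [residual_norm]). Over a time [s h] with [s]
    small, the accumulated error is a small fraction of the norm of the packet.

    Only a spectral representation of [- Delta_0] is given, so Duhamel's principle
    is replaced by an explicit Euler scheme on the spectral side
    ([propagated_close]). The cutoff [phi (h^2 l)] is harmless if [phi] equals [1]
    at [0] and has a large support, because [- Delta_0] applied to the packet has
    norm of order [h^-2] ([packet_tracking]).

    For [0 <= t <= s h] the solution thus keeps a fixed fraction of its mass on the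
    packet. Testing it against the packet, which has mean zero on each circle and
    lives in [r >= r1], so that it sees neither [Pi] nor the restriction, bounds from
    below the [L^q] norm of the solution ([Pic_lower], [concentration]). Integration
    in time gives an [L^p L^q] norm of order at least [h^(1/(2q))], because
    [1/p = 1/2 - 1/q]. The [H^sigma] norm of the datum is at most of order
    [h^(1/4 - sigma)] for [sigma >= 0] ([sobolev_upper]), hence the quotient grows at
    least like [h^(sigma - sigma_S)]. *)

Set Implicit Arguments.
Unset Strict Implicit.
Unset Printing Implicit Defensive.
Import Order.TTheory GRing.Theory Num.Theory.
Import numFieldNormedType.Exports.
Local Open Scope classical_set_scope.
Local Open Scope ring_scope.
Local Notation Re := complex.Re.
Local Notation Im := complex.Im.
Local Notation normc := Normc.normc.

(** * Smooth functions and a bump function *)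

Section smooth_algebra.
Context {R : realType} {V : normedModType R}.
Implicit Types (f g : V -> R) (m : nat).

(** Counting the derivatives allows inductions for sums, products and compositions. *)
Fixpoint smoothn m f : Prop :=
  (forall x, differentiable f x) /\
  if m is m'.+1 then forall v, smoothn m' ('D_v f) else True.

Lemma smoothP f : smooth f <-> forall m, smoothn m f.
Proof.
split=> [sf m|].
  elim: m f sf => [|m ih] f sf /=; first by split=> //; exact: (sf [::]).
  split; first exact: (sf [::]).
  by move=> v; apply: ih => s x; have := sf (rcons s v) x; rewrite foldr_rcons.
move=> sf s; elim/last_ind: s f sf => [|s v ih] f sf x.
  exact: (sf 0%N).1.
by rewrite foldr_rcons; apply: ih => m; exact: (sf m.+1).2.
Qed.

Lemma smoothn_diff m f : smoothn m f -> forall x, differentiable f x.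
Proof. by case: m => [|m] []. Qed.

Lemma smoothnS m f : smoothn m.+1 f -> smoothn m f.
Proof.
elim: m f => [|m ih] f [df sf]; first by split.
by split=> // v; apply: ih; exact: sf.
Qed.

Lemma smooth_differentiable f x : smooth f -> differentiable f x.
Proof. by move=> /smoothP sf; exact: (sf 0%N).1. Qed.

Lemma smooth_derive f v : smooth f -> smooth ('D_v f).
Proof. by move=> /smoothP sf; apply/smoothP => m; exact: (sf m.+1).2. Qed.

Lemma smooth_continuous f : smooth f -> continuous f.
Proof. by move=> sf x; exact/differentiable_continuous/smooth_differentiable. Qed.

Lemma smoothnD m f g : smoothn m f -> smoothn m g -> smoothn m (f \+ g).
Proof.
elim: m f g => [|m ih] f g [df sf] [dg sg]; (split; first by move=> x; exact: differentiableD) => //=.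
move=> v; rewrite (_ : 'D_v _ = 'D_v f \+ 'D_v g).
  by apply: ih; [exact: sf|exact: sg].
by apply/funext => x; apply: deriveD; exact: diff_derivable.
Qed.

Lemma smoothnM m f g : smoothn m f -> smoothn m g -> smoothn m (f \* g).
Proof.
elim: m f g => [|m ih] f g sf sg.
  by split=> // x; apply: differentiableM; [exact: sf.1|exact: sg.1].
have df := smoothn_diff sf; have dg := smoothn_diff sg.
have [[_ sf'] [_ sg']] := (sf, sg).
split=> [x|v]; first exact: differentiableM.
rewrite (_ : 'D_v _ = (f \* 'D_v g) \+ (g \* 'D_v f)).
  by apply: smoothnD; apply: ih;
    [exact: smoothnS|exact: sg'|exact: smoothnS|exact: sf'].
by apply/funext => x; apply: deriveM; exact: diff_derivable.
Qed.

Lemma smoothD f g : smooth f -> smooth g -> smooth (fun x => f x + g x).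
Proof. by move=> /smoothP sf /smoothP sg; apply/smoothP => m; exact: smoothnD. Qed.

Lemma smoothM f g : smooth f -> smooth g -> smooth (fun x => f x * g x).
Proof. by move=> /smoothP sf /smoothP sg; apply/smoothP => m; exact: smoothnM. Qed.

Lemma smooth_cst (k : R) : smooth (fun _ : V => k).
Proof.
apply/smoothP => m; elim: m k => [|m ih] k.
  by split=> // x; exact: differentiable_cst.
split=> [x|v]; first exact: differentiable_cst.
rewrite (_ : 'D_v _ = fun=> 0); first exact: ih.
by apply/funext => x; exact: derive_cst.
Qed.

Lemma smoothN f : smooth f -> smooth (fun x => - f x).
Proof.
move=> sf; rewrite (_ : (fun x => _) = (fun x => (-1) * f x)).
  by apply: smoothM => //; exact: smooth_cst.
by apply/funext => x; rewrite mulN1r.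
Qed.

Lemma smoothB f g : smooth f -> smooth g -> smooth (fun x => f x - g x).
Proof. by move=> sf sg; apply: smoothD => //; exact: smoothN. Qed.

Lemma smooth_linear (f : {linear V -> R}) : continuous f -> smooth f.
Proof.
move=> cf; apply/smoothP => -[|m]; split => //.
- by move=> x; exact: linear_differentiable.
- by move=> x; exact: linear_differentiable.
move=> v; rewrite (_ : 'D_v f = fun=> f v).
  by move: m; apply/smoothP; exact: smooth_cst.
apply/funext => x; rewrite deriveE; last exact: linear_differentiable.
by rewrite diff_lin.
Qed.

(** The derivatives of all orders of [G 0], required only on a set [D] so that the
    logarithm and the inverse are covered. *)
Definition tower (D : set R) (G : nat -> R -> R) : Prop :=
  forall m y, D y -> is_derive y 1 (G m) (G m.+1 y).

Lemma smooth_comp D (G : nat -> R -> R) f : tower D G ->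
  (forall x, D (f x)) -> smooth f -> smooth (fun x => G 0%N (f x)).
Proof.
move=> tG Df /smoothP sf; apply/smoothP => m; move: 0%N => k.
have df := (sf 0%N).1.
have dG j x : differentiable (G j) (f x).
  by apply/derivable1_diffP; have [] := tG j _ (Df x).
have dGf j x : differentiable (fun x => G j (f x)) x.
  exact: differentiable_comp.
elim: m k => [|m ih] k; split => // v.
rewrite (_ : 'D_v _ = (fun x => G k.+1 (f x)) \* ('D_v f)).
  by apply: smoothnM; [exact: ih|exact: (sf m.+1).2].
apply/funext => x /=; rewrite deriveE// diff_comp//= deriveE//.
have [dG1 dG2] := tG k _ (Df x).
by rewrite deriv1E// /= derive1E dG2 mulrC.
Qed.

End smooth_algebra.

Section smooth_coordinates.
Context {R : realType}.

Lemma smooth_tower (g : R -> R) : smooth g ->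
  tower [set: R] (fun m => iter m (fun f : R -> R => 'D_1 f) g).
Proof.
move=> sg m y _; split => //; apply: diff_derivable; apply: smooth_differentiable.
by elim: m => [//|m ih]; exact: smooth_derive.
Qed.

Lemma smooth_comp1 (V : normedModType R) (g : R -> R) (f : V -> R) :
  smooth g -> smooth f -> smooth (fun x => g (f x)).
Proof. by move=> /smooth_tower tg; exact: (smooth_comp tg). Qed.

Lemma smooth_id : smooth (@id R).
Proof. by apply: (@smooth_linear _ _ idfun) => x; exact: cvg_id. Qed.

Lemma smooth_fst : smooth (fun z : R * R => z.1).
Proof. by apply: (@smooth_linear _ _ fst) => x; exact: cvg_fst. Qed.

Lemma smooth_snd : smooth (fun z : R * R => z.2).
Proof. by apply: (@smooth_linear _ _ snd) => x; exact: cvg_snd. Qed.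

End smooth_coordinates.

Section towers.
Context {R : realType}.

Lemma tower_expR : tower [set: R] (fun=> expR).
Proof. by move=> m y _; exact: is_derive_expR. Qed.

Lemma tower_sin : tower [set: R] (fun m y => sin (y + (pi / 2) *+ m)).
Proof.
move=> m y _; apply: is_derive_eq.
by rewrite addr0 mulr1 [X in sin (_ + X)]mulrSr addrA sinDpihalf.
Qed.

Lemma tower_inv : tower [set y : R | y != 0]
  (fun m y => (-1) ^+ m * m`!%:R * (y^-1) ^+ m.+1).
Proof.
move=> m y /= y0.
have dV : is_derive y 1 (fun z : R => z^-1) (- y ^- 2).
  apply: is_derive_eq; first exact: is_deriveV.
  by rewrite /GRing.scale /= mulr1.
have -> : (fun z : R => (-1) ^+ m * m`!%:R * z^-1 ^+ m.+1) =
   ((-1) ^+ m * m`!%:R) \*: ((fun z : R => z^-1) ^+ m.+1).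
  by apply/funext => z; rewrite fctE.
apply: is_derive_eq.
rewrite /GRing.scale /= factS natrM -[y ^- 2]exprVn -[_ *+ m.+1]mulr_natr.
move: y^-1 => i; by rewrite !exprS; ring.
Qed.

Lemma tower_ln : tower [set y : R | 0 < y]
  (fun m => if m is m'.+1 then fun y => (-1) ^+ m' * m'`!%:R * (y^-1) ^+ m'.+1
            else @ln R).
Proof.
case=> [|m] y /= y0; last by apply: tower_inv; rewrite /= gt_eqF.
by rewrite expr0 fact0 mul1r mul1r expr1; exact: is_derive1_ln.
Qed.

End towers.

Section elementary_smooth.
Context {R : realType} {V : normedModType R}.
Implicit Types f : V -> R.

Lemma smooth_expR f : smooth f -> smooth (fun x => expR (f x)).
Proof. by move=> sf; exact: (smooth_comp tower_expR). Qed.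

Lemma smooth_sin f : smooth f -> smooth (fun x => sin (f x)).
Proof.
move=> sf; rewrite (_ : (fun x => _) = fun x => sin (f x + (pi / 2) *+ 0)).
  exact: (smooth_comp tower_sin).
by apply/funext => x; rewrite mulr0n addr0.
Qed.

Lemma smooth_cos f : smooth f -> smooth (fun x => cos (f x)).
Proof.
move=> sf; rewrite (_ : (fun x => _) = fun x => sin (f x + pi / 2)).
  by apply: smooth_sin; apply: smoothD => //; exact: smooth_cst.
by apply/funext => x; rewrite sinDpihalf.
Qed.

Lemma smooth_inv f : (forall x, f x != 0) -> smooth f -> smooth (fun x => (f x)^-1).
Proof.
move=> f0 sf; have := smooth_comp tower_inv f0 sf.
by under eq_fun do rewrite expr0 fact0 mul1r mul1r expr1.
Qed.

Lemma smooth_ln f : (forall x, 0 < f x) -> smooth f -> smooth (fun x => ln (f x)).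
Proof. by move=> f0 sf; exact: (smooth_comp tower_ln f0 sf). Qed.

End elementary_smooth.

Section bump.
Context {R : realType}.

(** The exponential beats all polynomials: this is why the function below is smooth
    at [0]. *)
Lemma expr_le_expR (n : nat) (y : R) : 0 <= y -> y ^+ n <= (n ^ n)%:R * expR y.
Proof.
move=> y0; case: n => [|n].
  by rewrite expr0 expn0 mul1r -expR0 ler_expR.
have n0 : (0 : R) < n.+1%:R by rewrite ltr0n.
have -> : expR y = expR (y / n.+1%:R) ^+ n.+1.
  by rewrite -expRM_natl mulrC divfK ?gt_eqF.
have -> : y ^+ n.+1 = (n.+1 ^ n.+1)%:R * (y / n.+1%:R) ^+ n.+1.
  by rewrite natrX -exprMn mulrC divfK ?gt_eqF.
apply: ler_wpM2l; first by rewrite ler0n.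
apply: lerXn2r; rewrite ?nnegrE ?expR_ge0 ?divr_ge0 ?ler0n//.
by apply: le_trans (expR_ge1Dx _); rewrite lerDr.
Qed.

Lemma horner_le_expR (q : {poly R}) :
  exists2 C, 0 <= C & forall y, 0 <= y -> `|q.[y]| <= C * expR y.
Proof.
exists (\sum_(i < size q) `|q`_i| * (i ^ i)%:R).
  by apply: sumr_ge0 => i _; rewrite mulr_ge0.
move=> y y0; rewrite horner_coef mulr_suml.
apply: le_trans (ler_norm_sum _ _ _) _; apply: ler_sum => i _.
by rewrite normrM normrX (ger0_norm y0) -mulrA ler_wpM2l// expr_le_expR.
Qed.

(** The derivatives of [exp (-1/z)], extended by [0], have this shape. *)
Definition flat (p : {poly R}) (z : R) : R :=
  if 0 < z then p.[z^-1] * expR (- z^-1) else 0.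

Lemma is_derive_flat (p : {poly R}) (z : R) :
  is_derive z 1 (flat p) (flat ('X^2 * (p - p^`()%R)) z).
Proof.
have [z0|z0|->] := ltgtP z 0.
- rewrite {2}/flat ltNge (ltW z0) /=.
  apply: (@near_eq_is_derive _ _ _ (cst 0)) => //.
  near=> t; rewrite /flat ltNge (_ : t <= 0)//= ltW//; near: t.
  exact: lt_nbhsl.
- rewrite {2}/flat z0 /=.
  have dV : is_derive z 1 (fun z : R => z^-1) (- z ^- 2).
    apply: is_derive_eq; first by apply: is_deriveV; rewrite gt_eqF.
    by rewrite /GRing.scale /= mulr1.
  have dp : is_derive z 1 (fun t : R => p.[t^-1]) (p^`()%R.[z^-1] * (- z ^- 2)).
    apply: (@is_derive1_comp _ (horner p) (fun z : R => z^-1)) => //.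
  have de : is_derive z 1 (fun t : R => expR (- t^-1)) (z ^- 2 * expR (- z^-1)).
    have dN : is_derive z 1 (fun t : R => - t^-1) (- - z ^- 2) by exact: is_deriveN.
    have := @is_derive1_comp _ expR (fun z : R => - z^-1) z _ _ _ dN.
    by move=> /(_ _ (is_derive_expR _)); rewrite opprK mulrC.
  apply: (@near_eq_is_derive _ _ _
    ((fun t : R => p.[t^-1]) * (fun t : R => expR (- t^-1)))) => //.
    by near=> t; rewrite /flat (_ : 0 < t)//; near: t; exact: lt_nbhsr.
  apply: is_derive_eq.
  by rewrite /GRing.scale /= !hornerE /= exprVn; ring.
- rewrite {2}/flat ltxx.
  have [C C0 hC] := horner_le_expR ('X^2 * p).
  have key : (fun h : R => h^-1 *: (flat p (h *: 1 + 0) - flat p 0)) @ 0^' --> (0 : R).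
    have hb h : `|h^-1 *: (flat p (h *: 1 + 0) - flat p 0)| <= C * `|h|.
      rewrite /GRing.scale /= mulr1 addr0 {2}/flat ltxx subr0 /flat.
      case: ifPn => [h0|_]; last by rewrite mulr0 normr0 mulr_ge0.
      have := hC h^-1; rewrite invr_ge0 => /(_ (ltW h0)).
      have i0 : 0 < h^-1 by rewrite invr_gt0.
      rewrite hornerM hornerXn !normrM !(gtr0_norm i0) (gtr0_norm h0).
      rewrite (gtr0_norm (expR_gt0 _)) expRN => /(ler_wpM2l (ltW h0)).
      rewrite !mulrA mulfV ?gt_eqF// mul1r => H.
      by rewrite ler_pdivrMr ?expR_gt0// (le_trans H)// [h * C]mulrC.
    apply/norm_cvg0P.
    apply: (@squeeze_cvgr _ _ _ _ (cst 0) (fun h => C * `|h|)).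
    + by near=> h; rewrite normr_ge0 /=; exact: hb.
    + exact: cvg_cst.
    + rewrite -[X in _ --> X](mulr0 C) -[X in C * X](@normr0 _ R).
      apply: cvgMr; apply: (@cvg_norm _ _ _ _ _ id).
      exact: nbhs_dnbhs.
  split; first by apply/cvg_ex; exists 0.
  by apply/cvg_lim.
Unshelve. all: by end_near. Qed.

Lemma tower_flat : tower [set: R]
  (fun m => flat (iter m (fun p => 'X^2 * (p - p^`()%R)) 1)).
Proof. by move=> m y _; exact: is_derive_flat. Qed.

Definition bumpf (y : R) : R := flat 1 (1 - y ^+ 2).

Lemma smooth_bump : smooth bumpf.
Proof.
apply: (smooth_comp tower_flat) => //.
apply: smoothB; first exact: smooth_cst.
by under eq_fun do rewrite expr2; apply: smoothM; exact: smooth_id.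
Qed.

Lemma bump_ge0 y : 0 <= bumpf y.
Proof.
by rewrite /bumpf /flat; case: ifPn => // _; rewrite hornerC mul1r expR_ge0.
Qed.

Lemma bump_le0 y : bumpf y <= bumpf 0.
Proof.
rewrite /bumpf /flat expr0n subr0 ltr01 !hornerC !mul1r invr1.
case: ifPn => [y1|_]; last exact: expR_ge0.
by rewrite ler_expR lerN2 invf_ge1// gerBl sqr_ge0.
Qed.

Lemma bump0_gt0 : 0 < bumpf 0.
Proof. by rewrite /bumpf /flat expr0n subr0 ltr01 hornerC mul1r expR_gt0. Qed.

(** A pointwise lower bound, to bound the mass of the packets from below. *)
Lemma bump_low y : `|y| <= 2^-1 -> expR (- 2) <= bumpf y.
Proof.
move=> y1; have y2 : y ^+ 2 <= 4^-1.
  rewrite -real_normK ?num_real// (_ : 4^-1 = (2^-1) ^+ 2) ?lerXn2r ?nnegrE//.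
    by rewrite expr2; lra.
have p : 0 < 1 - y ^+ 2 by lra.
rewrite /bumpf /flat p hornerC mul1r ler_expR lerN2 invf_ple ?posrE//.
lra.
Qed.

Definition bumpn (m : nat) : R -> R := iter m (fun f : R -> R => 'D_1 f) bumpf.

Lemma smooth_bumpn m : smooth (bumpn m).
Proof. by elim: m => [|m ih]; [exact: smooth_bump|exact: smooth_derive]. Qed.

Lemma is_derive_bumpn m (y : R) : is_derive y 1 (bumpn m) (bumpn m.+1 y).
Proof.
split => //; apply: diff_derivable; apply: smooth_differentiable.
exact: smooth_bumpn.
Qed.

Lemma bumpn_out m y : 1 < `|y| -> bumpn m y = 0.
Proof.
elim: m y => [|m ih] y y1.
  rewrite /bumpn /= /bumpf /flat ifF//; apply/negbTE; rewrite -leNgt subr_le0.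
  by rewrite -real_normK ?num_real// expr_ge1// ltW.
rewrite /bumpn /=.
have -> : 'D_1 (bumpn m) y = 'D_1 (cst 0 : R -> R) y; last by rewrite derive_cst.
apply: near_eq_derive => //.
near=> t; rewrite /= ih//; near: t.
by apply: (@cvgr_gt _ _ _ _ (fun x : R => `|x|)) y1; apply: cvg_norm; exact: cvg_id.
Unshelve. all: by end_near. Qed.

Lemma bumpn_bounded m : exists2 C, 0 < C & forall y, `|bumpn m y| <= C.
Proof.
have cb : continuous (fun y => `|bumpn m y|).
  move=> y; apply: cvg_norm; exact: (smooth_continuous (smooth_bumpn m)).
have [|c _ hc] := @EVT_max R (fun y => `|bumpn m y|) (-1) 1 _ (continuous_subspaceT cb).
  by rewrite -subr_ge0 opprK.
exists (`|bumpn m c| + 1) => [|y]; first by rewrite ltr_pwDr.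
have [y1|y1] := leP `|y| 1; last by rewrite bumpn_out// normr0 addr_ge0.
by apply: le_trans (hc _ _) _; rewrite ?lerDl// in_itv /= -ler_norml.
Qed.

End bump.

(** * Square integrable complex functions *)

Section complex_facts.
Context {R : realType}.
Implicit Types x y : R[i].

Lemma cReM x y : Re (x * y) = Re x * Re y - Im x * Im y.
Proof. by case: x y => a b [c d]. Qed.

Lemma cImM x y : Im (x * y) = Re x * Im y + Im x * Re y.
Proof. by case: x y => a b [c d]. Qed.

Lemma sqr_normcE x : normc x ^+ 2 = Re x ^+ 2 + Im x ^+ 2.
Proof. by case: x => a b; rewrite /= sqr_sqrtr ?addr_ge0 ?sqr_ge0. Qed.

Lemma normc_ge0 x : 0 <= normc x.
Proof. by case: x => a b; exact: sqrtr_ge0. Qed.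

Lemma normc_real (a : R) : normc a%:C%C = `|a|.
Proof. by rewrite /= expr0n addr0 sqrtr_sqr. Qed.

Lemma normc_le_add x : normc x <= `|Re x| + `|Im x|.
Proof.
rewrite -(@ler_pXn2r _ 2) ?nnegrE ?addr_ge0 ?normc_ge0// sqr_normcE sqrrD.
by rewrite !real_normK ?num_real// lerD2r lerDl mulrn_wge0// mulr_ge0.
Qed.

Lemma Re_le_normc x : `|Re x| <= normc x.
Proof.
by rewrite -(@ler_pXn2r _ 2) ?nnegrE ?normc_ge0// sqr_normcE real_normK ?num_real// lerDl sqr_ge0.
Qed.

Lemma Im_le_normc x : `|Im x| <= normc x.
Proof.
by rewrite -(@ler_pXn2r _ 2) ?nnegrE ?normc_ge0// sqr_normcE real_normK ?num_real// lerDr sqr_ge0.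
Qed.

Lemma normcN x : normc (- x) = normc x.
Proof. by case: x => a b /=; rewrite !sqrrN. Qed.

Lemma complexP x y : Re x = Re y -> Im x = Im y -> x = y.
Proof. by case: x y => a b [c d] /= -> ->. Qed.

End complex_facts.

Lemma eq_leW d (T : porderType d) (x y : T) : x = y -> (x <= y)%O.
Proof. by move=> ->. Qed.

Section ge0_integrals.
Local Open Scope ereal_scope.
Context {d} {T : measurableType d} {R : realType} (mu : {measure set T -> \bar R}).

(** The integral of a nonnegative function is a supremum over the simple functions
    below it, hence it is monotone on arbitrary functions. *)
Lemma ge0_le_integralT (f g : T -> \bar R) : (forall x, 0 <= f x) ->
  (forall x, f x <= g x) -> \int[mu]_x f x <= \int[mu]_x g x.
Proof.
move=> f0 fg; rewrite !ge0_integralTE//; last by move=> x; exact: le_trans (fg x).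
apply: le_ereal_sup => _ [h /= hf <-]; exists h => // x.
exact: le_trans (hf x) (fg x).
Qed.

Lemma le_LnormT (p : R) (f g : T -> \bar R) : (0 <= p)%R ->
  (forall x, `|f x| <= `|g x|) -> Lnorm mu p%:E f <= Lnorm mu p%:E g.
Proof.
move=> p0 fg; rewrite unlock; apply: gt0_ler_poweR; rewrite ?invr_ge0//.
- by rewrite in_itv/= leey andbT integral_ge0// => x _; exact: poweR_ge0.
- by rewrite in_itv/= leey andbT integral_ge0// => x _; exact: poweR_ge0.
apply: ge0_le_integralT => x; first exact: poweR_ge0.
by apply: gt0_ler_poweR => //; rewrite in_itv/= leey andbT abse_ge0.
Qed.

End ge0_integrals.

Section L2_space.
Context {d} {T : measurableType d} {R : realType} (mu : {measure set T -> \bar R}).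
Implicit Types (f g u v w : T -> R[i]).

Definition cmeasurable f : Prop :=
  measurable_fun [set: T] (fun x => Re (f x)) /\
  measurable_fun [set: T] (fun x => Im (f x)).

Lemma in_L2_cmeasurable f : in_L2 mu f -> cmeasurable f.
Proof. by case. Qed.

Lemma cmeasurableD f g : cmeasurable f -> cmeasurable g ->
  cmeasurable (fun x => f x + g x).
Proof.
move=> [rf jf] [rg jg]; split.
- rewrite (_ : (fun x => _) = (fun x => Re (f x)) \+ (fun x => Re (g x))).
    exact: measurable_funD.
  by apply/funext => x /=; case: (f x) (g x) => ? ? [].
- rewrite (_ : (fun x => _) = (fun x => Im (f x)) \+ (fun x => Im (g x))).
    exact: measurable_funD.
  by apply/funext => x /=; case: (f x) (g x) => ? ? [].
Qed.

Lemma cmeasurableM f g : cmeasurable f -> cmeasurable g ->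
  cmeasurable (fun x => f x * g x).
Proof.
move=> [rf jf] [rg jg]; split.
- under eq_fun do rewrite cReM.
  by apply: measurable_funB; exact: measurable_funM.
- under eq_fun do rewrite cImM.
  by apply: measurable_funD; exact: measurable_funM.
Qed.

Lemma cmeasurable_real (a : T -> R) : measurable_fun [set: T] a ->
  cmeasurable (fun x => (a x)%:C%C).
Proof. by move=> ma; split => //=; exact: measurable_cst. Qed.

Lemma cmeasurable_cst (c : R[i]) : cmeasurable (fun=> c).
Proof. by split; exact: measurable_cst. Qed.

Lemma cmeasurable_normc f : cmeasurable f ->
  measurable_fun [set: T] (fun x => normc (f x)).
Proof.
move=> [rf jf].
rewrite (_ : (fun x => _) = @Num.sqrt R \o
    ((fun x => Re (f x) ^+ 2) \+ (fun x => Im (f x) ^+ 2))).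
  apply: measurableT_comp.
    by apply: continuous_measurable_fun; exact: sqrt_continuous.
  by apply: measurable_funD; exact: measurable_funX.
by apply/funext => x /=; case: (f x).
Qed.

Local Open Scope ereal_scope.

(** The square of the norm is compared with real numbers by integrals alone, without
    roots. *)
Definition nsq f : \bar R := \int[mu]_x (normc (f x) ^+ 2)%:E.

Lemma nsq_ge0 f : 0 <= nsq f.
Proof. by apply: integral_ge0 => x _; rewrite lee_fin sqr_ge0. Qed.

Lemma cLnorm2E f : cLnorm mu 2%:E f = nsq f `^ 2^-1.
Proof.
rewrite /cLnorm unlock; congr (_ `^ _); apply: eq_integral => x _.
by rewrite abse_EFin poweR_EFin powR_mulrn ?normr_ge0// ger0_norm ?normc_ge0.
Qed.

Lemma cLnorm_ge0 p f : 0 <= cLnorm mu p f.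
Proof. exact: Lnorm_ge0. Qed.

Lemma nsqE f : nsq f = cLnorm mu 2%:E f `^ 2.
Proof. by rewrite cLnorm2E -poweRrM mulVf// poweRe1// nsq_ge0. Qed.

Lemma cLnorm2_le f (B : R) : (0 <= B)%R ->
  (cLnorm mu 2%:E f <= B%:E) = (nsq f <= (B ^+ 2)%:E).
Proof.
move=> B0; apply/idP/idP => h.
  rewrite nsqE -(powR_mulrn _ B0) -poweR_EFin.
  by apply: gt0_ler_poweR; rewrite // in_itv/= leey andbT ?cLnorm_ge0// lee_fin.
rewrite cLnorm2E (_ : B = ((B ^+ 2) `^ 2^-1)%R).
  rewrite -poweR_EFin; apply: gt0_ler_poweR => //; rewrite in_itv/= leey andbT ?nsq_ge0//.
  by rewrite lee_fin sqr_ge0.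
by rewrite -powR_mulrn// -powRrM mulfV// powRr1.
Qed.

Lemma cLnorm2_lty f : (cLnorm mu 2%:E f < +oo) = (nsq f < +oo).
Proof.
apply/idP/idP => h; first by rewrite nsqE; exact: poweR_lty.
by rewrite cLnorm2E; exact: poweR_lty.
Qed.

Lemma measurable_nsq f : cmeasurable f ->
  measurable_fun [set: T] (fun x => (normc (f x) ^+ 2)%:E).
Proof.
by move=> mf; apply/measurable_EFinP; apply: measurable_funX; exact: cmeasurable_normc.
Qed.

Lemma ae_le_cLnorm2 f g (M : R) : (0 <= M)%R -> cmeasurable f -> cmeasurable g ->
  {ae mu, forall x, (normc (f x) <= M * normc (g x))%R} ->
  cLnorm mu 2%:E f <= M%:E * cLnorm mu 2%:E g.
Proof.
move=> M0 mf mg [N [mN N0 hN]].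
rewrite !cLnorm2E (_ : M%:E = (M ^+ 2)%:E `^ 2^-1); last first.
  by rewrite poweR_EFin -powR_mulrn// -powRrM mulfV// powRr1.
rewrite -poweRM ?nsq_ge0 ?lee_fin ?sqr_ge0//; apply: gt0_ler_poweR => //.
- by rewrite in_itv/= leey andbT nsq_ge0.
- by rewrite in_itv/= leey andbT mule_ge0 ?nsq_ge0// lee_fin sqr_ge0.
rewrite /nsq -ge0_integralZl//; last 3 first.
- exact: measurable_nsq.
- by move=> x _; rewrite lee_fin sqr_ge0.
- by rewrite lee_fin sqr_ge0.
apply: ae_ge0_le_integral => //.
- by move=> x _; rewrite lee_fin sqr_ge0.
- exact: measurable_nsq.
- by move=> x _; rewrite mule_ge0 ?lee_fin ?sqr_ge0.
- by apply: measurable_funeM; exact: measurable_nsq.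
exists N; split => // x /= h; apply: hN => /= hx; apply: h => _.
by rewrite -EFinM lee_fin -exprMn lerXn2r ?nnegrE ?normc_ge0// mulr_ge0// normc_ge0.
Qed.

Lemma le_cLnorm2 f g (M : R) : (0 <= M)%R -> cmeasurable f -> cmeasurable g ->
  (forall x, (normc (f x) <= M * normc (g x))%R) ->
  cLnorm mu 2%:E f <= M%:E * cLnorm mu 2%:E g.
Proof. by move=> M0 mf mg h; apply: ae_le_cLnorm2 => //; exact: aeW. Qed.

Lemma ae_eq_cLnorm2 f g : cmeasurable f -> cmeasurable g -> aeeq mu f g ->
  cLnorm mu 2%:E f = cLnorm mu 2%:E g.
Proof.
move=> mf mg fg; apply/eqP; rewrite eq_le; apply/andP; split.
  rewrite -[leRHS]mul1e; apply: ae_le_cLnorm2 => //.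
  by apply: filterS fg => x ->; rewrite mul1r.
rewrite -[leRHS]mul1e; apply: ae_le_cLnorm2 => //.
by apply: filterS fg => x ->; rewrite mul1r.
Qed.

Lemma cLnormD f g : cmeasurable f -> cmeasurable g ->
  cLnorm mu 2%:E (fun x => f x + g x)%R <= cLnorm mu 2%:E f + cLnorm mu 2%:E g.
Proof.
move=> mf mg; rewrite /cLnorm.
apply: le_trans; last apply: (@minkowski_EFin _ _ _ mu _ _ 2) => //;
  last 3 first.
- exact: cmeasurable_normc mf.
- exact: cmeasurable_normc mg.
- by rewrite ler1n.
apply: le_LnormT => // x /=; rewrite lee_fin !ger0_norm ?addr_ge0 ?normc_ge0//.
exact: le_normcD.
Qed.

Lemma in_L2D f g : in_L2 mu f -> in_L2 mu g -> in_L2 mu (fun x => f x + g x)%R.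
Proof.
move=> [rf jf Lf] [rg jg Lg].
have [] := cmeasurableD (conj rf jf) (conj rg jg); split => //.
by apply: le_lt_trans (cLnormD _ _) _ => //; rewrite lte_add_pinfty.
Qed.

Lemma in_L2_le f g (M : R) : (0 <= M)%R -> cmeasurable f -> in_L2 mu g ->
  (forall x, (normc (f x) <= M * normc (g x))%R) -> in_L2 mu f.
Proof.
move=> M0 mf gL fg; have [rf jf] := mf; split => //.
apply: le_lt_trans (le_cLnorm2 M0 mf (in_L2_cmeasurable gL) fg) _.
by rewrite lte_mul_pinfty// ?lee_fin//; case: gL.
Qed.

Lemma in_L2M (c : R[i]) f : in_L2 mu f -> in_L2 mu (fun x => c * f x)%R.
Proof.
move=> fL; apply: (in_L2_le (normc_ge0 c) _ fL).
  by apply: cmeasurableM; [exact: cmeasurable_cst|exact: in_L2_cmeasurable].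
by move=> x; rewrite Normc.normcM.
Qed.

Lemma in_L2B f g : in_L2 mu f -> in_L2 mu g -> in_L2 mu (fun x => f x - g x)%R.
Proof.
move=> fL gL; rewrite (_ : (fun x => _) = (fun x => f x + (-1) * g x)%R).
  by apply: in_L2D => //; exact: in_L2M.
by apply/funext => x; rewrite mulN1r.
Qed.

Lemma in_L2_0 : in_L2 mu (fun=> 0%R).
Proof.
split; try exact: measurable_cst.
rewrite cLnorm2_lty /nsq integral0_eq// => x _.
by rewrite Normc.normc0 expr0n.
Qed.

Lemma integrable_nsq f : in_L2 mu f ->
  mu.-integrable [set: T] (fun x => (normc (f x) ^+ 2)%:E).
Proof.
move=> [rf jf Lf]; apply/integrableP; split; first exact: measurable_nsq.
move: Lf; rewrite cLnorm2_lty; apply: le_lt_trans.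
by under eq_integral do rewrite gee0_abs ?lee_fin ?sqr_ge0//.
Qed.

Lemma integrable_normcM f g : in_L2 mu f -> in_L2 mu g ->
  mu.-integrable [set: T] (fun x => (normc (f x) * normc (g x))%:E).
Proof.
move=> fL gL; have := integrableD measurableT (integrable_nsq fL) (integrable_nsq gL).
apply: le_integrable => //.
  by apply/measurable_EFinP; apply: measurable_funM; apply: cmeasurable_normc;
    apply: in_L2_cmeasurable.
move=> x _; rewrite lee_fin !ger0_norm ?addr_ge0 ?mulr_ge0 ?sqr_ge0 ?normc_ge0//.
by have := sqr_ge0 (normc (f x) - normc (g x))%R; have := normc_ge0 (f x);
  have := normc_ge0 (g x); nra.
Qed.

Lemma cmeasurable_conjc f : cmeasurable f -> cmeasurable (fun x => conjc (f x)).
Proof.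
move=> [rf jf]; split.
  by rewrite (_ : (fun x => _) = (fun x => Re (f x)))//; apply/funext => x; case: (f x).
rewrite (_ : (fun x => _) = \- (fun x => Im (f x)))%R.
  exact: measurableT_comp.
by apply/funext => x /=; case: (f x).
Qed.

Lemma cnormJ x : normc (conjc x) = normc x :> R.
Proof. by case: x => a b /=; rewrite sqrrN. Qed.

Lemma integrable_ReM f g : in_L2 mu f -> in_L2 mu g ->
  mu.-integrable [set: T] (fun x => (Re (f x * conjc (g x)))%:E).
Proof.
move=> fL gL; have := integrable_normcM fL gL; apply: le_integrable => //.
  apply/measurable_EFinP.
  have [] // : cmeasurable (fun x => f x * conjc (g x))%R.
  by apply: cmeasurableM; [|apply: cmeasurable_conjc]; exact: in_L2_cmeasurable.
move=> x _; rewrite lee_fin [leRHS]ger0_norm ?mulr_ge0 ?normc_ge0//.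
by apply: le_trans (Re_le_normc _) _; rewrite Normc.normcM cnormJ.
Qed.

Local Close Scope ereal_scope.

(** The real inner product is recovered from the norm by a single identity, hence
    transported by the isometry of a spectral representation. *)
Definition rip f g : R := Re (inner mu f g).

Lemma ripE f g : rip f g = \int[mu]_x Re (f x * conjc (g x)).
Proof. by []. Qed.

Lemma ripC f g : rip f g = rip g f.
Proof.
rewrite !ripE; apply: eq_Rintegral => x _.
by case: (f x) (g x) => a b [c e] /=; rewrite [a * c]mulrC; ring.
Qed.

Lemma ripDl f g v : in_L2 mu f -> in_L2 mu g -> in_L2 mu v ->
  rip (fun x => f x + g x) v = rip f v + rip g v.
Proof.
move=> fL gL vL; rewrite !ripE -RintegralD//; try exact: integrable_ReM.
by apply: eq_Rintegral => x _; rewrite !mulrDl; case: (_ * _) (_ * _) => ? ? [].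
Qed.

Lemma ripZl (a : R) f v : in_L2 mu f -> in_L2 mu v ->
  rip (fun x => a%:C%C * f x) v = a * rip f v.
Proof.
move=> fL vL; rewrite !ripE -RintegralZl//; last exact: integrable_ReM.
apply: eq_Rintegral => x _; rewrite -mulrA cReM /=.
by rewrite mul0r subr0.
Qed.

Lemma ripBl f g v : in_L2 mu f -> in_L2 mu g -> in_L2 mu v ->
  rip (fun x => f x - g x) v = rip f v - rip g v.
Proof.
move=> fL gL vL; rewrite !ripE -RintegralB//; try exact: integrable_ReM.
by apply: eq_Rintegral => x _; rewrite !mulrBl; case: (_ * _) (_ * _) => ? ? [].
Qed.

Lemma nsq_rip f : in_L2 mu f -> nsq f = (rip f f)%:E.
Proof.
move=> fL; rewrite ripE /Rintegral fineK.
  apply: eq_integral => x _; rewrite sqr_normcE.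
  by case: (f x) => a b /=; rewrite mulrN opprK !expr2.
by apply: integrable_fin_num => //; exact: integrable_ReM.
Qed.

Lemma nsqDZ (a : R) f g : in_L2 mu f -> in_L2 mu g ->
  nsq (fun x => f x + a%:C%C * g x) =
  (rip f f + a *+ 2 * rip g f + a ^+ 2 * rip g g)%:E.
Proof.
move=> fL gL; have aL := in_L2M a%:C%C gL.
rewrite nsq_rip; last exact: in_L2D.
rewrite ripDl ?[rip f _]ripC ?[rip _ (fun x => f x + _)]ripC ?ripDl//;
  try exact: in_L2D.
rewrite !ripZl ?[rip _ (fun x => _ * _)]ripC ?ripZl// ?[rip f g]ripC.
by congr EFin; ring.
Qed.

Lemma cauchy_schwarz f g : in_L2 mu f -> in_L2 mu g ->
  (`|rip f g|%:E <= cLnorm mu 2%:E f * cLnorm mu 2%:E g)%E.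
Proof.
move=> fL gL.
apply: (@le_trans _ _ (\int[mu]_x (normc (f x) * normc (g x))%:E)%E).
  rewrite ripE.
  apply: (@le_trans _ _ (\int[mu]_x (`|Re (f x * conjc (g x))|)%:E)%E).
    have h : mu.-integrable setT (EFin \o (fun x => `|Re (f x * conjc (g x))|)).
      by have := integrable_abse (integrable_ReM fL gL); apply: eq_integrable.
    rewrite -[leRHS](fineK (integrable_fin_num _ h))//.
    by rewrite lee_fin; apply: le_normr_Rintegral => //; exact: integrable_ReM.
  apply: ge0_le_integralT => x; first by rewrite lee_fin.
  by rewrite lee_fin (le_trans (Re_le_normc _))// Normc.normcM cnormJ.
rewrite /cLnorm; apply: le_trans; last first.
  apply: (@hoelder _ _ _ mu (fun x => normc (f x)) (fun x => normc (g x)) 2 2) => //.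
  - by apply: cmeasurable_normc; exact: in_L2_cmeasurable.
  - by apply: cmeasurable_normc; exact: in_L2_cmeasurable.
  - by rewrite [RHS]splitr !div1r.
rewrite Lnorm1; apply: ge0_le_integralT => x /=.
  by rewrite lee_fin mulr_ge0 ?normc_ge0.
by rewrite lee_fin ger0_norm// mulr_ge0 ?normc_ge0.
Qed.

Lemma cvg_rip (v : nat -> T -> R[i]) u g : (forall n, in_L2 mu (v n)) ->
  in_L2 mu u -> in_L2 mu g ->
  (cLnorm mu 2%:E (v n \- u)%R @[n --> \oo] --> (0 : \bar R))%E ->
  rip (v n) g @[n --> \oo] --> rip u g.
Proof.
move=> vL uL gL vu; apply/subr_cvg0; apply/norm_cvg0P.
have gfin : cLnorm mu 2%:E g \is a fin_num.
  by rewrite ge0_fin_numE ?cLnorm_ge0//; case: gL.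
have key : (EFin \o (fun n => `|rip (v n) g - rip u g|)) @ \oo --> 0%:E.
  apply: (@squeeze_cvge _ _ _ _ (cst 0%E) _
    (fun n => cLnorm mu 2%:E (v n \- u)%R * cLnorm mu 2%:E g)%E).
  - near=> n; rewrite lee_fin normr_ge0 /= -ripBl//.
    by apply: cauchy_schwarz => //; exact: in_L2B.
  - exact: cvg_cst.
  - have := cvgeZr gfin vu; rewrite mul0e; exact.
by move/fine_cvgP: key => [_].
Unshelve. all: by end_near. Qed.

End L2_space.

(** * Functional calculus of a nonnegative operator *)

Section friedrichs_positivity.
Context {d} {T : measurableType d} {R : realType} (mu : {measure set T -> \bar R}).

(** For approximants [v m], [v n] of [u] in the form domain, polarisation gives
    [2 <v m, A (v n)> = <A (v m), v m> + <A (v n), v n> - <A (v m - v n), v m - v n>],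
    which is at least [- e] for large indices. Letting first [m], then [n], tend to
    infinity turns the left-hand side into [2 <w, u>]. *)
Lemma friedrichs_ge0 (D : set (T -> R[i])) (A : (T -> R[i]) -> T -> R[i])
    (u w : T -> R[i]) :
  (forall v, D v -> in_L2 mu v) -> (forall v, D v -> in_L2 mu (A v)) ->
  (forall v v', D v -> D v' -> D (v \- v') /\ A (v \- v') = A v \- A v') ->
  (forall v v', D v -> D v' -> rip mu (A v) v' = rip mu v (A v')) ->
  (forall v, D v -> 0 <= rip mu (A v) v) ->
  friedrichs mu D A u w -> 0 <= rip mu w u.
Proof.
move=> DL AL DB sym pos [uL wL [v [Dv vu vC]] adj].
have key n m : rip mu (v m) (A (v n)) =
    2^-1 * (rip mu (A (v m)) (v m) + rip mu (A (v n)) (v n) -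
    rip mu (A (v m \- v n)) (v m \- v n)).
  have [_ ->] := DB _ _ (Dv m) (Dv n).
  have vL k : in_L2 mu (v k) by exact: DL.
  have AvL k : in_L2 mu (A (v k)) by exact: AL.
  rewrite ripBl//; last exact: in_L2B.
  rewrite ![rip mu _ (v m \- v n)]ripC !ripBl// -(sym _ _ (Dv m) (Dv n)).
  rewrite [rip mu (v n) (A (v m))]ripC [rip mu (v m) (A (v m))]ripC.
  by rewrite [rip mu (v n) (A (v n))]ripC; lra.
have hA e : 0 < e -> - e <= rip mu w u.
  move=> e0; have [N hN] := vC _ e0.
  have hn n : (N <= n)%N -> - e <= rip mu (v n) w.
    move=> Nn; rewrite ripC.
    have -> : rip mu w (v n) = rip mu u (A (v n)).
      by rewrite /rip -adj.
    have cv : rip mu (v m) (A (v n)) @[m --> \oo] --> rip mu u (A (v n)).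
      apply: cvg_rip => //; first by move=> k; exact: DL.
      exact: AL.
    rewrite -(cvg_lim _ cv)//; apply: limr_ge; first by apply/cvg_ex; eexists; exact: cv.
    near=> m; rewrite key.
    have := hN m n; rewrite -[complex.Re _]/(rip mu _ _) => /(_ _ Nn) h.
    have {h} := h _; rewrite (_ : (N <= m)%N); last by near: m; exact: nbhs_infty_ge.
    move=> /(_ isT); have := pos _ (Dv m); have := pos _ (Dv n); lra.
  have cv : rip mu (v n) w @[n --> \oo] --> rip mu u w.
    by apply: cvg_rip => // k; exact: DL.
  rewrite ripC -(cvg_lim _ cv)//; apply: limr_ge; first by apply/cvg_ex; eexists; exact: cv.
  by near=> n; apply: hn; near: n; exact: nbhs_infty_ge.
by rewrite leNgt; apply/negP => h; have := hA (- rip mu w u / 2); lra.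
Unshelve. all: by end_near. Qed.

End friedrichs_positivity.

Section spectral.
Context {d} {T : measurableType d} {R : realType} (mu : {measure set T -> \bar R}).
Variable H : (T -> R[i]) -> (T -> R[i]) -> Prop.
Variable S : spectral_rep mu H.
Local Notation nu := (sr_meas S).
Local Notation U := (sr_U S).
Local Notation sy := (symb S).
Local Notation msymb := (@measurable_symb _ _ _ _ _ S).

Lemma cmeasurable_symb (f : R -> R[i]) (g : sr_space S -> R[i]) :
  cmeasurable f -> cmeasurable g -> cmeasurable (fun y => f (sy y) * g y).
Proof.
move=> [rf jf] mg; apply: cmeasurableM => //.
by split; [exact: (measurableT_comp rf msymb)|
  exact: (measurableT_comp jf msymb)].
Qed.

Lemma sr_U_cmeas u : in_L2 mu u -> cmeasurable (U u).
Proof. by move=> uL; apply: (in_L2_cmeasurable (mu := nu)); exact: sr_U_L2. Qed.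

Lemma sr_U_rip u w : in_L2 mu u -> in_L2 mu w -> rip nu (U w) (U u) = rip mu w u.
Proof.
move=> uL wL; have L := sr_U_L2.
have e1 v : in_L2 mu v -> rip nu (U v) (U v) = rip mu v v.
  move=> vL; apply: EFin_inj; rewrite -!nsq_rip//; last exact: L.
  by rewrite !nsqE sr_U_isometry.
have := sr_U_linear S 1 uL wL => lin.
have := @nsqDZ _ _ _ mu 1 u w uL wL.
have := @nsqDZ _ _ _ nu 1 (U u) (U w) (L _ _ _ _ _ S u uL) (L _ _ _ _ _ S w wL).
have -> : nsq nu (fun x => U u x + 1%:C%C * U w x) =
          nsq mu (fun x => u x + 1%:C%C * w x).
  have suL : in_L2 mu (fun x => 1 * u x + w x).
    by apply: in_L2D => //; exact: in_L2M.
  rewrite (_ : (fun x => u x + 1%:C%C * w x) = (fun x => 1 * u x + w x)); last first.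
    by apply/funext => x; rewrite !mul1r.
  rewrite [RHS]nsqE -(sr_U_isometry S suL) nsqE; congr (_ `^ _)%E.
  apply: ae_eq_cLnorm2.
  - apply: cmeasurableD; first exact: sr_U_cmeas.
    by apply: cmeasurableM; [exact: cmeasurable_cst|exact: sr_U_cmeas].
  - exact: sr_U_cmeas.
  by apply: filterS lin => y ->; rewrite !mul1r.
by move=> -> [] ; rewrite !e1//; lra.
Qed.

(** A nonnegative operator has a nonnegative symbol: the indicator of a bounded
    part of [symb < 0] would otherwise have negative energy. *)
Lemma symb_ge0 : (forall u w, H u w -> in_L2 mu u -> in_L2 mu w -> 0 <= rip mu w u) ->
  {ae nu, forall y, 0 <= sy y}.
Proof.
move=> Hpos; have [F FT Ffin] := sigma_finiteT nu.
pose E (n m : nat) : set (sr_space S) := F n `&` (sy @^-1` `[- m%:R, 0[).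
have mE n m : measurable (E n m).
  apply: measurableI; first by have [] := Ffin n.
  by rewrite -[X in measurable X]setTI; apply: msymb.
have hE n m : {ae nu, forall y, ~ E n m y}.
  have mI : measurable_fun setT (\1_(E n m) : sr_space S -> R) by exact: measurable_indic.
  pose g := fun y => ((\1_(E n m) y : R))%:C%C.
  pose k := fun y => ((sy y * \1_(E n m) y : R))%:C%C.
  have gL : in_L2 nu g.
    split; [exact: mI|exact: measurable_cst|].
    rewrite cLnorm2_lty /nsq; under eq_integral do rewrite normc_real.
    apply: (@le_lt_trans _ _ (\int[nu]_x (\1_(E n m) x)%:E)%E).
      apply: ge0_le_integralT => x; first by rewrite lee_fin sqr_ge0.
      by rewrite lee_fin indicE; case: (_ \in _); rewrite ?normr1 ?normr0 ?expr1n ?expr0n.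
    rewrite integral_indic// setIT; have [mF Fn] := Ffin n.
    apply: le_lt_trans Fn; apply: le_measure; rewrite ?inE//; exact: subIsetl.
  have kL : in_L2 nu k.
    apply: (@in_L2_le _ _ _ _ _ g m%:R) => //.
      by apply: cmeasurable_real; apply: measurable_funM => //; exact: msymb.
    move=> y; rewrite !normc_real normrM indicE.
    have [|_] := boolP (y \in _); last by rewrite !normr0 !mulr0.
    rewrite inE => -[_ /=]; rewrite in_itv/= => /andP[h1 h2].
    by rewrite normr1 !mulr1 ltr0_norm// lerNl.
  have [u uL Uu] := sr_U_onto gL.
  have [w wL Uw] := sr_U_onto kL.
  have Huw : H u w.
    apply/(sr_diag S) => //; move: Uu Uw; apply: filterS2 => y -> ->.
    by apply: complexP => //=; rewrite ?mulr0 ?subr0 ?mul0r ?addr0.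
  have : 0 <= rip nu (U w) (U u) by rewrite sr_U_rip// Hpos.
  pose f := fun y => (- (sy y * \1_(E n m) y : R))%:E.
  have f0 y : (0 <= f y)%E.
    rewrite lee_fin indicE; have [|_] := boolP (y \in _); last by rewrite mulr0 oppr0.
    rewrite inE => -[_ /=]; rewrite in_itv/= => /andP[h1 h2].
    by rewrite mulr1 oppr_ge0 ltW.
  have mf : measurable_fun setT f.
    apply/measurable_EFinP; apply: measurableT_comp => //.
    by apply: measurable_funM => //; exact: msymb.
  rewrite ripE /Rintegral.
  have -> : (\int[nu]_x (Re (U w x * conjc (U u x)))%:E = - \int[nu]_x f x)%E.
    rewrite -integral_ge0N//; apply: ae_eq_integral => //.
    - apply/measurable_EFinP.
      have [] // : cmeasurable (fun x => U w x * conjc (U u x)).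
      apply: cmeasurableM; first exact: sr_U_cmeas.
      by apply: cmeasurable_conjc; exact: sr_U_cmeas.
    - exact: measurableT_comp.
    move: Uu Uw; apply: filterS2 => y -> -> _ /=.
    rewrite oppr0 mulr0 subr0 opprK indicE.
    by case: (_ \in _); rewrite ?mulr1 ?mulr0.
  have fint : (\int[nu]_x f x)%E \is a fin_num.
    apply: integrable_fin_num => //.
    apply: (le_integrable measurableT mf _ (integrableZl measurableT m%:R (integrable_nsq gL))).
    move=> y _; rewrite lee_fin normc_real indicE normrN normrM.
    have [|_] := boolP (y \in _); last by rewrite !normr0 expr0n !mulr0 normr0.
    rewrite inE => -[_ /=]; rewrite in_itv/= => /andP[h1 h2].
    by rewrite !(normr1, expr1n, mulr1) ltr0_norm// normr_nat lerNl.
  rewrite fineN oppr_ge0 => hf.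
  have f00 : (\int[nu]_x `|f x| = 0)%E.
    under eq_integral do rewrite gee0_abs//.
    apply/eqP; rewrite eq_le integral_ge0// andbT.
    by rewrite -(fineK fint) lee_fin.
  have /ae_eq_integral_abs := f00.
  move=> /(_ measurableT mf); apply: filterS => y /(_ I) /= fy0 Ey.
  have := fy0; rewrite /f indicE mem_set// => -[] /eqP.
  rewrite mulr1 oppr_eq0 => /eqP s0; case: Ey => _ /=.
  by rewrite in_itv/= s0 ltxx andbF.
have : {ae nu, forall y, forall n m, ~ E n m y}.
  by apply: ae_foralln => n; apply: ae_foralln => m; exact: hE.
apply: filterS => y h; rewrite leNgt; apply/negP => sy0.
have [n _ Fny] : (\bigcup_n F n) y by rewrite -FT.
pose m := Num.bound (- sy y).
apply: (h n m); split => //=; rewrite in_itv/= sy0 andbT lerNl.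
by apply/ltW/archi_boundP; rewrite oppr_ge0 ltW.
Qed.

(** Outside the domain of [f(H)] the value is [0] by convention, which satisfies any
    bound. *)
Lemma fcalc_norm_le f u (M : \bar R) : cmeasurable f -> in_L2 mu u ->
  (cLnorm nu 2%:E (fun y => (f (sy y) * U u y)%R) <= M -> 0 <= M ->
  cLnorm mu 2%:E (fcalc S f u) <= M)%E.
Proof.
move=> mf uL hM M0; rewrite /fcalc; set P := [set w | _].
have [[w Pw]|nP] := pselect (exists w, P w).
  have /= [wL wE] := xgetPex (fun=> 0) (ex_intro P w Pw).
  rewrite -(sr_U_isometry S wL) (ae_eq_cLnorm2 _ _ wE)//; first exact: sr_U_cmeas.
  by apply: cmeasurable_symb => //; exact: sr_U_cmeas.
rewrite xgetPN; last by move=> w Pw; apply: nP; exists w.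
rewrite cLnorm2E /nsq integral0_eq ?poweR0r// => x _.
by rewrite Normc.normc0 expr0n.
Qed.

Lemma fcalcP f u (M : R) : cmeasurable f -> (forall l, normc (f l) <= M) ->
  in_L2 mu u -> in_L2 mu (fcalc S f u) /\
  aeeq nu (U (fcalc S f u)) (fun y => f (sy y) * U u y).
Proof.
move=> mf fM uL.
have M0 : 0 <= M by apply: le_trans (fM 0); exact: normc_ge0.
have gL : in_L2 nu (fun y => f (sy y) * U u y).
  apply: (in_L2_le M0 _ (sr_U_L2 S uL)).
    by apply: cmeasurable_symb => //; exact: sr_U_cmeas.
  by move=> y; rewrite Normc.normcM ler_wpM2r ?normc_ge0.
have [w wL Uw] := sr_U_onto gL.
exact: (xgetPex (fun=> 0) (ex_intro (fun w => in_L2 mu w /\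
    aeeq nu (U w) (fun y => f (sy y) * U u y)) w (conj wL Uw))).
Qed.

Lemma sr_UD u v : in_L2 mu u -> in_L2 mu v ->
  aeeq nu (U (fun x => u x + v x)) (fun y => U u y + U v y).
Proof.
move=> uL vL; have := sr_U_linear S 1 uL vL.
rewrite (_ : (fun x => 1 * u x + v x) = (fun x => u x + v x)); last first.
  by apply/funext => x; rewrite mul1r.
by apply: filterS => y ->; rewrite mul1r.
Qed.

Lemma sr_UZ (c : R[i]) u : in_L2 mu u ->
  aeeq nu (U (fun x => c * u x)) (fun y => c * U u y).
Proof.
move=> uL; have l0 := sr_U_linear S (-1) (in_L2_0 mu) (in_L2_0 mu).
have := sr_U_linear S c uL (in_L2_0 mu); move: l0; apply: filterS2 => y.
rewrite (_ : (fun x : T => -1 * 0 + 0) = (fun=> 0)); last first.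
  by apply/funext => x; rewrite mulr0 addr0.
rewrite (_ : (fun x => c * u x + 0) = (fun x => c * u x)); last first.
  by apply/funext => x; rewrite addr0.
by move=> -> ->; rewrite mulN1r addNr addr0.
Qed.

Lemma sr_UB u v : in_L2 mu u -> in_L2 mu v ->
  aeeq nu (U (fun x => u x - v x)) (fun y => U u y - U v y).
Proof.
move=> uL vL; have h1 := sr_UD uL (in_L2M (-1) vL).
move: h1 (sr_UZ (-1) vL); apply: filterS2 => y.
rewrite (_ : (fun x => u x + -1 * v x) = (fun x => u x - v x)); last first.
  by apply/funext => x; rewrite mulN1r.
by move=> -> ->; rewrite mulN1r.
Qed.

(** With [y = h^2 (1 + l)] this is [y ^ (s / 2) <= 1 + y], for exponents at most [1]. *)
Lemma powR_interp (s s' h l : R) : s <= s' -> 0 <= s' <= 2 -> 0 < h <= 1 -> 0 <= l ->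
  (1 + l) `^ (s / 2) <= h `^ (- s') * (1 + h ^+ 2 * (1 + l)).
Proof.
move=> ss' /andP[s0 s2] /andP[h0 h1] l0.
apply: (@le_trans _ _ ((1 + l) `^ (s' / 2))).
  by apply: ler_powR; rewrite ?lerDl// ler_pM2r.
have -> : (1 + l) `^ (s' / 2) = h `^ (- s') * (h ^+ 2 * (1 + l)) `^ (s' / 2).
  rewrite powRM ?sqr_ge0 ?addr_ge0// -powR_mulrn ?(ltW h0)// -powRrM.
  rewrite (_ : 2 * (s' / 2) = s'); last by rewrite mulrC divfK.
  rewrite mulrA -powRD ?addNr ?powRr0 ?mul1r//.
  by rewrite (gt_eqF h0) implybT.
rewrite ler_wpM2l ?powR_ge0//.
set y := h ^+ 2 * _; have y0 : 0 <= y by rewrite mulr_ge0 ?sqr_ge0 ?addr_ge0.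
have [y1|y1] := leP y 1.
  apply: (@le_trans _ _ 1); last by rewrite lerDl.
  have e1 : (1 : R) `^ (s' / 2) = 1 by rewrite powR1.
  rewrite -[leRHS]e1; apply: ge0_ler_powR; rewrite ?nnegrE//.
  by rewrite divr_ge0.
apply: (@le_trans _ _ (y `^ 1)); last by rewrite powRr1// lerDr.
by apply: ler_powR; rewrite ?ler_pdivrMr ?mul1r// ltW.
Qed.

(** Interpolation at frequency [1/h]: Sobolev norms of order at most [2] are controlled
    by the norms of [u] and [H u]. A negative order [s] is allowed through [s']. *)
Lemma sobolev_le u w (s s' h a b : R) : {ae nu, forall y, 0 <= sy y} ->
  H u w -> in_L2 mu u -> in_L2 mu w -> s <= s' -> 0 <= s' <= 2 -> 0 < h <= 1 ->
  (cLnorm mu 2%:E u <= a%:E -> cLnorm mu 2%:E w <= b%:E ->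
  cLnorm mu 2%:E (fcalc S (fun l => ((1 + l) `^ (s / 2))%:C%C) u) <=
  (h `^ (- s') * (2 * a + h ^+ 2 * b))%:E)%E.
Proof.
move=> sy0 Huw uL wL ss' s'02 h01 ua wb.
have [h0 h1] := andP h01.
have a0 : 0 <= a by rewrite -lee_fin; exact: le_trans (cLnorm_ge0 _ _ _) ua.
have b0 : 0 <= b by rewrite -lee_fin; exact: le_trans (cLnorm_ge0 _ _ _) wb.
have mf : cmeasurable (fun l : R => ((1 + l) `^ (s / 2))%:C%C).
  apply: cmeasurable_real; apply: (measurableT_comp (measurable_powR _)).
  exact: measurable_funD.
apply: fcalc_norm_le => //; last first.
  by rewrite lee_fin mulr_ge0 ?powR_ge0// addr_ge0// mulr_ge0// sqr_ge0.
have hwL := in_L2M (h ^+ 2)%:C%C wL; have huL := in_L2M (1 + h ^+ 2)%:C%C uL.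
pose k := fun x => (h ^+ 2)%:C%C * w x + (1 + h ^+ 2)%:C%C * u x.
have L : in_L2 mu k by exact: in_L2D.
have Uk : aeeq nu (U k) (fun y => (1 + h ^+ 2 * (1 + sy y))%:C%C * U u y).
  have l1 := sr_UD hwL huL; have l2 := sr_UZ (h ^+ 2)%:C%C wL.
  have l3 := sr_UZ (1 + h ^+ 2)%:C%C uL; have /(sr_diag S uL wL) Uw := Huw.
  near=> y.
  have -> : U k y = U (fun x => (h ^+ 2)%:C%C * w x) y +
      U (fun x => (1 + h ^+ 2)%:C%C * u x) y by near: y; exact: l1.
  have -> : U (fun x => (h ^+ 2)%:C%C * w x) y = (h ^+ 2)%:C%C * U w y by near: y; exact: l2.
  have -> : U (fun x => (1 + h ^+ 2)%:C%C * u x) y = (1 + h ^+ 2)%:C%C * U u y.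
    by near: y; exact: l3.
  have -> : U w y = (sy y)%:C%C * U u y by near: y; exact: Uw.
  by rewrite mulrA -mulrDl; congr (_ * _); apply: complexP => /=; ring.
apply: (@le_trans _ _ ((h `^ (- s'))%:E * cLnorm nu 2%:E (U k))%E).
  apply: ae_le_cLnorm2; first exact: powR_ge0.
  - by apply: (cmeasurable_symb mf); exact: sr_U_cmeas.
  - exact: sr_U_cmeas.
  move: sy0 Uk; apply: filterS2 => y sy0 ->.
  rewrite !Normc.normcM !normc_real mulrA ler_wpM2r ?normc_ge0//.
  rewrite !ger0_norm ?powR_ge0//; first exact: powR_interp.
  by rewrite addr_ge0// mulr_ge0 ?sqr_ge0// addr_ge0.
rewrite (sr_U_isometry S L) EFinM lee_wpmul2l ?lee_fin ?powR_ge0//.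
have [wc uc] := (in_L2_cmeasurable hwL, in_L2_cmeasurable huL).
apply: (le_trans (cLnormD mu wc uc)).
rewrite [leRHS]EFinD [leLHS]addeC.
apply: leeD.
  apply: (@le_trans _ _ (2%:E * cLnorm mu 2%:E u)%E).
    apply: le_cLnorm2; rewrite ?ler0n//; first exact: in_L2_cmeasurable uL.
    move=> x; rewrite Normc.normcM normc_real ler_wpM2r ?normc_ge0//.
    rewrite ger0_norm ?addr_ge0 ?sqr_ge0// -[2]/(1 + 1) lerD2l.
    by rewrite expr_le1// ltW.
  by rewrite EFinM lee_wpmul2l.
apply: (@le_trans _ _ ((h ^+ 2)%:E * cLnorm mu 2%:E w)%E).
  apply: le_cLnorm2; rewrite ?sqr_ge0//; first exact: in_L2_cmeasurable wL.
  by move=> x; rewrite Normc.normcM normc_real ger0_norm ?sqr_ge0.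
by rewrite [leRHS]EFinM lee_wpmul2l// lee_fin sqr_ge0.
Unshelve. all: by end_near. Qed.

End spectral.

(** * Approximate solutions follow the exact evolution *)

Section exponential.
Context {R : realType}.

Lemma mvt_bound (f df : R -> R) (x : R) (M : R) :
  (forall y : R, is_derive y 1 f (df y)) -> (forall y, `|y| <= `|x| -> `|df y| <= M) ->
  `|f x - f 0| <= M * `|x|.
Proof.
move=> hd hb.
have cf a b : {within `[a, b], continuous f}.
  apply: continuous_subspaceT => z; apply: differentiable_continuous.
  by apply/derivable1_diffP; have [] := hd z.
have [x0|x0|->] := ltgtP x 0; last by rewrite subrr !normr0 mulr0.
- have [c] := MVT x0 (fun y _ => hd y) (cf _ _).
  rewrite in_itv/= => /andP[c1 c2] e.
  rewrite distrC e normrM sub0r normrN ler_wpM2r//; apply: hb.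
  by rewrite !ltr0_norm// lerN2 ltW.
- have [c] := MVT x0 (fun y _ => hd y) (cf _ _).
  rewrite in_itv/= => /andP[c1 c2] ->.
  rewrite normrM subr0 ler_wpM2r//; apply: hb.
  by rewrite !gtr0_norm// ltW.
Qed.

Definition expNi (x : R) : R[i] := (cos x -i* sin x)%C.

Lemma expNiD x y : expNi (x + y) = expNi x * expNi y.
Proof.
by apply: complexP; rewrite ?cReM ?cImM /= ?cosD ?sinD; ring.
Qed.

Lemma expNi0 : expNi 0 = 1.
Proof. by apply: complexP; rewrite /= ?cos0 ?sin0 ?oppr0. Qed.

Lemma normc_expNi x : normc (expNi x) = 1.
Proof. by rewrite /= sqrrN cos2Dsin2 sqrtr1. Qed.

Lemma cmeasurable_expNi (t : R) : cmeasurable (fun l : R => expNi (t * l)).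
Proof.
have m : measurable_fun [set: R] (fun l : R => t * l) by exact: measurable_funM.
split => /=.
  have mc : measurable_fun [set: R] (@cos R).
    by apply: continuous_measurable_fun; exact: continuous_cos.
  exact: (measurableT_comp mc m).
apply: measurableT_comp => //.
have mc : measurable_fun [set: R] (@sin R).
  by apply: continuous_measurable_fun; exact: continuous_sin.
exact: (measurableT_comp mc m).
Qed.

Lemma expNi_taylor x : normc (1 - 'i%C * x%:C%C - expNi x) <= 3 * x ^+ 2.
Proof.
have hs (y : R) : `|sin y| <= `|y|.
  have := @mvt_bound sin cos y 1 (fun z => is_derive_sin z).
  by rewrite sin0 subr0 mul1r; apply => z _; rewrite ler_norml cos_geN1 cos_le1.
have hc (y : R) : `|cos y - 1| <= y ^+ 2.
  have := @mvt_bound cos (fun z => - sin z) y `|y| (fun z => is_derive_cos z).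
  rewrite cos0 -expr2 real_normK ?num_real//; apply => z zy.
  by rewrite normrN (le_trans (hs z)).
have hs2 (y : R) : `|sin y - y| <= 2 * y ^+ 2.
  have [y1|y1] := leP `|y| 1; last first.
    have : `|sin y - y| <= 2 * `|y|.
      by apply: le_trans (ler_normB _ _) _; have := hs y; lra.
    move/le_trans; apply; rewrite ler_pM2l// -[leRHS]real_normK ?num_real//.
    by rewrite expr2 ler_peMl// ltW.
  have := @mvt_bound (fun z => sin z - z) (fun z => cos z - 1) y (`|y|).
  rewrite sin0 !subr0 -expr2 real_normK ?num_real// => H.
  apply: (@le_trans _ _ (y ^+ 2)); last by have := sqr_ge0 y; lra.
  apply: H => z zy; rewrite (le_trans (hc z))// -[leLHS]real_normK ?num_real//.
  rewrite expr2; apply: (le_trans _ zy); rewrite ler_piMr//.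
  exact: le_trans zy y1.
apply: le_trans (normc_le_add _) _.
have -> : Re (1 - 'i%C * x%:C%C - expNi x) = - (cos x - 1) by rewrite /=; ring.
have -> : Im (1 - 'i%C * x%:C%C - expNi x) = sin x - x by rewrite /=; ring.
by rewrite normrN; have := hc x; have := hs2 x; lra.
Qed.

End exponential.

Section propagation.
Context {d} {T : measurableType d} {R : realType} (mu : {measure set T -> \bar R}).
Variable H : (T -> R[i]) -> (T -> R[i]) -> Prop.
Variable S : spectral_rep mu H.
Local Notation nu := (sr_meas S).
Local Notation U := (sr_U S).
Local Notation sy := (symb S).

Variables (phi : R -> R[i]) (K : R).
Hypothesis mphi : cmeasurable phi.
Hypothesis phi1 : forall l : R, normc (phi l) <= 1.
Hypothesis phiK : forall l : R, phi l != 0 -> `|l| <= K.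

Variables (u w : R -> T -> R[i]) (T0 M eps C : R).
Hypothesis T0_ge0 : 0 <= T0.
Hypothesis uL : forall t : R, 0 <= t <= T0 -> in_L2 mu (u t).
Hypothesis wL : forall t : R, 0 <= t <= T0 -> in_L2 mu (w t).
Hypothesis Huw : forall t : R, 0 <= t <= T0 -> H (u t) (w t).
Hypothesis uM : forall t : R, 0 <= t <= T0 -> (cLnorm mu 2%:E (u t) <= M%:E)%E.
Hypothesis step : forall t tau : R, 0 <= t -> 0 <= tau -> t + tau <= T0 ->
  (cLnorm mu 2%:E (fun x => (u (t + tau)%R x - u t x + 'i%C * tau%:C%C * w t x)%R)
   <= (tau * eps + C * tau ^+ 2)%:E)%E.

Let cm (t : R) : 0 <= t <= T0 -> cmeasurable (U (u t)).
Proof. by move=> t0; apply: sr_U_cmeas; exact: uL. Qed.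

(** The difference between the approximate and the exact solution, seen through the
    cutoff [phi], which makes the generator bounded by [K]. *)
Let defect (t : R) : sr_space S -> R[i] :=
  fun y => phi (sy y) * (U (u t) y - expNi (t * sy y) * U (u 0) y).

Let T00 : 0 <= (0 : R) <= T0. Proof. by rewrite lexx. Qed.

Let cm_defect (t : R) : 0 <= t <= T0 -> cmeasurable (defect t).
Proof.
move=> t0; apply: (cmeasurable_symb mphi).
have -> : (fun y => U (u t) y - expNi (t * sy y) * U (u 0) y) =
  (fun y => U (u t) y + (-1) * (expNi (t * sy y) * U (u 0) y)).
  by apply/funext => y; rewrite mulN1r.
apply: cmeasurableD; first exact: cm.
apply: cmeasurableM; first exact: cmeasurable_cst.
by apply: (cmeasurable_symb (cmeasurable_expNi t)); exact: cm.
Qed.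

(** The exact evolution over [tau] is unitary. The other errors are the consistency
    of [u], and the Taylor remainder of the exponential on the support of [phi]. *)
Let defect_step (t tau : R) : 0 <= t -> 0 <= tau -> t + tau <= T0 ->
  (cLnorm nu 2%:E (defect (t + tau)) <= cLnorm nu 2%:E (defect t) +
    (tau * eps + (C + 3 * K ^+ 2 * M) * tau ^+ 2)%:E)%E.
Proof.
move=> t0 tau0 tT.
have tt : 0 <= t <= T0 by rewrite t0 /=; lra.
have tt' : 0 <= t + tau <= T0 by rewrite addr_ge0.
pose r := fun x => u (t + tau) x - u t x + 'i%C * tau%:C%C * w t x.
have rL : in_L2 mu r.
  by apply: in_L2D; [apply: in_L2B; exact: uL|apply: in_L2M; exact: wL].
have Ur : aeeq nu (U r) (fun y => U (u (t + tau)) y - U (u t) y +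
    'i%C * (tau * sy y)%:C%C * U (u t) y).
  have dL := in_L2B (uL tt') (uL tt).
  have h1 := sr_UD S dL (in_L2M ('i%C * tau%:C%C) (wL tt)).
  have h2 := sr_UB S (uL tt') (uL tt).
  have h3 := sr_UZ S ('i%C * tau%:C%C) (wL tt).
  have h4 := proj1 (sr_diag S (uL tt) (wL tt)) (Huw tt).
  near=> y.
  have -> : U r y = U (fun x => u (t + tau) x - u t x) y +
      U (fun x => 'i%C * tau%:C%C * w t x) y by near: y; exact: h1.
  have -> : U (fun x => u (t + tau) x - u t x) y = U (u (t + tau)) y - U (u t) y.
    by near: y; exact: h2.
  have -> : U (fun x => 'i%C * tau%:C%C * w t x) y = 'i%C * tau%:C%C * U (w t) y.
    by near: y; exact: h3.
  have -> : U (w t) y = (sy y)%:C%C * U (u t) y by near: y; exact: h4.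
  by rewrite rmorphM /= !mulrA.
pose a := fun y => phi (sy y) * U r y.
pose b := fun y => phi (sy y) * ((1 - 'i%C * (tau * sy y)%:C%C - expNi (tau * sy y)) * U (u t) y).
pose c := fun y => expNi (tau * sy y) * defect t y.
have ma : cmeasurable a by apply: (cmeasurable_symb mphi); exact: sr_U_cmeas.
have mb : cmeasurable b.
  apply: (cmeasurable_symb mphi).
  apply: (@cmeasurable_symb _ _ _ _ _ S
    (fun l => 1 - 'i%C * (tau * l)%:C%C - expNi (tau * l))); last exact: cm.
  rewrite (_ : (fun l => _) = (fun l => 1 + ((-1) * ('i%C * (tau * l)%:C%C) +
     (-1) * expNi (tau * l)))); last by apply/funext => l; rewrite !mulN1r addrA.
  apply: cmeasurableD; first exact: cmeasurable_cst.
  apply: cmeasurableD; apply: cmeasurableM; try exact: cmeasurable_cst.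
    apply: cmeasurableM; first exact: cmeasurable_cst.
    by apply: cmeasurable_real; exact: measurable_funM.
  exact: cmeasurable_expNi.
have mc : cmeasurable c.
  by apply: (cmeasurable_symb (cmeasurable_expNi tau)); exact: cm_defect.
have Edef : aeeq nu (defect (t + tau)) (fun y => c y + (a y + b y)).
  apply: filterS Ur => y Ery; rewrite /a /b /c /defect Ery mulrDl expNiD; ring.
rewrite (ae_eq_cLnorm2 _ _ Edef); [|exact: cm_defect| ]; last first.
  by apply: cmeasurableD => //; exact: cmeasurableD.
apply: le_trans (cLnormD _ mc (cmeasurableD ma mb)) _.
apply: leeD.
  rewrite -[leRHS]mul1e; apply: le_cLnorm2 => //; first exact: cm_defect.
  by move=> y; rewrite Normc.normcM normc_expNi.
apply: le_trans (cLnormD _ ma mb) _.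
have -> : tau * eps + (C + 3 * K ^+ 2 * M) * tau ^+ 2 =
  (tau * eps + C * tau ^+ 2) + 3 * K ^+ 2 * M * tau ^+ 2 by ring.
rewrite [leRHS]EFinD; apply: leeD.
  apply: le_trans (step t0 tau0 tT).
  rewrite -(sr_U_isometry S rL) -[leRHS]mul1e; apply: le_cLnorm2 => //.
    exact: sr_U_cmeas.
  by move=> y; rewrite Normc.normcM ler_wpM2r ?normc_ge0.
apply: (@le_trans _ _ ((3 * K ^+ 2 * tau ^+ 2)%:E * cLnorm nu 2%:E (U (u t)))%E).
  apply: le_cLnorm2; [by rewrite mulr_ge0 ?sqr_ge0// mulr_ge0 ?sqr_ge0|exact: mb|exact: cm|].
  move=> y; rewrite !Normc.normcM mulrA ler_wpM2r ?normc_ge0//.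
  have [->|p0] := eqVneq (phi (sy y)) 0.
    by rewrite Normc.normc0 mul0r mulr_ge0 ?sqr_ge0// mulr_ge0 ?sqr_ge0.
  apply: (@le_trans _ _ (1 * (3 * (tau * sy y) ^+ 2))).
    by apply: ler_pM; rewrite ?normc_ge0// expNi_taylor.
  rewrite mul1r -mulrA ler_pM2l// exprMn [leLHS]mulrC ler_wpM2r ?sqr_ge0//.
  rewrite -[leLHS]real_normK ?num_real// lerXn2r ?nnegrE ?phiK//.
  exact: le_trans (phiK p0).
rewrite (sr_U_isometry S (uL tt)).
have -> : 3 * K ^+ 2 * M * tau ^+ 2 = (3 * K ^+ 2 * tau ^+ 2) * M by ring.
rewrite [leRHS]EFinM lee_wpmul2l ?uM//.
by rewrite lee_fin mulr_ge0 ?sqr_ge0// mulr_ge0 ?sqr_ge0.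
Unshelve. all: by end_near. Qed.

(** Over [N] steps of length [T0 / N] the quadratic one-step errors add up to
    [O(1 / N)], and only [T0 * eps] is left as [N] tends to infinity. *)
Lemma duhamel : (cLnorm nu 2%:E (defect T0) <= (T0 * eps)%:E)%E.
Proof.
have d0 : (cLnorm nu 2%:E (defect 0) = 0)%E.
  rewrite cLnorm2E /nsq integral0_eq ?poweR0r// => y _.
  by rewrite /defect mul0r expNi0 mul1r subrr mulr0 Normc.normc0 expr0n.
pose C' := C + 3 * K ^+ 2 * M.
have HN (N : nat) : (cLnorm nu 2%:E (defect T0) <=
    (T0 * eps + C' * T0 ^+ 2 / N.+1%:R)%:E)%E.
  pose tau := T0 / N.+1%:R.
  have tau0 : 0 <= tau by rewrite divr_ge0.
  have N0 : (N.+1%:R : R) != 0 by rewrite pnatr_eq0.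
  have Nt : N.+1%:R * tau = T0 by rewrite mulrC divfK.
  have hj j : (j <= N.+1)%N ->
    (cLnorm nu 2%:E (defect (j%:R * tau)) <= (j%:R * (tau * eps + C' * tau ^+ 2))%:E)%E.
    elim: j => [_|j ih jN]; first by rewrite !mul0r d0.
    have jS X : j.+1%:R * X = j%:R * X + X :> R by rewrite -natr1 mulrDl mul1r.
    rewrite [j.+1%:R * tau]jS jS [leRHS]EFinD.
    apply: le_trans (leeD (ih (ltnW jN)) (lexx _)).
    rewrite -/C'; apply: defect_step => //; first by rewrite mulr_ge0.
    by rewrite -Nt -[X in _ + X]mul1r -mulrDl natr1 ler_wpM2r// ler_nat.
  have := hj N.+1 (leqnn _); rewrite Nt => /le_trans; apply.
  have -> : N.+1%:R * (tau * eps + C' * tau ^+ 2) =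
    (N.+1%:R * tau) * eps + C' * (N.+1%:R * tau) * tau by ring.
  by rewrite Nt /tau expr2 !mulrA.
apply/lee_addgt0Pr => e e0.
have [N hN] : exists N : nat, C' * T0 ^+ 2 / N.+1%:R <= e.
  exists (Num.bound (`|C' * T0 ^+ 2| / e)).
  rewrite ler_pdivrMr ?ltr0n//; apply: le_trans (ler_norm _) _.
  rewrite -ler_pdivrMl// mulrC.
  apply/ltW/(lt_trans (archi_boundP _)); first by rewrite divr_ge0// ltW.
  by rewrite ltr_nat.
by apply: le_trans (HN N) _; rewrite -EFinD lee_fin lerD2l.
Qed.

(** The approximate solution itself is not cut off, and what the cutoff removes from
    it at time [T0] is bounded by its energy, as [1 - phi] vanishes at [0]. *)
Lemma propagated_close (c W : R) : 0 <= c ->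
  (forall l : R, normc (1 - phi l) <= c * `|l|) ->
  (cLnorm mu 2%:E (w T0) <= W%:E)%E ->
  let Psi := fcalc S (fun l => expNi (T0 * l)) (fcalc S phi (u 0)) in
  in_L2 mu Psi /\
  (cLnorm mu 2%:E (fun x => (Psi x - u T0 x)%R) <= (T0 * eps + c * W)%:E)%E.
Proof.
move=> c0 hc hW Psi.
have TT : 0 <= T0 <= T0 by rewrite T0_ge0 lexx.
have [fL Uf] := fcalcP S mphi phi1 (uL T00).
have [PL UP] := fcalcP S (cmeasurable_expNi T0)
  (fun l => eq_ind_r (fun z => z <= 1) (lexx _) (normc_expNi (T0 * l))) fL.
split=> //.
rewrite -(sr_U_isometry S (in_L2B PL (uL TT))).
pose b := fun y => (-1) * ((1 - phi (sy y)) * U (u T0) y).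
pose a := fun y => (-1) * defect T0 y.
have m1 : cmeasurable (fun l => 1 - phi l).
  rewrite (_ : (fun l => _) = (fun l => 1 + (-1) * phi l)); last first.
    by apply/funext => l; rewrite mulN1r.
  apply: cmeasurableD; first exact: cmeasurable_cst.
  by apply: cmeasurableM => //; exact: cmeasurable_cst.
have m2 : cmeasurable (fun y => (1 - phi (sy y)) * U (u T0) y).
  by apply: (cmeasurable_symb m1); exact: cm.
have mb : cmeasurable b by apply: cmeasurableM => //; exact: cmeasurable_cst.
have ma : cmeasurable a.
  by apply: cmeasurableM; [exact: cmeasurable_cst|exact: cm_defect].
have E : aeeq nu (U (fun x => Psi x - u T0 x)) (fun y => a y + b y).
  have h := sr_UB S PL (uL TT); near=> y.
  have -> : U (fun x => Psi x - u T0 x) y = U Psi y - U (u T0) y by near: y; exact: h.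
  have -> : U Psi y = expNi (T0 * sy y) * U (fcalc S phi (u 0)) y by near: y; exact: UP.
  have -> : U (fcalc S phi (u 0)) y = phi (sy y) * U (u 0) y by near: y; exact: Uf.
  by rewrite /a /b /defect; ring.
rewrite (ae_eq_cLnorm2 _ _ E); [|by apply: sr_U_cmeas; apply: in_L2B => //; exact: uL|
  exact: cmeasurableD].
apply: le_trans (cLnormD _ ma mb) _; rewrite [leRHS]EFinD; apply: leeD.
  apply: le_trans duhamel; rewrite -[leRHS]mul1e.
  apply: le_cLnorm2 => //; first exact: cm_defect.
  by move=> y; rewrite mul1r /a mulN1r normcN.
rewrite [leRHS]EFinM.
apply: (@le_trans _ _ (c%:E * cLnorm nu 2%:E (U (w T0)))%E); last first.
  by rewrite (sr_U_isometry S (wL TT)) lee_wpmul2l.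
apply: ae_le_cLnorm2 => //; first by apply: sr_U_cmeas; exact: wL.
have := proj1 (sr_diag S (uL TT) (wL TT)) (Huw TT); apply: filterS => y ->.
rewrite /b mulN1r normcN !Normc.normcM normc_real mulrA ler_wpM2r ?normc_ge0//.
Unshelve. all: by end_near. Qed.

End propagation.

(** * Integration on the cusp *)

Section radial.
Context {R : realType}.
Local Notation mu := (@lebesgue_measure R).
Local Notation rho := (@exponential_pdf R 1).

Lemma radial_measureE (V : set R) : measurable V ->
  radial_measure V = (\int[mu]_(r in V) (rho r)%:E)%E.
Proof.
move=> mV; rewrite /radial_measure /exponential_pdf integral_mkcondr.
apply: eq_integral => r _; rewrite /patch; case: ifPn => // _.
by rewrite mul1r mulN1r.
Qed.

Let radial_fin : fin_num_fun (@radial_measure R).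
Proof.
move=> V mV; rewrite ge0_fin_numE ?measure_ge0//.
apply: (@le_lt_trans _ _ (radial_measure [set: R])).
  by apply: le_measure; rewrite ?inE.
by rewrite radial_measureE// integral_exponential_pdf// ltry.
Qed.

HB.instance Definition _ :=
  Measure_isFinite.Build _ _ _ (@radial_measure R) radial_fin.

(** The sigma-algebra of [R] bears two names: densities with respect to the Lebesgue
    measure are taken under the second one. *)
Definition radial_measureR : set (measurableTypeR R) -> \bar R := @radial_measure R.

HB.instance Definition _ := isMeasure.Build _ _ _ radial_measureR
  (measure0 (@radial_measure R)) (measure_ge0 (@radial_measure R))
  (@measure_semi_sigma_additive _ _ _ (@radial_measure R)).

HB.instance Definition _ :=
  Measure_isFinite.Build _ _ _ radial_measureR radial_fin.

Lemma radial_dom : radial_measureR `<< mu.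
Proof.
apply/null_content_dominatesP => A mA muA0.
rewrite -[LHS]/(radial_measure A) radial_measureE//; apply: null_set_integral => //.
apply: measurable_funTS; apply/measurable_EFinP; exact: measurable_exponential_pdf.
Qed.

Lemma integral_radial (f : R -> \bar R) :
  (@radial_measure R).-integrable [set: R] f ->
  (\int[@radial_measure R]_r f r = \int[mu]_r (f r * (rho r)%:E))%E.
Proof.
move=> fi; have mf := measurable_int _ fi.
have mrho : measurable_fun [set: measurableTypeR R] (fun r => (rho r)%:E).
  by apply/measurable_EFinP; exact: measurable_exponential_pdf.
have mid : measurable_fun [set: R] (id : R -> measurableTypeR R) by [].
have eqm A : measurable A -> A `<=` setT ->
    radial_measureR A = pushforward (@radial_measure R) (id : R -> measurableTypeR R) A by [].
have fiR : radial_measureR.-integrable [set: measurableTypeR R] f.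
  apply/integrableP; split => //; move/integrableP : fi => [_].
  rewrite (@eq_measure_integral _ (measurableTypeR R) R setT
    (pushforward (@radial_measure R) (id : R -> measurableTypeR R)))//.
  rewrite ge0_integral_pushforward//; exact: measurableT_comp.
transitivity (\int[radial_measureR]_r f r)%E.
  rewrite (@eq_measure_integral _ (measurableTypeR R) R setT
    (pushforward (@radial_measure R) (id : R -> measurableTypeR R)))//.
  by rewrite integral_pushforward.
rewrite -(Radon_Nikodym_change_of_variables radial_dom)//=.
apply: ae_eq_integral => //.
- apply: emeasurable_funM; [exact: mf|apply: (measurable_int mu)].
  by apply: Radon_Nikodym_integrable; exact: radial_dom.
- by apply: emeasurable_funM; [exact: mf|exact: mrho].
apply: ae_eqe_mul2l; apply: integral_ae_eq => //=.
  by apply: Radon_Nikodym_integrable; exact: radial_dom.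
move=> E _ mE; rewrite -Radon_Nikodym_integral//=; last exact: radial_dom.
by rewrite -radial_measureE.
Qed.

(** The weight [e^r] cancels the density [e^(- r)] of the radial measure, and [F]
    vanishes at both ends. *)
Lemma integral_radial_deriv (F f : R -> R) (a b : R) : 0 < a ->
  (forall r : R, is_derive r 1 F (f r)) -> continuous f ->
  (forall r, F r != 0 -> a <= r <= b) ->
  (\int[@radial_measure R]_r (expR r * f r)%:E = 0)%E.
Proof.
move=> a0 dF cf F0.
have f0 r : ~~ (a <= r <= b) -> f r = 0.
  move=> hr.
  have Fr : forall t, ~~ (a <= t <= b) -> F t = 0.
    by move=> t; apply: contraNeq; exact: F0.
  have [d <-] := dF r.
  have -> : 'D_1 F r = 'D_1 (cst 0 : R -> R) r; last by rewrite derive_cst.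
  apply: near_eq_derive => //; move: hr; rewrite negb_and -!ltNge => /orP[hr|hr].
    near=> t; rewrite /= Fr// negb_and -!ltNge; apply/orP; left; near: t.
    exact: lt_nbhsl.
  near=> t; rewrite /= Fr// negb_and -!ltNge; apply/orP; right; near: t.
  exact: lt_nbhsr.
pose c := Num.max b 1 + 1.
have c0 : 0 < c by rewrite ltr_pwDr// le_max ler01 orbT.
have bc : b < c by apply: le_lt_trans (_ : b <= Num.max b 1) _; rewrite ?le_max ?lexx// ltrDl.
have cef : continuous (fun r => expR r * f r).
  by move=> r; apply: continuousM; [exact: continuous_expR|exact: cf].
have mef : measurable_fun [set: R] (fun r => expR r * f r).
  exact: continuous_measurable_fun.
have [B B0 hB] : exists2 B, 0 <= B & forall r, `|expR r * f r| <= B.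
  have [|z _ hz] := @EVT_max R (fun r => `|expR r * f r|) 0 c (ltW c0) _.
    by apply: continuous_subspaceT => r; apply: cvg_norm; exact: cef.
  exists `|expR z * f z| => // r.
  have [rc|/negP rc] := boolP (r \in `[0, c]); first exact: hz.
  rewrite f0 ?mulr0 ?normr0//; apply/negP => /andP[h1 h2]; apply: rc.
  by rewrite in_itv/= (le_trans (ltW a0) h1) (le_trans h2 (ltW bc)).
have ie : (@radial_measure R).-integrable [set: R] (fun r => (expR r * f r)%:E).
  apply: (@measurable_bounded_integrable _ _ _ _ (fun r => expR r * f r)) => //.
    by apply: (@le_lt_trans _ _ _ _ _ _ (fin_num_fun_lty radial_fin)).
  by exists B; split; rewrite ?num_real// => M BM r _; apply: le_trans (hB r) (ltW BM).
rewrite integral_radial//.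
transitivity (\int[mu]_(r in `[0%R, c]) (f r)%:E)%E.
  rewrite [RHS]integral_mkcond; apply: eq_integral => r _.
  rewrite /patch mem_setE; case: ifPn => [|rc].
    rewrite in_itv/= => /andP[r0 _].
    rewrite exponential_pdfE// mul1r mulN1r -EFinM mulrAC.
    by rewrite expRN mulfV ?mul1r// gt_eqF// expR_gt0.
  rewrite f0 ?mulr0 ?mul0e//; apply: contra rc => /andP[h1 h2].
  by rewrite in_itv/= (le_trans (ltW a0) h1) (le_trans h2 (ltW bc)).
have dF1 r : derivable F r 1 by have [] := dF r.
have cF : continuous F.
  by move=> r; apply: differentiable_continuous; apply/derivable1_diffP.
rewrite (@continuous_FTC2 _ f F)//.
- have -> : F c = 0.
    by apply: contraTeq isT => /F0 /andP[_]; rewrite leNgt bc.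
  have -> : F 0 = 0.
    by apply: contraTeq isT => /F0 /andP[]; rewrite leNgt a0.
  by rewrite subee.
- exact: continuous_subspaceT.
- split; first by move=> r _.
    by apply: cvg_at_right_filter; exact: cF.
  by apply: cvg_at_left_filter; exact: cF.
- by move=> r _; rewrite derive1E; have [] := dF r.
Unshelve. all: by end_near. Qed.

End radial.

Lemma ge0_integral_mrestr d (T : measurableType d) (R : realType)
    (mu : {measure set T -> \bar R}) (D : set T) (mD : measurable D) (f : T -> \bar R) :
  (forall x, (0 <= f x)%E) -> measurable_fun [set: T] f ->
  (\int[mrestr mu mD]_x f x = \int[mu]_(x in D) f x)%E.
Proof.
move=> f0 mf; rewrite (@ge0_negligible_integral _ _ _ (mrestr mu mD) setT (~` D))//.
- rewrite setTD setCK; apply: eq_measure_integral => A mA AD.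
  by rewrite /= /mrestr setIidl.
- exact: measurableC.
- by rewrite /= /mrestr setICl measure0.
Qed.

Section circle.
Context {R : realType} {n : nat}.
Variable ell : 'I_n.+1 -> R.
Local Notation mu := (@lebesgue_measure R).
Local Notation point := ('I_n.+1 * R)%type.

Lemma measurable_indexed d (T : measurableType d) (f : T * 'I_n.+1 -> R) :
  (forall k, measurable_fun [set: T] (fun z => f (z, k))) ->
  measurable_fun [set: T * 'I_n.+1] f.
Proof.
move=> mf.
rewrite (_ : f = fun x => \sum_(k < n.+1) \1_[set y : T * 'I_n.+1 | y.2 = k] x * f (x.1, k)).
  apply: measurable_sum => k; apply: measurable_funM.
    apply: measurable_indic.
    rewrite -[X in measurable X]setTI.
    exact: (@measurable_snd _ _ T 'I_n.+1 measurableT [set k]).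
  exact: (measurableT_comp (mf k) measurable_fst).
apply/funext => -[z k] /=; rewrite (bigD1 k)//= big1 ?addr0.
  by rewrite indicE mem_set// mul1r.
by move=> j jk; rewrite indicE memNset ?mul0r//= => /eqP; rewrite eq_sym (negbTE jk).
Qed.

Lemma measurable_circles (f : point -> R) :
  (forall k, measurable_fun [set: R] (fun s => f (k, s))) -> measurable_fun [set: point] f.
Proof.
move=> mf; rewrite (_ : f = (fun x : R * 'I_n.+1 => f (x.2, x.1)) \o (fun x : point => (x.2, x.1))).
  apply: measurableT_comp; first exact: measurable_indexed.
  by apply: measurable_fun_pair; [exact: measurable_snd|exact: measurable_fst].
by apply/funext => -[].
Qed.

Lemma measurable_cusp (f : R * point -> R) :
  (forall k, measurable_fun [set: R * R] (fun z : R * R => f (z.1, (k, z.2)))) ->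
  measurable_fun [set: R * point] f.
Proof.
move=> mf; rewrite (_ : f = (fun x : (R * R) * 'I_n.+1 => f (x.1.1, (x.2, x.1.2))) \o
    (fun x : R * point => ((x.1, x.2.2), x.2.1))).
  apply: measurableT_comp; first exact: measurable_indexed.
  apply: measurable_fun_pair; last first.
    exact: (measurableT_comp measurable_fst measurable_snd).
  apply: measurable_fun_pair; first exact: measurable_fst.
  exact: (measurableT_comp measurable_snd measurable_snd).
by apply/funext => -[r []].
Qed.

(** The measure on the circles is the sum of the images of Lebesgue measures on
    intervals. *)
Let slice (i : nat) (s : measurableTypeR R) : point := (inord i, s).

Let mslice i : measurable_fun [set: measurableTypeR R] (slice i).
Proof.
by apply: measurable_fun_pair; [exact: measurable_cst|move=> _ Y mY; rewrite setTI].
Qed.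

Let arc (i : nat) := mrestr mu (@measurable_itv R `[0%R, ell (inord i)[).

Let arcm (i : nat) : {measure set point -> \bar R}.
Proof.
unshelve refine [the {measure set point -> \bar R} of pushforward (arc i) (slice i)].
exact: mslice.
Defined.

Let arcmE i A : arcm i A = mu (slice i @^-1` A `&` `[0%R, ell (inord i)[).
Proof. by []. Qed.

Lemma integral_circle (f : point -> \bar R) :
  (forall a, (0 <= f a)%E) -> measurable_fun [set: point] f ->
  (\int[circle_measure ell]_a f a =
   \sum_(k < n.+1) \int[mu]_(s in `[0%R, ell k[) f (k, s))%E.
Proof.
move=> f0 mf; rewrite (@eq_measure_integral _ _ _ setT (msum arcm n.+1)); last first.
  move=> A mA _; rewrite /circle_measure /msum/=.
  apply: eq_bigr => k _; rewrite -[RHS]/(arcm k A) arcmE /slice inord_val.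
  by congr (mu (_ `&` _)); apply/seteqP; split => s /=; rewrite /xsection /= inE.
rewrite ge0_integral_measure_sum//; apply: eq_bigr => k _.
rewrite (ge0_integral_pushforward (mslice k))//.
rewrite -[LHS]/(\int[arc k]_s (f \o slice k) s)%E.
rewrite ge0_integral_mrestr; last 2 first.
- by move=> s; exact: f0.
- by apply: measurableT_comp => //; exact: mslice.
by rewrite inord_val; apply: eq_integral => s _ /=; rewrite /slice inord_val.
Qed.

(** The bound [B] makes [g + B] nonnegative, for which integrals split over the
    circles unconditionally. *)
Lemma integral_circle_deriv (G g : point -> R) (B : R) :
  (forall k, 0 < ell k) -> (forall a, `|g a| <= B) ->
  (forall k (s : R), is_derive s 1 (fun s => G (k, s)) (g (k, s))) ->
  (forall k, continuous (fun s => g (k, s))) ->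
  (forall k, G (k, ell k) = G (k, 0)) ->
  (\int[circle_measure ell]_a (g a)%:E = 0)%E.
Proof.
move=> ell0 gB dG cg per.
have mg : measurable_fun [set: point] g.
  by apply: measurable_circles => k; exact: continuous_measurable_fun.
have gi : (circle_measure ell).-integrable [set: point] (fun a => (g a)%:E).
  apply: (@measurable_bounded_integrable _ _ _ _ g) => //.
    exact: fin_num_fun_lty.
  by exists B; split; rewrite ?num_real// => M BM a _; apply: le_trans (gB a) (ltW BM).
have ci : (circle_measure ell).-integrable [set: point] (fun a => B%:E).
  by apply: finite_measure_integrable_cst.
have F0 a : (0 <= (g a + B)%:E)%E.
  by rewrite lee_fin -lerBlDr sub0r; have := gB a; rewrite ler_norml => /andP[].
have B0 : 0 <= B by apply: le_trans (gB (ord0, 0)).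
suff : (\int[circle_measure ell]_a ((g a)%:E + B%:E) = \int[circle_measure ell]_a B%:E)%E.
  rewrite (integralD measurableT gi ci) => /(congr1 (fun x => x - \int[circle_measure ell]_a B%:E)%E).
  have fin := integrable_fin_num measurableT ci.
  by rewrite addeK// subee.
rewrite !integral_circle//=; last first.
  by apply/measurable_EFinP; exact: measurable_funD.
apply: eq_bigr => k _.
have dGk := dG k; pose P (s : R) := G (k, s) + B * s.
have cP : continuous P.
  move=> s; apply: differentiable_continuous; apply/derivable1_diffP.
  by apply: derivableD => //; have [] := dGk s.
have mgB : measurable_fun [set: measurableTypeR R] (fun s => (g (k, s) + B)%:E).
  apply/measurable_EFinP; apply: measurable_funD => //.
  exact: (continuous_measurable_fun (cg k)).
have dP (s : R) : is_derive s 1 P (g (k, s) + B).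
  have := dGk s => ?; rewrite /P; apply: is_derive_eq.
  by rewrite /GRing.scale /= mulr1.
rewrite !integral_itv_bndo_bndc//; last exact: measurable_funTS.
rewrite (@continuous_FTC2 _ (fun s => g (k, s) + B) P)//.
- rewrite /P per mulr0 addr0 integral_cst//= lebesgue_measure_itv/= lte_fin ell0.
  by rewrite oppr0 adde0 -EFinB -EFinM; congr EFin; ring.
- apply: continuous_subspaceT => s; apply: continuousD; first exact: cg.
  exact: cst_continuous.
- split; first by move=> s _; have [] := dP s.
    by apply: cvg_at_right_filter; exact: cP.
  by apply: cvg_at_left_filter; exact: cP.
- by move=> s _; rewrite derive1E; have [] := dP s.
Qed.

End circle.

Section partial_derivatives.
Context {R : realType}.
Implicit Types f : R * R -> R.

Lemma derive_fst f (z : R * R) : smooth f ->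
  is_derive z.1 1 (fun r => f (r, z.2)) ('D_((1, 0) : R * R) f z).
Proof.
move=> sf; have df := smooth_differentiable z sf.
have [d e] : is_derive z ((1, 0) : R * R) f ('D_((1, 0) : R * R) f z).
  by split => //; exact: diff_derivable.
have E : (fun h : R => h^-1 *: (f (h *: ((1, 0) : R * R) + z) - f z)) =
    (fun h : R => h^-1 *: (f (h *: 1 + z.1, z.2) - f (z.1, z.2))).
  apply/funext => h; congr (_ *: (f _ - f _)); last by case: z {df d e}.
  case: z {df d e} => z1 z2 /=.
  by rewrite -[LHS]/(h *: 1 + z1, h *: 0 + z2) scaler0 add0r.
split; first by move: d; rewrite /derivable E.
by rewrite /derive E.
Qed.

Lemma derive_snd f (z : R * R) : smooth f ->
  is_derive z.2 1 (fun s => f (z.1, s)) ('D_((0, 1) : R * R) f z).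
Proof.
move=> sf; have df := smooth_differentiable z sf.
have [d e] : is_derive z ((0, 1) : R * R) f ('D_((0, 1) : R * R) f z).
  by split => //; exact: diff_derivable.
have E : (fun h : R => h^-1 *: (f (h *: ((0, 1) : R * R) + z) - f z)) =
    (fun h : R => h^-1 *: (f (z.1, h *: 1 + z.2) - f (z.1, z.2))).
  apply/funext => h; congr (_ *: (f _ - f _)); last by case: z {df d e}.
  case: z {df d e} => z1 z2 /=.
  by rewrite -[LHS]/(h *: 0 + z1, h *: 1 + z2) scaler0 add0r.
split; first by move: d; rewrite /derivable E.
by rewrite /derive E.
Qed.

Lemma smooth_slice_snd f (r : R) : smooth f -> continuous (fun s => f (r, s)).
Proof.
move=> sf s; apply: differentiable_continuous; apply/derivable1_diffP.
by have [] := derive_snd (r, s) sf.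
Qed.

Lemma smooth_slice_fst f (s : R) : smooth f -> continuous (fun r => f (r, s)).
Proof.
move=> sf r; apply: differentiable_continuous; apply/derivable1_diffP.
by have [] := derive_fst (r, s) sf.
Qed.

Lemma smooth_bounded f (a b c e : R) : a <= b -> c <= e -> smooth f ->
  exists2 B, 0 <= B & forall r s, a <= r <= b -> c <= s <= e -> `|f (r, s)| <= B.
Proof.
move=> ab ce sf.
have [||| z _ hz] := @compact_EVT_max _ R (fun z => `|f z|) (`[a, b] `*` `[c, e]).
- by exists (a, c); split; rewrite /= in_itv/= lexx.
- by apply: compact_setX; exact: segment_compact.
- by apply: continuous_subspaceT => z; apply: cvg_norm; exact: smooth_continuous.
exists `|f z| => // r s rab sce; apply: hz.
by rewrite inE; split; rewrite /= in_itv.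
Qed.

End partial_derivatives.

(** * The Laplacian on test functions *)

Section real_test_functions.
Context {R : realType} {n : nat}.
Variable ell : 'I_n.+1 -> R.
Hypothesis ell0 : forall k, 0 < ell k.
Local Notation point := (R * ('I_n.+1 * R))%type.
Implicit Types u v : point -> R.

Definition slice k u : R * R -> R := fun z => u (z.1, (k, z.2)).

(** The real and imaginary parts of test functions are treated separately. *)
Definition rtest u : Prop :=
  [/\ forall k, smooth (slice k u),
      forall r k s, u (r, (k, s + ell k)) = u (r, (k, s))
    & exists a b : R, 0 < a /\ forall x, u x != 0 -> a <= x.1 <= b].

Definition dr u : point -> R := fun x => derive1 (fun r => u (r, x.2)) x.1.
Definition ds u : point -> R := fun x => derive1 (fun s => u (x.1, (x.2.1, s))) x.2.2.

Lemma slice_dr k u : smooth (slice k u) ->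
  slice k (dr u) = 'D_((1, 0) : R * R) (slice k u).
Proof.
move=> su; apply/funext => z; rewrite /slice /dr /= derive1E.
by have [_ ->] := derive_fst z su.
Qed.

Lemma slice_ds k u : smooth (slice k u) ->
  slice k (ds u) = 'D_((0, 1) : R * R) (slice k u).
Proof.
move=> su; apply/funext => z; rewrite /slice /ds /= derive1E.
by have [_ ->] := derive_snd z su.
Qed.

Lemma is_derive_dr u (r : R) a : rtest u -> is_derive r 1 (fun r => u (r, a)) (dr u (r, a)).
Proof.
case: a => k s [su _ _]; rewrite -[dr u _]/(slice k (dr u) (r, s)) slice_dr//.
exact: (derive_fst (r, s) (su k)).
Qed.

Lemma is_derive_ds u (r : R) k (s : R) : rtest u ->
  is_derive s 1 (fun s => u (r, (k, s))) (ds u (r, (k, s))).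
Proof.
move=> [su _ _]; rewrite -[ds u _]/(slice k (ds u) (r, s)) slice_ds//.
exact: (derive_snd (r, s) (su k)).
Qed.

Lemma rtest_dr u : rtest u -> rtest (dr u).
Proof.
move=> tu; have [su pu [a [b [a0 ub]]]] := tu; split.
- by move=> k; rewrite slice_dr//; exact: smooth_derive.
- move=> r k s; rewrite /dr /=; congr (derive1 _ r).
  by apply/funext => r'; exact: pu.
exists (a / 2), (b + 1); split; first by rewrite divr_gt0.
move=> [r y]; apply: contraNT => hr.
have [_ <-] := is_derive_dr r y tu.
have u0 (r' : R) : ~~ (a <= r' <= b) -> u (r', y) = 0.
  by move=> h; apply/eqP; apply: contraNT h => /ub.
have -> : 'D_1 (fun r' : R => u (r', y)) r = 'D_1 (cst 0 : R -> R) r; last first.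
  by rewrite derive_cst.
apply: near_eq_derive => //; move: hr; rewrite /= negb_and -!ltNge => /orP[hr|hr].
  near=> t; rewrite /= u0// negb_and -!ltNge; apply/orP; left; near: t.
  by apply: lt_nbhsl; lra.
near=> t; rewrite /= u0// negb_and -!ltNge; apply/orP; right; near: t.
by apply: lt_nbhsr; lra.
Unshelve. all: by end_near. Qed.

Lemma rtest_ds u : rtest u -> rtest (ds u).
Proof.
move=> tu; have [su pu [a [b [a0 ub]]]] := tu; split.
- by move=> k; rewrite slice_ds//; exact: smooth_derive.
- move=> r k s; have [_ <-] := is_derive_ds r k s tu.
  have [_ <-] := is_derive_ds r k (s + ell k) tu.
  have E : (fun h : R => h^-1 *: (u (r, (k, h *: 1 + (s + ell k))) - u (r, (k, s + ell k)))) =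
      (fun h : R => h^-1 *: (u (r, (k, h *: 1 + s)) - u (r, (k, s)))).
    by apply/funext => h; rewrite addrA !pu.
  by rewrite /derive E.
exists a, b; split => // -[r [k s]]; apply: contraNT => hr.
rewrite /ds /= (_ : (fun s => u (r, (k, s))) = cst 0) ?derive1_cst//.
apply/funext => s' /=; apply/eqP; apply: contraNT hr => /ub.
by [].
Qed.

Lemma rtestB u v : rtest u -> rtest v -> rtest (fun x => u x - v x).
Proof.
move=> [su pu [a [b [a0 ub]]]] [sv pv [a' [b' [a'0 vb]]]]; split.
- by move=> k; exact: (smoothB (su k) (sv k)).
- by move=> r k s; rewrite pu pv.
exists (Num.min a a'), (Num.max b b'); split; first by rewrite lt_min a0.
move=> x; have [->|/ub /andP[h1 h2] _] := eqVneq (u x) 0.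
  by rewrite sub0r oppr_eq0 => /vb /andP[h1 h2]; rewrite ge_min h1 orbT le_max h2 orbT.
by rewrite ge_min h1 le_max h2.
Qed.

Lemma rtestM u v : rtest u -> rtest v -> rtest (fun x => u x * v x).
Proof.
move=> [su pu [a [b [a0 ub]]]] [sv pv _]; split.
- by move=> k; exact: (smoothM (su k) (sv k)).
- by move=> r k s; rewrite pu pv.
exists a, b; split => // x; rewrite mulf_eq0 negb_or => /andP[h _]; exact: ub.
Qed.

Lemma rtestZ (c : R -> R) u : smooth c -> rtest u -> rtest (fun x => c x.1 * u x).
Proof.
move=> sc [su pu [a [b [a0 ub]]]]; split.
- move=> k; apply: (@smoothM _ _ (fun z => c z.1) (slice k u)) => //.
  by apply: smooth_comp1 => //; exact: smooth_fst.
- by move=> r k s; rewrite pu.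
exists a, b; split => // x; rewrite mulf_eq0 negb_or => /andP[_ h]; exact: ub.
Qed.

End real_test_functions.

(** A function that is continuous in the first variable and measurable in the
    second is jointly measurable: it is the limit of its samples at the points
    of [Z / m] of the first variable. *)
Lemma measurable_caratheodory (R : realType) (f : R * R -> R) :
  (forall s, continuous (fun r => f (r, s))) ->
  (forall r, measurable_fun [set: R] (fun s => f (r, s))) ->
  measurable_fun [set: R * R] f.
Proof.
move=> cf mf; apply/measurable_EFinP.
pose q (m : nat) (r : R) : R := (Num.floor (r * m.+1%:R))%:~R / m.+1%:R.
apply: (emeasurable_fun_cvg (fun m z => (f (q m z.1, z.2))%:E)) => [m|[r s] _].
  apply/measurable_EFinP => _ Y mY; rewrite setTI.
  pose E (i : int) : set (R * R) :=
    `[(i%:~R / m.+1%:R : R), ((i + 1)%:~R / m.+1%:R : R)[ `*`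
      ((fun s => f (i%:~R / m.+1%:R, s)) @^-1` Y).
  have mE i : measurable (E i).
    by apply: measurableX => //; rewrite -[X in measurable X]setTI; exact: mf.
  have m0 : 0 < (m.+1%:R : R) by rewrite ltr0n.
  rewrite (_ : _ @^-1` Y = \bigcup_(j : nat) (if unpickle j is Some i then E i else set0)).
    by apply: bigcupT_measurable => j; case: (unpickle j).
  apply/seteqP; split => [[r s] /= Yrs|[r s] [j _]].
    exists (pickle (Num.floor (r * m.+1%:R))) => //; rewrite pickleK; split => //=.
    by rewrite in_itv/= ler_pdivrMr// ltr_pdivlMr// floor_itv.
  case: (unpickle j) => // i [/= ri Yrs].
  rewrite /q (_ : Num.floor _ = i)//; apply: floor_def.
  by move: ri; rewrite in_itv/= ler_pdivrMr// ltr_pdivlMr.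
apply: cvg_EFin; first exact: nearW.
rewrite /comp /=; apply: (@cvg_comp _ _ _ (q ^~ r) (fun r => f (r, s))); last exact: cf.
apply/cvgrPdist_le => e e0; near=> m.
have m0 : 0 < (m.+1%:R : R) by rewrite ltr0n.
have /andP[h1 h2] := floor_itv (r * m.+1%:R).
have -> : r - q m r = (r * m.+1%:R - (Num.floor (r * m.+1%:R))%:~R) / m.+1%:R.
  by rewrite /q mulrBl mulfK ?gt_eqF.
rewrite normrM normfV (gtr0_norm m0) ger0_norm ?subr_ge0// ler_pdivrMr//.
apply: (@le_trans _ _ 1); first by rewrite lerBlDr addrC ltW//; move: h2; rewrite intrD.
rewrite -ler_pdivrMr// div1r ltW//; near: m.
exact: (near_infty_natSinv_lt (PosNum e0)).
Unshelve. all: by end_near. Qed.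

Section cusp_integrals.
Context {R : realType} {n : nat}.
Variable ell : 'I_n.+1 -> R.
Hypothesis ell0 : forall k, 0 < ell k.
Local Notation point := (R * ('I_n.+1 * R))%type.
Local Notation vol := (vol0 ell).
Implicit Types u v : point -> R.

Lemma vol0_fin : (vol [set: point] < +oo)%E.
Proof.
rewrite -setXTT [X in (X < _)%E](product_measure1E (@radial_measure R) (circle_measure ell))//.
by rewrite lte_mul_pinfty ?measure_ge0//; exact: fin_num_fun_lty || exact: fin_num_measure.
Qed.

Lemma periodic_int (k : 'I_n.+1) (f : R -> R) : (forall s, f (s + ell k) = f s) ->
  forall (m : nat) s, f (s + ell k *+ m) = f s /\ f (s - ell k *+ m) = f s.
Proof.
move=> per; elim=> [|m ih] s; first by rewrite mulr0n subr0 addr0.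
split.
  by rewrite mulrSr addrA per; exact: (ih s).1.
by rewrite mulrSr opprD addrA -[LHS]per subrK; exact: (ih s).2.
Qed.

(** The periodicity makes a smooth function bounded on the whole circle. *)
Lemma periodic_repr (k : 'I_n.+1) (f : R -> R) : (forall s, f (s + ell k) = f s) ->
  forall s, exists2 s', 0 <= s' <= ell k & f s = f s'.
Proof.
move=> per s; have l0 := ell0 k.
pose z := Num.floor (s / ell k).
have [h1 h2] : z%:~R * ell k <= s /\ s < (z + 1)%:~R * ell k.
  by rewrite -ler_pdivlMr// -ltr_pdivrMr//; have /andP[] := floor_itv (s / ell k).
exists (s - z%:~R * ell k).
  by rewrite subr_ge0 h1 lerBlDl /= (le_trans (ltW h2))// intrD mulrDl mul1r.
case: z h1 h2 => m _ _.
  by have [_ <-] := periodic_int per m s; rewrite mulr_natl.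
have [<- _] := periodic_int per m.+1 s.
by rewrite NegzE mulrNz mulNr opprK mulr_natl.
Qed.

Lemma rtest_bounded u : rtest ell u -> exists2 B, 0 <= B & forall x, `|u x| <= B.
Proof.
move=> [su pu [a [b [a0 ub]]]].
have [ab|ab] := leP a b; last first.
  exists 0 => // x; have [->|/ub] := eqVneq (u x) 0; first by rewrite normr0.
  by move=> /andP[h1 h2]; have := le_trans h1 h2; rewrite leNgt ab.
have /choice[B hB] : forall k, exists B, 0 <= B /\
    forall r s, a <= r <= b -> 0 <= s <= ell k -> `|u (r, (k, s))| <= B.
  by move=> k; have [B] := smooth_bounded ab (ltW (ell0 k)) (su k); exists B.
exists (\sum_k B k); first by apply: sumr_ge0 => k _; exact: (hB k).1.
move=> [r [k s]].
have [->|u0] := eqVneq (u (r, (k, s))) 0.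
  by rewrite normr0; apply: sumr_ge0 => j _; exact: (hB j).1.
have rab := ub _ u0.
have [s' s'l ->] := periodic_repr (fun s => pu r k s) s.
apply: le_trans ((hB k).2 _ _ rab s'l) _.
by rewrite (bigD1 k)//= lerDl; apply: sumr_ge0 => j _; exact: (hB j).1.
Qed.

Lemma rtest_measurable u : rtest ell u -> measurable_fun [set: point] u.
Proof.
move=> [su _ _]; apply: measurable_cusp => k.
apply: measurable_caratheodory => [s|r].
  exact: (smooth_slice_fst (su k)).
by apply: continuous_measurable_fun; exact: (smooth_slice_snd (su k)).
Qed.

Lemma bounded_integrable u : measurable_fun [set: point] u ->
  (exists B, forall x, `|u x| <= B) -> vol.-integrable [set: point] (EFin \o u).
Proof.
move=> mu [B hB]; apply: measurable_bounded_integrable => //; first exact: vol0_fin.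
by exists B; split; rewrite ?num_real// => M BM x _; apply: le_trans (hB x) (ltW BM).
Qed.

Lemma rtest_integrable u : rtest ell u -> vol.-integrable [set: point] (EFin \o u).
Proof.
move=> tu; apply: bounded_integrable; first exact: rtest_measurable.
by have [B _ hB] := rtest_bounded tu; exists B.
Qed.

Lemma rtest_continuous_fst u a : rtest ell u -> continuous (fun r => u (r, a)).
Proof. by case: a => k s [su _ _]; exact: (smooth_slice_fst (su k)). Qed.

Lemma rtest_continuous_snd u r k : rtest ell u -> continuous (fun s => u (r, (k, s))).
Proof. by move=> [su _ _]; exact: (smooth_slice_snd (su k)). Qed.

Lemma Rintegral_dr u : rtest ell u -> \int[vol]_x (expR x.1 * dr u x) = 0.
Proof.
move=> tu; have tv : rtest ell (fun x => expR x.1 * dr u x).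
  by apply: rtestZ; [apply: smooth_expR; exact: smooth_id|exact: rtest_dr].
have /= vi := rtest_integrable tv.
rewrite /Rintegral -(integral21_prod_meas1 vi) integral0_eq// => a _.
have [_ _ [c [b [c0 ub]]]] := tu.
apply: (@integral_radial_deriv _ (fun r => u (r, a)) (fun r => dr u (r, a)) c b c0).
- by move=> r; exact: (is_derive_dr r a tu).
- by apply: rtest_continuous_fst; exact: rtest_dr.
- by move=> r /ub.
Qed.

Lemma Rintegral_ds u : rtest ell u -> \int[vol]_x ds u x = 0.
Proof.
move=> tu; have tv := rtest_ds tu.
have /= vi := rtest_integrable tv.
rewrite /Rintegral -(integral12_prod_meas1 vi) integral0_eq// => r _.
have [B _ hB] := rtest_bounded tv; have [_ pu _] := tu.
apply: (@integral_circle_deriv _ _ _ (fun a => u (r, a)) (fun a => ds u (r, a)) B) => //.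
- by move=> k s; exact: (is_derive_ds r k s tu).
- by move=> k; exact: rtest_continuous_snd.
- by move=> k; rewrite -(pu r k 0) add0r.
Qed.

(** [- Delta_0] on real functions. *)
Definition neg_lapR u : point -> R :=
  fun x => - dr (dr u) x + dr u x - expR (2 * x.1) * ds (ds u) x.

Definition dirichlet u v : point -> R :=
  fun x => dr u x * dr v x + expR (2 * x.1) * (ds u x * ds v x).

Lemma smooth_expR2 : smooth (fun r : R => expR (2 * r)).
Proof.
by apply: smooth_expR; apply: smoothM; [exact: smooth_cst|exact: smooth_id].
Qed.

Lemma rtestD u v : rtest ell u -> rtest ell v -> rtest ell (fun x => u x + v x).
Proof.
move=> tu tv; have tN : rtest ell (fun x => (-1) * v x).
  by apply: (rtestZ (c := fun=> -1)) => //; exact: smooth_cst.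
have := rtestB tu tN; rewrite (_ : (fun x => u x - -1 * v x) = (fun x => u x + v x))//.
by apply/funext => x; rewrite mulN1r opprK.
Qed.

Lemma rtest_neg_lapR u : rtest ell u -> rtest ell (neg_lapR u).
Proof.
move=> tu; apply: rtestB.
  have := rtestB (rtest_dr tu) (rtest_dr (rtest_dr tu)).
  rewrite (_ : (fun x => _ - _) = (fun x => - dr (dr u) x + dr u x))//.
  by apply/funext => x; rewrite addrC.
by apply: (rtestZ smooth_expR2); exact/rtest_ds/rtest_ds.
Qed.

Lemma rtest_dirichlet u v : rtest ell u -> rtest ell v -> rtest ell (dirichlet u v).
Proof.
move=> tu tv; apply: rtestD; first by apply: rtestM; exact: rtest_dr.
by apply: (rtestZ smooth_expR2); apply: rtestM; exact: rtest_ds.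
Qed.

(** With the volume density [e^(- r)], the difference of the integrands is the
    divergence of [(e^(- r) v dr u, e^(2r) v ds u)]. *)
Lemma green u v : rtest ell u -> rtest ell v ->
  \int[vol]_x (neg_lapR u x * v x) = \int[vol]_x dirichlet u v x.
Proof.
move=> tu tv.
pose F := fun x : point => expR (- x.1) * (dr u x * v x).
pose G := fun x : point => expR (2 * x.1) * (ds u x * v x).
have tF : rtest ell F.
  apply: (rtestZ (c := fun r => expR (- r))).
    by apply: smooth_expR; apply: smoothN; exact: smooth_id.
  by apply: rtestM => //; exact: rtest_dr.
have tG : rtest ell G.
  by apply: (rtestZ smooth_expR2); apply: rtestM => //; exact: rtest_ds.
have tF' : rtest ell (fun x => expR x.1 * dr F x).
  by apply: rtestZ; [apply: smooth_expR; exact: smooth_id|exact: rtest_dr].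
have E x : neg_lapR u x * v x = dirichlet u v x - expR x.1 * dr F x - ds G x.
  case: x => r [k s].
  have dF : dr F (r, (k, s)) = expR (- r) * (- (dr u (r, (k, s)) * v (r, (k, s)))
      + dr (dr u) (r, (k, s)) * v (r, (k, s)) + dr u (r, (k, s)) * dr v (r, (k, s))).
    have h1 := is_derive_dr r (k, s) tv.
    have h2 := is_derive_dr r (k, s) (rtest_dr tu).
    have dE : is_derive r 1 (fun r => expR (- r)) (- expR (- r)).
      by apply: is_derive_eq; rewrite mulrN1.
    rewrite [LHS]/dr derive1E /F /=; apply: derive_val.
    apply: is_derive_eq; rewrite /GRing.scale /=; ring.
  have dG : ds G (r, (k, s)) = expR (2 * r) * (ds (ds u) (r, (k, s)) * v (r, (k, s))
      + ds u (r, (k, s)) * ds v (r, (k, s))).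
    have h1 := is_derive_ds r k s tv.
    have h2 := is_derive_ds r k s (rtest_ds tu).
    rewrite [LHS]/ds derive1E /G /=; apply: derive_val.
    apply: is_derive_eq; rewrite /GRing.scale /=; ring.
  rewrite dF dG /neg_lapR /dirichlet /= expRN.
  by field; rewrite gt_eqF// expR_gt0.
under eq_Rintegral do rewrite E.
have idir := rtest_integrable (rtest_dirichlet tu tv).
have iF := rtest_integrable tF'.
rewrite RintegralB//; last 2 first.
- exact: (rtest_integrable (rtestB (rtest_dirichlet tu tv) tF')).
- exact: (rtest_integrable (rtest_ds tG)).
by rewrite RintegralB// Rintegral_dr// Rintegral_ds// !subr0.
Qed.

End cusp_integrals.

Section complex_test_functions.
Context {R : realType} {n : nat}.
Variable ell : 'I_n.+1 -> R.
Hypothesis ell0 : forall k, 0 < ell k.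
Local Notation point := (R * ('I_n.+1 * R))%type.
Local Notation vol := (vol0 ell).
Implicit Types u v w : point -> R[i].

Definition rpart u : point -> R := fun x => Re (u x).
Definition ipart u : point -> R := fun x => Im (u x).

Lemma test_cuspP u : test_cusp ell u <-> rtest ell (rpart u) /\ rtest ell (ipart u).
Proof.
split=> [[su pu [a [b [a0 ub]]]]|[[su pu [a [b [a0 ub]]]] [sv pv [a' [b' [a'0 vb]]]]]].
  split; split.
  - by move=> k; exact: (su k).1.
  - by move=> r k s; rewrite /rpart pu.
  - exists a, b; split => // x h; apply: ub; apply: contraNneq h => h.
    by rewrite /rpart h.
  - by move=> k; exact: (su k).2.
  - by move=> r k s; rewrite /ipart pu.
  - exists a, b; split => // x h; apply: ub; apply: contraNneq h => h.
    by rewrite /ipart h.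
split.
- by move=> k; split; [exact: su|exact: sv].
- by move=> r k s; apply: complexP; [exact: pu|exact: pv].
exists (Num.min a a'), (Num.max b b'); split; first by rewrite lt_min a0.
move=> x u0; have [r0|/ub /andP[h1 h2]] := eqVneq (rpart u x) 0; last first.
  by rewrite ge_min h1 le_max h2.
have [i0|/vb /andP[h1 h2]] := eqVneq (ipart u x) 0; last first.
  by rewrite ge_min h1 orbT le_max h2 orbT.
by case/eqP: u0; apply: complexP.
Qed.

Definition neg_lap u : point -> R[i] := fun x => - laplacian0 u x.

Lemma rpart_neg_lap u : rpart (neg_lap u) = neg_lapR (rpart u).
Proof.
apply/funext => x; rewrite /rpart /neg_lap /laplacian0 /neg_lapR.
rewrite (_ : forall a b c : R[i], Re (- (a - b + c)) = - Re a + Re b - Re c).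
  by rewrite cReM /= mul0r subr0.
by move=> [? ?] [? ?] [? ?] /=; ring.
Qed.

Lemma ipart_neg_lap u : ipart (neg_lap u) = neg_lapR (ipart u).
Proof.
apply/funext => x; rewrite /ipart /neg_lap /laplacian0 /neg_lapR.
rewrite (_ : forall a b c : R[i], Im (- (a - b + c)) = - Im a + Im b - Im c).
  by rewrite cImM /= mul0r addr0.
by move=> [? ?] [? ?] [? ?] /=; ring.
Qed.

Lemma Re_neg_lap u x : Re (neg_lap u x) = neg_lapR (rpart u) x.
Proof. by rewrite -rpart_neg_lap. Qed.

Lemma Im_neg_lap u x : Im (neg_lap u x) = neg_lapR (ipart u) x.
Proof. by rewrite -ipart_neg_lap. Qed.

Lemma test_neg_lap u : test_cusp ell u -> test_cusp ell (neg_lap u).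
Proof.
by move=> /test_cuspP[tr ti]; apply/test_cuspP; rewrite rpart_neg_lap ipart_neg_lap; split;
  exact: rtest_neg_lapR.
Qed.

Lemma rpartB u v : rpart (u \- v) = fun x => rpart u x - rpart v x.
Proof. by apply/funext => x; rewrite /rpart /=; case: (u x) (v x) => ? ? []. Qed.

Lemma ipartB u v : ipart (u \- v) = fun x => ipart u x - ipart v x.
Proof. by apply/funext => x; rewrite /ipart /=; case: (u x) (v x) => ? ? []. Qed.

Lemma test_cuspB u v : test_cusp ell u -> test_cusp ell v -> test_cusp ell (u \- v).
Proof.
move=> /test_cuspP[ur ui] /test_cuspP[vr vi].
by apply/test_cuspP; rewrite rpartB ipartB; split; exact: rtestB.
Qed.

Lemma in_L2_1 : in_L2 vol (fun=> 1).
Proof.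
split; try exact: measurable_cst.
rewrite cLnorm2_lty /nsq; under eq_integral do rewrite Normc.normc1 expr1n.
by rewrite integral_cst// mul1e; exact: vol0_fin.
Qed.

Lemma test_in_L2 u : test_cusp ell u -> in_L2 vol u.
Proof.
move=> /test_cuspP[tr ti].
have [B1 B10 h1] := rtest_bounded ell0 tr.
have [B2 B20 h2] := rtest_bounded ell0 ti.
have L1 := in_L2_1.
apply: (@in_L2_le _ _ _ _ _ (fun=> 1) (B1 + B2)) => //.
- exact: addr_ge0.
- by split; [exact: (rtest_measurable tr)|exact: (rtest_measurable ti)].
move=> x; rewrite Normc.normc1 mulr1; apply: le_trans (normc_le_add _) _.
by apply: lerD; [exact: h1|exact: h2].
Qed.

Lemma Re_mul_conjc (a b : R[i]) : Re (a * conjc b) = Re a * Re b + Im a * Im b.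
Proof. by case: a b => ? ? [? ?] /=; ring. Qed.

Lemma Im_mul_conjc (a b : R[i]) : Im (a * conjc b) = Im a * Re b - Re a * Im b.
Proof. by case: a b => ? ? [? ?] /=; ring. Qed.

Let M := fun a b : point -> R => \int[vol]_x (neg_lapR a x * b x).

Let MC a b : rtest ell a -> rtest ell b -> M a b = M b a.
Proof.
move=> ta tb; rewrite /M (green ell0 ta tb) (green ell0 tb ta); apply: eq_Rintegral => x _.
by rewrite /dirichlet [dr a x * _]mulrC [ds a x * _]mulrC.
Qed.

Let Mi a b : rtest ell a -> rtest ell b ->
  vol.-integrable [set: point] (EFin \o (fun x => neg_lapR a x * b x)).
Proof. by move=> ta tb; exact: (rtest_integrable ell0 (rtestM (rtest_neg_lapR ta) tb)). Qed.

Lemma inner_neg_lapl u v : test_cusp ell u -> test_cusp ell v ->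
  inner vol (neg_lap u) v =
  ((M (rpart u) (rpart v) + M (ipart u) (ipart v))%R +i*
  (M (ipart u) (rpart v) - M (rpart u) (ipart v))%R)%C.
Proof.
move=> /test_cuspP[ur ui] /test_cuspP[vr vi].
rewrite /inner /cint; congr (_ +i* _)%C.
  rewrite /M -RintegralD//; try exact: Mi.
  apply: eq_Rintegral => x _; rewrite Re_mul_conjc.
  by rewrite Re_neg_lap Im_neg_lap.
rewrite /M -RintegralB//; try exact: Mi.
apply: eq_Rintegral => x _; rewrite Im_mul_conjc.
by rewrite Re_neg_lap Im_neg_lap.
Qed.

Lemma inner_neg_lapr u v : test_cusp ell u -> test_cusp ell v ->
  inner vol u (neg_lap v) = inner vol (neg_lap u) v.
Proof.
move=> tu tv; rewrite inner_neg_lapl//; move: tu tv => /test_cuspP[ur ui] /test_cuspP[vr vi].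
rewrite /inner /cint; congr (_ +i* _)%C.
  rewrite [M (rpart u) _]MC// [M (ipart u) _]MC// /M -RintegralD//; try exact: Mi.
  apply: eq_Rintegral => x _; rewrite Re_mul_conjc.
  rewrite Re_neg_lap Im_neg_lap.
  by rewrite mulrC [Im _ * _]mulrC.
rewrite [M (rpart u) _]MC// [M (ipart u) _]MC// /M -RintegralB//; try exact: Mi.
apply: eq_Rintegral => x _; rewrite Im_mul_conjc.
rewrite Re_neg_lap Im_neg_lap.
by rewrite mulrC [Re _ * _]mulrC.
Qed.

Lemma rip_neg_lap_ge0 u : test_cusp ell u -> 0 <= rip vol (neg_lap u) u.
Proof.
move=> tu; rewrite /rip inner_neg_lapl//=; move: tu => /test_cuspP[ur ui].
have h a : rtest ell a -> 0 <= M a a.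
  move=> ta; rewrite /M (green ell0 ta ta); apply: Rintegral_ge0 => x _.
  by rewrite /dirichlet -!expr2 addr_ge0 ?sqr_ge0// mulr_ge0 ?expR_ge0 ?sqr_ge0.
by rewrite addr_ge0 ?h.
Qed.

Lemma neg_lapB u v : test_cusp ell u -> test_cusp ell v -> neg_lap (u \- v) = neg_lap u \- neg_lap v.
Proof.
move=> /test_cuspP[ur ui] /test_cuspP[vr vi].
have h a b : rtest ell a -> rtest ell b -> neg_lapR (fun x => a x - b x) = (fun x => neg_lapR a x - neg_lapR b x).
  move=> ta tb.
  have dB a' b' : rtest ell a' -> rtest ell b' ->
      dr (fun x => a' x - b' x) = (fun x => dr a' x - dr b' x).
    move=> ta' tb'; apply/funext => -[r y].
    rewrite {1}/dr derive1E /=.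
    have h1 := is_derive_dr r y ta'; have h2 := is_derive_dr r y tb'.
    exact: derive_val.
  have sB a' b' : rtest ell a' -> rtest ell b' ->
      ds (fun x => a' x - b' x) = (fun x => ds a' x - ds b' x).
    move=> ta' tb'; apply/funext => -[r [k s]].
    rewrite {1}/ds derive1E /=.
    have h1 := is_derive_ds r k s ta'; have h2 := is_derive_ds r k s tb'.
    exact: derive_val.
  apply/funext => x; rewrite /neg_lapR (dB _ _ ta tb) (dB _ _ (rtest_dr ta) (rtest_dr tb)).
  rewrite (sB _ _ ta tb).
  rewrite (sB _ _ (rtest_ds ta) (rtest_ds tb)).
  move: (dr (dr a) x) (dr (dr b) x) (dr a x) (dr b x) (ds (ds a) x) (ds (ds b) x).
  by move=> *; ring.
apply/funext => x; apply: complexP.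
  rewrite Re_neg_lap rpartB h// -!rpart_neg_lap /rpart /=.
  by case: (neg_lap u x) (neg_lap v x) => ? ? [].
rewrite Im_neg_lap ipartB h// -!ipart_neg_lap /ipart /=.
by case: (neg_lap u x) (neg_lap v x) => ? ? [].
Qed.

(** A test function is approximated by the constant sequence, and the adjunction is
    Green's formula. *)
Lemma neg_Delta0_test u : test_cusp ell u -> neg_Delta0 ell u (neg_lap u).
Proof.
move=> tu; split; [exact: test_in_L2|exact/test_in_L2/test_neg_lap| |].
  exists (fun=> u); split => //.
    have -> : cLnorm vol 2%:E (u \- u) = 0%E.
      rewrite cLnorm2E /nsq integral0_eq ?poweR0r// => x _ /=.
      by rewrite subrr Normc.normc0 expr0n.
    exact: cvg_cst.
  move=> e e0; exists 0%N => m k _ _; rewrite /inner /cint /=.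
  rewrite (_ : Rintegral _ _ _ = 0)//.
  rewrite /Rintegral integral0_eq// => x _.
  by rewrite subrr (_ : conjc 0 = 0) ?mulr0//; apply: complexP; rewrite /= ?oppr0.
by move=> v tv; rewrite (inner_neg_lapr tu tv).
Qed.

Lemma neg_Delta0_ge0 u w : neg_Delta0 ell u w -> 0 <= rip vol w u.
Proof.
apply: friedrichs_ge0.
- by move=> v tv; exact: test_in_L2.
- by move=> v tv; exact/test_in_L2/test_neg_lap.
- by move=> v v' tv tv'; split; [exact: test_cuspB|exact: neg_lapB].
- by move=> v v' tv tv'; rewrite /rip inner_neg_lapr.
- exact: rip_neg_lap_ge0.
Qed.

End complex_test_functions.

(** * The projection onto the kernel and a duality bound *)

Section kernel_projection.
Context {R : realType} {n : nat}.
Variable ell : 'I_n.+1 -> R.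
Hypothesis ell0 : forall k, 0 < ell k.
Local Notation circ := ('I_n.+1 * R)%type.
Local Notation C := (circle_measure ell).
Implicit Types (f g e : circ -> R[i]) (a b : circ -> R).

(** A function with zero second derivative is affine, and constant if it is periodic. *)
Lemma ker_laplacian_cst e : ker_laplacian_circles ell e ->
  forall k s, e (k, s) = e (k, 0).
Proof.
move=> [se le] k s.
have cst (f : R -> R) : smooth f -> (forall t, derive1 (derive1 f) t = 0) ->
    (forall t, f (t + ell k) = f t) -> f s = f 0.
  move=> sf f2 per.
  have df (t : R) : is_derive t 1 f (derive1 f t).
    by rewrite derive1E; split => //; apply/diff_derivable/smooth_differentiable.
  have sf' : smooth (derive1 f).
    rewrite (_ : derive1 f = 'D_1 f); first exact: smooth_derive.
    by apply/funext => t; rewrite derive1E.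
  have df' (t : R) : is_derive t 1 (derive1 f) 0.
    rewrite -(f2 t) [X in is_derive _ _ _ X]derive1E; split => //.
    exact/diff_derivable/smooth_differentiable.
  pose c := derive1 f 0.
  have c' t : derive1 f t = c by exact: is_derive_0_is_cst.
  have dfc (t : R) : is_derive t 1 (fun t => f t - c * t) 0.
    have := df t; rewrite c' => ?; apply: is_derive_eq.
    by rewrite /GRing.scale /= mulr1 subrr.
  have cE t : f t - c * t = f 0.
    by have /= := is_derive_0_is_cst t 0 dfc; rewrite mulr0 subr0.
  have c0 : c = 0.
    have := cE (ell k); have := cE 0; rewrite -[X in f X - _ = _ -> _]add0r => _.
    rewrite -[ell k]add0r per add0r => /eqP; rewrite subr_eq addrC -subr_eq subrr eq_sym.
    by rewrite mulf_eq0 (gt_eqF (ell0 k)) orbF => /eqP.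
  by have := cE s; rewrite c0 mul0r subr0.
have [[sr si] per] := se k.
apply: complexP.
  apply: (cst (fun s => Re (e (k, s)))) => // t; last by rewrite per.
  by have /(congr1 (@complex.Re R)) := le (k, t).
apply: (cst (fun s => Im (e (k, s)))) => // t; last by rewrite per.
by have /(congr1 (@complex.Im R)) := le (k, t).
Qed.

Lemma ker_laplacian_circlewise (c : 'I_n.+1 -> R[i]) :
  ker_laplacian_circles ell (fun x => c x.1).
Proof.
have cst0 (z : R[i]) t : cderive (fun=> z) t = 0.
  by apply: complexP; rewrite /= derive1_cst.
split=> [k|x]; last first.
  rewrite /laplacian_circles /= (_ : cderive (fun=> c x.1) = fun=> 0) ?cst0//.
  by apply/funext => t; rewrite cst0.
by split => //; split; [exact: (smooth_cst (Re (c k)))|exact: (smooth_cst (Im (c k)))].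
Qed.

(** The indicators of the circles span the kernel of the Laplacian. *)
Definition chi k : circ -> R := fun x => (x.1 == k)%:R.

Lemma measurable_chi k : measurable_fun [set: circ] (chi k).
Proof. by apply: measurable_circles => j; exact: measurable_cst. Qed.

Lemma chi_le1 k x : 0 <= chi k x <= 1.
Proof. by rewrite /chi; case: (_ == _); rewrite ?lexx ?ler01. Qed.

Lemma integral_chi k : \int[C]_x chi k x = ell k.
Proof.
rewrite /Rintegral integral_circle//; last 2 first.
- by move=> x; rewrite lee_fin; case/andP: (chi_le1 k x).
- by apply/measurable_EFinP; exact: measurable_chi.
rewrite (bigD1 k)//= big1 ?adde0.
  rewrite (eq_integral (fun=> 1%E)); last by move=> s _; rewrite /chi eqxx.
  by rewrite integral_cst//= lebesgue_measure_itv/= lte_fin ell0 oppr0 adde0 mul1e.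
move=> j jk; rewrite integral0_eq// => s _.
by rewrite /chi /= (negbTE jk).
Qed.

Lemma integrable_circle_bounded a B : measurable_fun [set: circ] a ->
  (forall x, `|a x| <= B) -> C.-integrable [set: circ] (EFin \o a).
Proof.
move=> ma hB; apply: measurable_bounded_integrable => //; first exact: fin_num_fun_lty.
by exists B; split; rewrite ?num_real// => M BM x _; apply: le_trans (hB x) (ltW BM).
Qed.

Lemma integrable_circleMl a b B : measurable_fun [set: circ] b -> (forall x, `|b x| <= B) ->
  C.-integrable [set: circ] (EFin \o a) ->
  C.-integrable [set: circ] (EFin \o (fun x => b x * a x)).
Proof.
move=> mb hB ia.
have ma : measurable_fun [set: circ] a by apply/measurable_EFinP; exact: (measurable_int _ ia).
have B0 : 0 <= B by apply: le_trans (hB (ord0, 0)).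
apply: (le_integrable measurableT _ _ (integrableZl measurableT B ia)).
  by apply/measurable_EFinP; exact: measurable_funM.
by move=> x _; rewrite lee_fin !normrM (ger0_norm B0) ler_wpM2r.
Qed.

Definition average a k : R := (\int[C]_x (chi k x * a x)) / ell k.

Lemma chi_norm k x : `|chi k x| <= 1.
Proof. by have /andP[h1 h2] := chi_le1 k x; rewrite ger0_norm. Qed.

Lemma circlewise_measurable (c : 'I_n.+1 -> R) : measurable_fun [set: circ] (fun x => c x.1).
Proof. by apply: measurable_circles => k; exact: (measurable_cst (c k)). Qed.

Lemma circlewise_bounded (c : 'I_n.+1 -> R) : forall x : circ, `|c x.1| <= \sum_k `|c k|.
Proof. by move=> x; rewrite (bigD1 x.1)//= lerDl sumr_ge0. Qed.

Lemma average_orthogonal a (c : 'I_n.+1 -> R) : C.-integrable [set: circ] (EFin \o a) ->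
  \int[C]_x ((a x - average a x.1) * c x.1) = 0.
Proof.
move=> ia; rewrite /Rintegral.
have E x : ((a x - average a x.1) * c x.1)%:E =
    (\sum_k (c k * (chi k x * a x - average a k * chi k x))%:E)%E.
  rewrite (bigD1 x.1)//= big1 ?adde0.
    by rewrite /chi eqxx mul1r mulr1 mulrC.
  by move=> k kx; rewrite /chi eq_sym (negbTE kx) mul0r mulr0 subr0 mulr0.
under eq_integral do rewrite E.
have ia' k := integrable_circleMl (measurable_chi k) (chi_norm k) ia.
have ichi k := integrable_circle_bounded (measurable_chi k) (chi_norm k).
have iavg k := integrableZl measurableT (average a k) (ichi k).
have isub k := integrableB measurableT (ia' k) (iavg k).
have ic k := integrableZl measurableT (c k) (isub k).
rewrite (integral_sum measurableT ic).
rewrite big1// => k _.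
have -> : (\int[C]_x (c k * (chi k x * a x - average a k * chi k x))%:E)%E =
   (c k * \int[C]_x (chi k x * a x - average a k * chi k x))%:E.
  rewrite -(RintegralZl _ measurableT (isub k)) /Rintegral fineK//.
  by apply: integrable_fin_num => //; exact: (ic k).
rewrite (RintegralB measurableT (ia' k) (iavg k)) (RintegralZl _ measurableT (ichi k)).
rewrite integral_chi /average divfK ?gt_eqF//.
by rewrite subrr mulr0.
Qed.

Definition cintegrable f : Prop :=
  C.-integrable [set: circ] (fun x => (Re (f x))%:E) /\
  C.-integrable [set: circ] (fun x => (Im (f x))%:E).

(** [pi0] is specified by orthogonality only: the averages satisfy the specification,
    and testing against the indicator of a circle shows that they are the only
    choice. *)
Lemma pi0E f : cintegrable f -> forall k s,
  pi0 ell f (k, s) = ((average (fun x => Re (f x)) k) +i*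
                      (average (fun x => Im (f x)) k))%C.
Proof.
move=> [ir ii] k s; rewrite /pi0; set P := [set g | _].
pose g0 : circ -> R[i] := fun x => ((average (fun x => Re (f x)) x.1) +i*
                      (average (fun x => Im (f x)) x.1))%C.
have avg_sub (a : circ -> R) (c : 'I_n.+1 -> R) : C.-integrable [set: circ] (EFin \o a) ->
    C.-integrable [set: circ] (EFin \o (fun x => a x - c x.1)).
  move=> ia; have ic := integrable_circle_bounded (circlewise_measurable c) (circlewise_bounded c).
  exact: (integrableB measurableT ia ic).
have ptm (a : circ -> R) (c c' : 'I_n.+1 -> R) : C.-integrable [set: circ] (EFin \o a) ->
    C.-integrable [set: circ] (EFin \o (fun x => (a x - c x.1) * c' x.1)).
  move=> ia; have := integrable_circleMl (circlewise_measurable c')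
    (circlewise_bounded c') (avg_sub _ c ia).
  by apply: eq_integrable => // x _; rewrite /= mulrC.
have Pg0 : P g0.
  split; first exact: (ker_laplacian_circlewise
    (fun k => (average (fun x => Re (f x)) k +i* average (fun x => Im (f x)) k)%C)).
  move=> e /ker_laplacian_cst ec.
  pose c k := Re (e (k, 0)); pose d k := Im (e (k, 0)).
  have eE x : e x = (c x.1 +i* d x.1)%C.
    by case: x => j t; rewrite (ec j t) /c /d /=; case: (e _).
  rewrite /inner /cint; apply: complexP => /=.
    transitivity (\int[C]_x ((Re (f x) - average (fun x => Re (f x)) x.1) * c x.1) +
        \int[C]_x ((Im (f x) - average (fun x => Im (f x)) x.1) * d x.1)); last first.
      by rewrite !average_orthogonal// addr0.
    rewrite -RintegralD//; try exact: ptm.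
    apply: eq_Rintegral => x _; rewrite Re_mul_conjc eE /g0 /=.
    by case: (f x).
  transitivity (\int[C]_x ((Im (f x) - average (fun x => Im (f x)) x.1) * c x.1) -
      \int[C]_x ((Re (f x) - average (fun x => Re (f x)) x.1) * d x.1)); last first.
    by rewrite !average_orthogonal// subr0.
  rewrite -RintegralB//; try exact: ptm.
  apply: eq_Rintegral => x _; rewrite Im_mul_conjc eE /g0 /=.
  by case: (f x).
have [kg og] := xgetPex (fun=> 0) (ex_intro P g0 Pg0).
move: kg og; set g := xget _ _ => kg og.
have gc := ker_laplacian_cst kg.
pose c k := Re (g (k, 0)); pose d k := Im (g (k, 0)).
have gE x : g x = (c x.1 +i* d x.1)%C.
  by case: x => j t; rewrite (gc j t) /c /d /=; case: (g _).
have := og _ (ker_laplacian_circlewise (fun j => ((j == k)%:R : R)%:C%C)).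
rewrite /inner /cint => /eqP; rewrite eq_complex /= => /andP[/eqP hr /eqP hi].
have fin a (c' : 'I_n.+1 -> R) : C.-integrable [set: circ] (EFin \o a) ->
    \int[C]_x ((a x - c' x.1) * (x.1 == k)%:R) = 0 -> c' k = average a k.
  move=> ia.
  have ia' := integrable_circleMl (measurable_chi k) (chi_norm k) ia.
  have ichi := integrable_circle_bounded (measurable_chi k) (chi_norm k).
  rewrite (_ : (\int[C]_x _) = \int[C]_x (chi k x * a x - c' k * chi k x)); last first.
    apply: eq_Rintegral => x _; rewrite /chi.
    by case: eqP => [->|_]; rewrite ?mulr1 ?mul1r ?mulr0 ?mul0r ?subrr.
  rewrite (RintegralB measurableT ia' (integrableZl measurableT _ ichi)).
  rewrite (RintegralZl _ measurableT ichi) integral_chi => /eqP; rewrite subr_eq0 => /eqP h.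
  by rewrite /average h mulfK// gt_eqF.
rewrite (gE (k, s)) /=; congr (_ +i* _)%C.
  apply: fin => //; rewrite -[RHS]hr; apply: eq_Rintegral => x _.
  by rewrite cReM /= oppr0 mulr0 subr0 gE; case: (f x).
apply: fin => //; rewrite -[RHS]hi; apply: eq_Rintegral => x _.
by rewrite cImM /= oppr0 mulr0 add0r gE; case: (f x).
Qed.

End kernel_projection.

Section pairing.
Context {R : realType} {n : nat}.
Variable ell : 'I_n.+1 -> R.
Hypothesis ell0 : forall k, 0 < ell k.
Local Notation circ := ('I_n.+1 * R)%type.
Local Notation point := (R * ('I_n.+1 * R))%type.
Local Notation vol := (vol0 ell).
Local Notation rad := (@radial_measure R).
Local Notation C := (circle_measure ell).

Lemma in_L2_integrable (f : point -> R[i]) : in_L2 vol f ->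
  vol.-integrable [set: point] (EFin \o (fun x => Re (f x))) /\
  vol.-integrable [set: point] (EFin \o (fun x => Im (f x))).
Proof.
move=> fL; have [mr mi _] := fL.
have h := integrable_normcM fL (in_L2_1 ell).
split; apply: (le_integrable measurableT _ _ h); try exact/measurable_EFinP.
- by move=> x _; rewrite lee_fin Normc.normc1 mulr1 (ger0_norm (normc_ge0 _)) Re_le_normc.
- by move=> x _; rewrite lee_fin Normc.normc1 mulr1 (ger0_norm (normc_ge0 _)) Im_le_normc.
Qed.

Lemma measurable_average (a : point -> R) (k : 'I_n.+1) :
  vol.-integrable [set: point] (EFin \o a) ->
  measurable_fun [set: R] (fun r => average ell (fun y => a (r, y)) k).
Proof.
move=> ia; have ma : measurable_fun [set: point] a.
  by apply/measurable_EFinP; exact: (measurable_int _ ia).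
have mchi : measurable_fun [set: point] (fun x => chi k x.2).
  exact: (measurableT_comp (measurable_chi k) measurable_snd).
have i' : (rad \x C)%E.-integrable [set: point] (fun x => (chi k x.2 * a x)%:E).
  apply: (le_integrable measurableT _ _ ia).
    by apply/measurable_EFinP; exact: measurable_funM.
  by move=> x _; rewrite lee_fin normrM ler_piMl// chi_norm.
rewrite /average /Rintegral.
apply: measurable_funM; last exact: measurable_cst.
by apply: (measurableT_comp (fine_measurable measurableT)); exact: measurable_fubini_F i'.
Qed.

Lemma restrict_in_L2 (r1 : R) (f : point -> R[i]) : in_L2 vol f ->
  in_L2 vol (restrict_ge r1 f).
Proof.
move=> fL; apply: (in_L2_le (ler01) _ fL).
  have -> : restrict_ge r1 f = (fun x => (\1_(`[r1, +oo[ `*` [set: circ]) x : R)%:C%C * f x).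
    apply/funext => -[r a]; rewrite /restrict_ge indicE /= in_setX in_setT andbT mem_setE.
    by rewrite in_itv/= andbT; case: (r1 <= r); rewrite ?mul1r ?mul0r.
  apply: cmeasurableM; last exact: in_L2_cmeasurable fL.
  by apply: cmeasurable_real; apply: measurable_indic; exact: measurableX.
move=> x; rewrite mul1r /restrict_ge; case: ifP => // _.
by rewrite Normc.normc0 normc_ge0.
Qed.

Lemma Lnorm_indic (W : set point) (V p : R) : measurable W -> 0 < p -> 0 <= V ->
  (vol W <= V%:E)%E -> (Lnorm vol p%:E (fun x => (\1_W x)%:E) <= (V `^ p^-1)%:E)%E.
Proof.
move=> mW p0 V0 hV; rewrite unlock -poweR_EFin; apply: gt0_ler_poweR.
- by rewrite invr_ge0 ltW.
- by rewrite in_itv/= leey andbT integral_ge0// => x _; exact: poweR_ge0.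
- by rewrite in_itv/= leey andbT lee_fin.
apply: le_trans hV; rewrite -[X in vol X]setIT -integral_indic//.
apply: eq_leW; apply: eq_integral => x _.
rewrite indicE; case: (_ \in _) => /=.
  by rewrite -[true%:R]/(1 : R) normr1 powR1.
by rewrite -[false%:R]/(0 : R) normr0 powR0// gt_eqF.
Qed.

Variables (r1 : R) (Psi u : point -> R[i]) (W : set point) (q Mb V : R).
Hypotheses (PsiL : in_L2 vol Psi) (mu : cmeasurable u).
Hypotheses (q1 : 1 < q) (Mb0 : 0 < Mb) (V0 : 0 < V) (mW : measurable W).
Hypotheses (uM : forall x, normc (u x) <= Mb) (uW : forall x, u x != 0 -> W x).
Hypotheses (ur1 : forall x, u x != 0 -> r1 <= x.1).
Hypotheses (uk : forall x, u x != 0 -> x.2.1 = ord0) (hV : (vol W <= V%:E)%E).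
Hypotheses (mean_re : forall r, (\int[C]_a (Re (u (r, a)))%:E = 0)%E).
Hypotheses (mean_im : forall r, (\int[C]_a (Im (u (r, a)))%:E = 0)%E).

Let f := restrict_ge r1 Psi.
Let fL : in_L2 vol f. Proof. exact: restrict_in_L2. Qed.

Let rip_f : rip vol Psi u = rip vol f u.
Proof.
rewrite !ripE; apply: eq_Rintegral => x _; rewrite /f /restrict_ge.
have [u0|/ur1 ->//] := eqVneq (u x) 0.
by rewrite u0 !Re_mul_conjc !mulr0.
Qed.

(** By Fubini almost all slices are integrable, and on those the projection is the
    explicit average. *)
Let good : exists N : set R, [/\ measurable N, rad N = 0%E &
  forall r, ~ N r -> cintegrable ell (fun a => f (r, a))].
Proof.
have [ir ii] := in_L2_integrable fL.
have hr : {ae rad, forall r, C.-integrable setT (fun a => (Re (f (r, a)))%:E)}.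
  exact: (ae_integrable1 ir).
have hi : {ae rad, forall r, C.-integrable setT (fun a => (Im (f (r, a)))%:E)}.
  exact: (ae_integrable1 ii).
have [N [mN N0 hN]] : {ae rad, forall r, cintegrable ell (fun a => f (r, a))}.
  by move: hr hi; apply: filterS2 => r h1 h2; split.
by exists N; split => // r Nr; apply: contrapT => h; apply: Nr; exact: hN.
Qed.

Let uL : in_L2 vol u.
Proof.
apply: (in_L2_le (ltW Mb0) mu (in_L2_1 ell)) => x.
by rewrite Normc.normc1 mulr1.
Qed.

(** [u] has mean zero on the circle where it lives, hence [Psi] can be replaced by
    [Pic (restrict_ge r1 Psi)] in the inner product with [u], which Hoelder's inequality
    then bounds by the [L^q] norm times the [L^q'] norm of [u]. *)
Lemma Pic_lower :
  ((rip vol Psi u)%:E <= (Mb * V `^ (1 - q^-1))%:E *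
     cLnorm vol q%:E (Pic ell (restrict_ge r1 Psi)))%E.
Proof.
have [N [mN N0 hN]] := good.
have [ir ii] := in_L2_integrable fL.
pose Are r := average ell (fun a => Re (f (r, a))) ord0.
pose Aim r := average ell (fun a => Im (f (r, a))) ord0.
(* The function [Pic f] is only known to be measurable where it agrees with the
   explicit formula, so [F1] replaces it by [0] elsewhere. *)
pose g (x : point) : R := \1_(~` N) x.1 * chi ord0 x.2.
pose F1 (x : point) : R[i] := (g x)%:C%C * (f x + (-1) * (Are x.1 +i* Aim x.1)%C).
have g0 x : 0 <= g x.
  by rewrite mulr_ge0//; case/andP: (chi_le1 ord0 x.2).
have mg : measurable_fun [set: point] g.
  apply: measurable_funM.
    apply: (measurableT_comp _ measurable_fst).
    by apply: measurable_indic; exact: measurableC.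
  exact: (measurableT_comp (measurable_chi ord0) measurable_snd).
have mF1 : cmeasurable F1.
  apply: cmeasurableM; first exact: cmeasurable_real.
  apply: cmeasurableD; first exact: in_L2_cmeasurable fL.
  apply: cmeasurableM; first exact: cmeasurable_cst.
  split.
    exact: (measurableT_comp (measurable_average ord0 ir) measurable_fst).
  exact: (measurableT_comp (measurable_average ord0 ii) measurable_fst).
have F1F x : normc (F1 x) <= normc (Pic ell f x).
  rewrite /F1 /g indicE; case: x => r [k s] /=.
  have [|_] := boolP (r \in ~` N); last first.
    by rewrite mul0r mul0r Normc.normc0 normc_ge0.
  rewrite inE => /hN ci; rewrite /chi mul1r /=.
  have [->|_] := eqVneq k ord0; last by rewrite mul0r Normc.normc0 normc_ge0.
  by rewrite mul1r mulN1r /Pic /Pi/= pi0E.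
have NF1 : (cLnorm vol q%:E F1 <= cLnorm vol q%:E (Pic ell f))%E.
  apply: le_LnormT; first by rewrite ltW// (lt_trans ltr01).
  by move=> x; rewrite lee_fin !ger0_norm ?normc_ge0.
have q0 : 0 < q by exact: lt_trans q1.
have q'0 : 0 < 1 - q^-1 by rewrite subr_gt0 invf_lt1.
have Vq : 0 < V `^ (1 - q^-1) by exact: powR_gt0.
have cst0 : 0 < Mb * V `^ (1 - q^-1) by exact: mulr_gt0.
apply: (@le_trans _ _ ((Mb * V `^ (1 - q^-1))%:E * cLnorm vol q%:E F1)%E); last first.
  by rewrite lee_wpmul2l// lee_fin ltW.
have [NF|NFy] := eqVneq (cLnorm vol q%:E F1) +oo%E.
  by rewrite NF gt0_muley ?lte_fin// leey.
have NFfin : cLnorm vol q%:E F1 \is a fin_num.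
  by rewrite ge0_fin_numE ?cLnorm_ge0// ltey.
have mnF1 := cmeasurable_normc mF1.
have hol : (\int[vol]_x (normc (F1 x) * \1_W x)%:E <=
    cLnorm vol q%:E F1 * (V `^ (1 - q^-1))%:E)%E.
  have := @hoelder _ _ _ vol (fun x => normc (F1 x)) (\1_W) q (1 - q^-1)^-1
    mnF1 (measurable_indic mW) q0.
  rewrite invr_gt0 invrK [q^-1 + _]addrC subrK => /(_ q'0 erefl).
  rewrite Lnorm1 => hh; apply: le_trans (le_trans hh _); last first.
    rewrite lee_wpmul2l ?cLnorm_ge0//.
    have := @Lnorm_indic W V (1 - q^-1)^-1 mW; rewrite invr_gt0 invrK.
    by apply => //; exact: ltW.
  apply: ge0_le_integralT => x; first by rewrite lee_fin mulr_ge0 ?normc_ge0.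
  by rewrite lee_fin ger0_norm// mulr_ge0 ?normc_ge0.
have intW : vol.-integrable [set: point] (fun x => (normc (F1 x) * \1_W x)%:E).
  apply/integrableP; split.
    by apply/measurable_EFinP; apply: measurable_funM => //; exact: measurable_indic.
  under eq_integral do rewrite gee0_abs ?lee_fin ?mulr_ge0 ?normc_ge0//.
  by apply: le_lt_trans hol _; rewrite lte_mul_pinfty ?cLnorm_ge0// ltry.
have uWb x : normc (u x) <= Mb * \1_W x.
  have [->|u0] := eqVneq (u x) 0.
    by rewrite Normc.normc0 mulr_ge0// ltW.
  by rewrite indicE mem_set ?mulr1//; exact: uW.
pose h1 (x : point) : R := Re (F1 x * conjc (u x)).
have mh1 : measurable_fun [set: point] h1.
  have [] // : cmeasurable (fun x => F1 x * conjc (u x)).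
  by apply: cmeasurableM => //; exact: cmeasurable_conjc.
have h1b x : `|h1 x| <= Mb * (normc (F1 x) * \1_W x).
  apply: le_trans (Re_le_normc _) _; rewrite Normc.normcM cnormJ mulrCA.
  by rewrite ler_wpM2l ?normc_ge0.
have ih1 : (rad \x C)%E.-integrable [set: point] (EFin \o h1).
  apply: (le_integrable measurableT _ _ (integrableZl measurableT Mb intW)).
    exact/measurable_EFinP.
  move=> x _; rewrite lee_fin; apply: le_trans (h1b x) _; exact: ler_norm.
have ih2 : (rad \x C)%E.-integrable [set: point] (fun x => (Re (f x * conjc (u x)))%:E).
  exact: (integrable_ReM fL uL).
have E : (\int[vol]_x (h1 x)%:E = \int[vol]_x (Re (f x * conjc (u x)))%:E)%E.
  rewrite -(integral12_prod_meas1 ih1) -(integral12_prod_meas1 ih2).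
  apply: ae_eq_integral => //.
  - exact: (measurable_fubini_F ih1).
  - exact: (measurable_fubini_F ih2).
  exists N; split => // r /= h; apply: contrapT => Nr; apply: h => _.
  have [cr ci] := hN _ Nr.
  pose w (a : circ) : R := Are r * Re (u (r, a)) + Aim r * Im (u (r, a)).
  have [mur mui] : cmeasurable (fun a => u (r, a)).
    split; first exact: (measurableT_comp mu.1 (measurable_pair1 r)).
    exact: (measurableT_comp mu.2 (measurable_pair1 r)).
  have bur a : `|Re (u (r, a))| <= Mb by apply: le_trans (Re_le_normc _) _.
  have bui a : `|Im (u (r, a))| <= Mb by apply: le_trans (Im_le_normc _) _.
  have iur := integrable_circle_bounded ell mur bur.
  have iui := integrable_circle_bounded ell mui bui.
  have iw : C.-integrable [set: circ] (EFin \o w).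
    exact: (integrableD measurableT (integrableZl measurableT (Are r) iur)
      (integrableZl measurableT (Aim r) iui)).
  have w0 : (\int[C]_a (w a)%:E = 0)%E.
    under eq_integral do rewrite EFinD !EFinM.
    rewrite (integralD measurableT (integrableZl measurableT (Are r) iur)
      (integrableZl measurableT (Aim r) iui)).
    by rewrite !integralZl// mean_re mean_im !mule0 adde0.
  have ip : C.-integrable [set: circ] (EFin \o (fun a => Re (f (r, a) * conjc (u (r, a))))).
    have i1 := integrable_circleMl mur bur cr.
    have i2 := integrable_circleMl mui bui ci.
    have := integrableD measurableT i1 i2; apply: eq_integrable => // a _ /=.
    by rewrite Re_mul_conjc -EFinD ![Re (u _) * _]mulrC ![Im (u _) * _]mulrC.
  have Eh a : (h1 (r, a))%:E = ((Re (f (r, a) * conjc (u (r, a))))%:E - (w a)%:E)%E.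
    rewrite -EFinB; congr EFin.
    have [u0|u0] := eqVneq (u (r, a)) 0.
      have c0 : conjc (0 : R[i]) = 0 by apply: complexP; rewrite /= ?oppr0.
      by rewrite /h1 /w u0 c0 !mulr0 addr0 subr0.
    rewrite /h1 /F1 /g /chi (uk u0) eqxx mulr1 indicE mem_set//= /w.
    rewrite mul1r mulN1r !Re_mul_conjc /=.
    by case: (f _) => ? ? /=; ring.
  transitivity (\int[C]_a ((Re (f (r, a) * conjc (u (r, a))))%:E - (w a)%:E))%E.
    by apply: eq_integral => a _; exact: Eh.
  by rewrite (integralB measurableT ip iw) w0 sube0.
rewrite rip_f ripE /Rintegral -E fineK; last first.
  exact: (integrable_fin_num measurableT ih1).
apply: le_trans (_ : _ <= Mb%:E * \int[vol]_x (normc (F1 x) * \1_W x)%:E)%E _; last first.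
  rewrite EFinM -muleA; apply: lee_wpmul2l; first by rewrite lee_fin ltW.
  by rewrite muleC.
rewrite -integralZl//.
apply: le_integral => //; first exact: (integrableZl measurableT Mb intW).
move=> x _; rewrite -EFinM lee_fin; apply: le_trans (h1b x); exact: ler_norm.
Qed.

End pairing.

(** * Wave packets carried by a classical trajectory *)

Section waves.
Context {R : realType} {n : nat}.
Variables lam Xi X Th : R.
Local Notation point := (R * ('I_n.+1 * R))%type.
Implicit Types (A B : R -> R).

Definition phase (x : point) : R := Xi * (x.1 - X) + Th + lam * x.2.2.

Definition rwave A B : point -> R := fun x =>
  (x.2.1 == ord0)%:R * (expR (x.1 / 2) * (A x.1 * cos (phase x) - B x.1 * sin (phase x))).

Definition iwave A B : point -> R := fun x =>
  (x.2.1 == ord0)%:R * (expR (x.1 / 2) * (A x.1 * sin (phase x) + B x.1 * cos (phase x))).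

(** [e^(r/2) (A + i B) e^(i phase)] on the first circle, [0] on the others. *)
Definition wave A B : point -> R[i] := fun x => (rwave A B x +i* iwave A B x)%C.

Lemma dr_rwave A B A' B' : (forall r : R, is_derive r 1 A (A' r)) ->
  (forall r : R, is_derive r 1 B (B' r)) ->
  dr (rwave A B) = rwave (fun r => A r / 2 + A' r - Xi * B r) (fun r => B r / 2 + B' r + Xi * A r).
Proof.
move=> dA dB; apply/funext => -[r [k s]].
have ? := dA r; have ? := dB r.
rewrite [LHS]/dr derive1E /rwave /phase /=; apply: derive_val.
by apply: is_derive_eq; rewrite /GRing.scale /=; ring.
Qed.

Lemma dr_iwave A B A' B' : (forall r : R, is_derive r 1 A (A' r)) ->
  (forall r : R, is_derive r 1 B (B' r)) ->
  dr (iwave A B) = iwave (fun r => A r / 2 + A' r - Xi * B r) (fun r => B r / 2 + B' r + Xi * A r).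
Proof.
move=> dA dB; apply/funext => -[r [k s]].
have ? := dA r; have ? := dB r.
rewrite [LHS]/dr derive1E /iwave /phase /=; apply: derive_val.
by apply: is_derive_eq; rewrite /GRing.scale /=; ring.
Qed.

Lemma ds_rwave A B : ds (rwave A B) = rwave (fun r => - lam * B r) (fun r => lam * A r).
Proof.
apply/funext => -[r [k s]].
rewrite [LHS]/ds derive1E /rwave /phase /=; apply: derive_val.
by apply: is_derive_eq; rewrite /GRing.scale /=; ring.
Qed.

Lemma ds_iwave A B : ds (iwave A B) = iwave (fun r => - lam * B r) (fun r => lam * A r).
Proof.
apply/funext => -[r [k s]].
rewrite [LHS]/ds derive1E /iwave /phase /=; apply: derive_val.
by apply: is_derive_eq; rewrite /GRing.scale /=; ring.
Qed.

(** The factor [e^(r/2)] removes the first-order term of [- Delta_0] and turns it into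
    [1/4]. *)
Lemma neg_lap_wave A B A1 B1 A2 B2 :
  (forall r : R, is_derive r 1 A (A1 r)) -> (forall r : R, is_derive r 1 B (B1 r)) ->
  (forall r : R, is_derive r 1 A1 (A2 r)) -> (forall r : R, is_derive r 1 B1 (B2 r)) ->
  neg_lap (wave A B) = wave
   (fun r => - A2 r + (4^-1 + Xi ^+ 2 + lam ^+ 2 * expR (2 * r)) * A r + 2 * Xi * B1 r)
   (fun r => - B2 r + (4^-1 + Xi ^+ 2 + lam ^+ 2 * expR (2 * r)) * B r - 2 * Xi * A1 r).
Proof.
move=> dA dB dA1 dB1.
have dA' (r : R) : is_derive r 1 (fun r => A r / 2 + A1 r - Xi * B r)
    (A1 r / 2 + A2 r - Xi * B1 r).
  have ? := dA r; have ? := dB r; have ? := dA1 r.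
  by apply: is_derive_eq; rewrite /GRing.scale /=; ring.
have dB' (r : R) : is_derive r 1 (fun r => B r / 2 + B1 r + Xi * A r)
    (B1 r / 2 + B2 r + Xi * A1 r).
  have ? := dA r; have ? := dB r; have ? := dB1 r.
  by apply: is_derive_eq; rewrite /GRing.scale /=; ring.
apply/funext => x; apply: complexP.
  rewrite -[LHS]/(rpart (neg_lap (wave A B)) x) rpart_neg_lap /neg_lapR.
  rewrite -[rpart _]/(rwave A B) (dr_rwave dA dB) (dr_rwave dA' dB') !ds_rwave.
  by rewrite /= /rwave; field.
rewrite -[LHS]/(ipart (neg_lap (wave A B)) x) ipart_neg_lap /neg_lapR.
rewrite -[ipart _]/(iwave A B) (dr_iwave dA dB) (dr_iwave dA' dB') !ds_iwave.
by rewrite /= /iwave; field.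
Qed.

Lemma normc_wave A B (x : point) : normc (wave A B x) =
  (x.2.1 == ord0)%:R * (expR (x.1 / 2) * normc (A x.1 +i* B x.1)%C).
Proof.
rewrite /wave /rwave /iwave; case: (_ == _) => /=; last first.
  by rewrite !mul0r expr0n addr0 sqrtr0.
rewrite !mul1r -[X in _ = X * _]ger0_norm ?expR_ge0// -sqrtr_sqr -sqrtrM ?sqr_ge0//.
congr Num.sqrt; have /= h := cos2Dsin2 (phase x); rewrite !exprMn.
transitivity (expR (x.1 / 2) ^+ 2 * ((A x.1 ^+ 2 + B x.1 ^+ 2) *
   (cos (phase x) ^+ 2 + sin (phase x) ^+ 2))); first by ring.
by rewrite h mulr1.
Qed.

Lemma wave_eq A B A' B' x : A x.1 = A' x.1 -> B x.1 = B' x.1 ->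
  wave A B x = wave A' B' x.
Proof. by move=> hA hB; rewrite /wave /rwave /iwave hA hB. Qed.

Lemma waveD A B A' B' x : wave A B x + wave A' B' x =
  wave (fun r => A r + A' r) (fun r => B r + B' r) x.
Proof. by apply: complexP; rewrite /= /rwave /iwave; ring. Qed.

Lemma waveZi (t : R) A B x : 'i%C * t%:C%C * wave A B x =
  wave (fun r => - t * B r) (fun r => t * A r) x.
Proof. by apply: complexP; rewrite /= /rwave /iwave; ring. Qed.

End waves.

Section taylor.
Context {R : realType}.

(** The constant is uniform in [r], as needed to integrate over the packet. *)
Lemma taylor_fst (f : R * R -> R) (T a b : R) : 0 <= T -> smooth f ->
  exists2 K, 0 <= K & forall t tau r, 0 <= t <= T -> 0 <= tau <= T -> a <= r <= b ->
    `|f (t + tau, r) - f (t, r) - tau * 'D_((1, 0) : R * R) f (t, r)| <= K * tau ^+ 2.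
Proof.
move=> T0 sf; have [ab|ab] := leP a b; last first.
  exists 0 => // t tau r _ _ /andP[h1 h2].
  by have := le_trans h1 h2; rewrite leNgt ab.
pose f1 := 'D_((1, 0) : R * R) f; pose f2 := 'D_((1, 0) : R * R) f1.
have sf1 : smooth f1 by exact: smooth_derive.
have [|||K K0 hK] := @smooth_bounded R f2 (- T) (T + T) a b.
- lra.
- exact: ab.
- exact: smooth_derive.
exists K => // t tau r /andP[t0 tT] /andP[tau0 tauT] rab.
have d0 (y : R) : is_derive y 1 (fun y => f (t + y, r) - y * f1 (t, r)) (f1 (t + y, r) - f1 (t, r)).
  have h := @derive_fst R f (t + y, r) sf.
  have h' : is_derive y 1 (fun y => f (t + y, r)) (f1 (t + y, r)).
    have dl : is_derive y 1 (fun y : R => t + y) 1 by apply: is_derive_eq; rewrite add0r mulr1.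
    by rewrite -[f1 _]mulr1; exact: (@is_derive1_comp R (fun z => f (z, r)) (fun y : R => t + y) y _ _ h dl).
  by apply: is_derive_eq; rewrite /GRing.scale /=; ring.
have d1 (y : R) : is_derive y 1 (fun y => f1 (t + y, r)) (f2 (t + y, r)).
  have h := @derive_fst R f1 (t + y, r) sf1.
  have dl : is_derive y 1 (fun y : R => t + y) 1 by apply: is_derive_eq; rewrite add0r mulr1.
  by rewrite -[f2 _]mulr1; exact: (@is_derive1_comp R (fun z => f1 (z, r)) (fun y : R => t + y) y _ _ h dl).
have := @mvt_bound R _ _ tau (K * tau) d0; rewrite !addr0 mul0r subr0 (ger0_norm tau0).
rewrite expr2 mulrA [f (t + tau, r) - _ - _]addrAC; apply => y yt.
have := @mvt_bound R _ _ y K d1; rewrite !addr0 => h.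
apply: (@le_trans _ _ (K * `|y|)); last by rewrite ler_wpM2l.
apply: h => z zy; apply: hK => //.
have := le_trans zy yt; rewrite ler_norml => /andP[z1 z2].
by apply/andP; split; lra.
Qed.

End taylor.

Section packet.
Context {R : realType} {n : nat}.
Variables (ell : 'I_n.+1 -> R) (lam mu delta : R).
Hypotheses (lam0 : 0 < lam) (mu0 : 0 < mu) (delta0 : 0 < delta).
Local Notation point := (R * ('I_n.+1 * R))%type.

(** The trajectory of the Hamiltonian [xi^2 + lam^2 e^(2x)] at energy [mu^2] that
    starts at its turning point: [lam e^(pos t) = mu / cosh (2 mu t)], with momentum
    [mom t] and potential energy [pot t]. The phase [act] integrates the Lagrangian
    [mom^2 - pot], shifted by the constant [1/4] of the operator. *)
Definition ch (t : R) : R := expR (2 * mu * t) + expR (- (2 * mu * t)).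
Definition sh (t : R) : R := expR (2 * mu * t) - expR (- (2 * mu * t)).
Definition pos (t : R) : R := ln (2 * mu / lam) - ln (ch t).
Definition mom (t : R) : R := - mu * (sh t * (ch t)^-1).
Definition pot (t : R) : R := 4 * mu ^+ 2 * (ch t)^-1 ^+ 2.
Definition act (t : R) : R := (mu ^+ 2 - 4^-1) * t + mom t.

Lemma ch_gt0 t : 0 < ch t. Proof. by rewrite addr_gt0 ?expR_gt0. Qed.

Lemma is_derive_ch (t : R) : is_derive t 1 ch (2 * mu * sh t).
Proof. by rewrite /ch /sh; apply: is_derive_eq; rewrite /GRing.scale /=; ring. Qed.

Lemma is_derive_sh (t : R) : is_derive t 1 sh (2 * mu * ch t).
Proof. by rewrite /ch /sh; apply: is_derive_eq; rewrite /GRing.scale /=; ring. Qed.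

Lemma ch2_sh2 t : ch t ^+ 2 - sh t ^+ 2 = 4.
Proof.
rewrite /ch /sh expRN.
have : expR (2 * mu * t) != 0 by rewrite gt_eqF ?expR_gt0.
by move: (expR _) => e e0; field.
Qed.

Lemma is_derive_pos (t : R) : is_derive t 1 pos (2 * mom t).
Proof.
have ? := is_derive_ch t.
have dl : is_derive t 1 (fun t => ln (ch t)) ((ch t)^-1 * (2 * mu * sh t)).
  apply: (@is_derive1_comp _ (@ln R) ch).
  exact: is_derive1_ln (ch_gt0 t).
rewrite /pos /mom; apply: is_derive_eq.
by ring.
Qed.

Lemma is_derive_mom (t : R) : is_derive t 1 mom (- 2 * pot t).
Proof.
have ? := is_derive_ch t; have ? := is_derive_sh t.
have c0 : ch t != 0 by rewrite gt_eqF// ch_gt0.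
have di : is_derive t 1 (fun t => (ch t)^-1) (- (ch t) ^- 2 *: (2 * mu * sh t)).
  exact: is_deriveV.
rewrite /mom /pot; apply: is_derive_eq; rewrite /GRing.scale /=.
have := ch2_sh2 t; move: (ch t) (sh t) c0 => c s c0 h.
rewrite -h; field.
exact: c0.
Qed.

Lemma is_derive_act (t : R) : is_derive t 1 act (mom t ^+ 2 - 4^-1 - pot t).
Proof.
have ? := is_derive_mom t.
have c0 : ch t != 0 by rewrite gt_eqF// ch_gt0.
rewrite /act; apply: is_derive_eq; rewrite /GRing.scale /=.
rewrite /mom /pot; have := ch2_sh2 t; move: (ch t) (sh t) c0 => c s c0 h.
have hs : s ^+ 2 = c ^+ 2 - 4 by rewrite -h; ring.
have -> : (- mu * (s / c)) ^+ 2 = mu ^+ 2 * s ^+ 2 * c^-1 ^+ 2 by rewrite !exprMn; ring.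
rewrite hs; field.
exact: c0.
Qed.

Lemma pot_pos t : lam ^+ 2 * expR (2 * pos t) = pot t.
Proof.
have c0 := ch_gt0 t.
have -> : expR (2 * pos t) = (2 * mu / lam * (ch t)^-1) ^+ 2.
  rewrite /pos -ln_div ?posrE ?divr_gt0 ?mulr_gt0//.
  by rewrite expRM_natl lnK// posrE !divr_gt0// mulr_gt0.
rewrite /pot; field.
by rewrite !gt_eqF.
Qed.

Lemma ch_ge2 t : 2 <= ch t.
Proof.
rewrite -(@ler_pXn2r _ 2) ?nnegrE ?(ltW (ch_gt0 t))//.
by have := ch2_sh2 t; have := sqr_ge0 (sh t); lra.
Qed.

Lemma mom_le t : `|mom t| <= mu.
Proof.
have c0 := ch_gt0 t.
rewrite /mom normrM normrN (gtr0_norm mu0) ler_piMr ?(ltW mu0)//.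
rewrite normrM normfV (gtr0_norm c0) ler_pdivrMr// mul1r.
rewrite -(@ler_pXn2r _ 2) ?nnegrE ?(ltW c0)// real_normK ?num_real//.
by have := ch2_sh2 t; lra.
Qed.

Lemma pot_ge0 t : 0 <= pot t.
Proof. by apply: mulr_ge0; [apply: mulr_ge0 => //; exact: sqr_ge0|exact: sqr_ge0]. Qed.

Lemma pot_le t : pot t <= mu ^+ 2.
Proof.
have c0 := ch_gt0 t.
rewrite /pot exprVn ler_pdivrMr ?exprn_gt0// [leRHS]mulrC ler_wpM2r ?sqr_ge0//.
by have := ch2_sh2 t; have := sqr_ge0 (sh t); lra.
Qed.

(** The packet moves by at most [2 s] during a time [s / mu]: it stays near the
    turning point. *)
Lemma pos_bounds t : 0 <= t -> ln (mu / lam) - 2 * mu * t <= pos t <= ln (mu / lam).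
Proof.
move=> t0; have c0 := ch_gt0 t; have c2 := ch_ge2 t.
have e : 2 * mu / lam = 2 * (mu / lam) by rewrite mulrA.
have ml0 : 0 < mu / lam by rewrite divr_gt0.
have eln : ln (2 * (mu / lam)) = ln 2 + ln (mu / lam).
  by apply: lnM; rewrite posrE.
rewrite /pos e eln; apply/andP; split; last first.
  have : ln 2 <= ln (ch t) by rewrite ler_ln ?posrE.
  lra.
have : ln (ch t) <= ln (2 * expR (2 * mu * t)).
  rewrite ler_ln ?posrE ?mulr_gt0 ?expR_gt0// /ch.
  have mt : 0 <= 2 * mu * t by rewrite !mulr_ge0// ltW.
  have : expR (- (2 * mu * t)) <= expR (2 * mu * t) by rewrite ler_expR; lra.
  lra.
by rewrite [ln (2 * expR _)]lnM ?posrE ?expR_gt0// expRK; lra.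
Qed.

Lemma smooth_scale (V : normedModType R) (c : R) (f : V -> R) : smooth f ->
  smooth (fun x => c * f x).
Proof. by move=> sf; apply: smoothM => //; exact: smooth_cst. Qed.

Lemma smooth_ch : smooth ch.
Proof.
by apply: smoothD; apply: smooth_expR; [|apply: smoothN];
  apply: (smooth_scale (2 * mu)); exact: smooth_id.
Qed.

Lemma smooth_sh : smooth sh.
Proof.
by apply: smoothB; apply: smooth_expR; [|apply: smoothN];
  apply: (smooth_scale (2 * mu)); exact: smooth_id.
Qed.

Lemma smooth_pos : smooth pos.
Proof.
apply: smoothB; first exact: smooth_cst.
by apply: smooth_ln; [exact: ch_gt0|exact: smooth_ch].
Qed.

Lemma smooth_mom : smooth mom.
Proof.
apply: smooth_scale; apply: smoothM; first exact: smooth_sh.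
by apply: smooth_inv; [move=> t; rewrite gt_eqF// ch_gt0|exact: smooth_ch].
Qed.

Lemma smooth_act : smooth act.
Proof.
by apply: smoothD; [apply: smooth_scale; exact: smooth_id|exact: smooth_mom].
Qed.

(** The [m]-th derivative of the profile, rescaled to the width [delta]. *)
Definition amp (m : nat) (t r : R) : R := bumpn m ((r - pos t) / delta) / delta ^+ m.

Definition packet (t : R) : point -> R[i] :=
  wave lam (mom t) (pos t) (act t) (amp 0 t) (fun=> 0).

Lemma ampE m t r : amp m t r = bumpn m ((r - pos t) / delta) / delta ^+ m.
Proof. by []. Qed.

Lemma amp0E t r : amp 0 t r = bumpf ((r - pos t) / delta).
Proof. by rewrite /amp expr0 divr1. Qed.

Lemma is_derive_amp m t (r : R) : is_derive r 1 (amp m t) (amp m.+1 t r).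
Proof.
have dl : is_derive r 1 (fun r => (r - pos t) / delta) (delta^-1).
  by apply: is_derive_eq; rewrite /GRing.scale /=; ring.
have h := is_derive_bumpn m ((r - pos t) / delta).
have := @is_derive1_comp _ (bumpn m) (fun r => (r - pos t) / delta) r _ _ h dl.
rewrite /comp /amp => ?; apply: is_derive_eq.
by rewrite /GRing.scale /= exprS invfM; ring.
Qed.

Lemma amp_out m t r : delta < `|r - pos t| -> amp m t r = 0.
Proof.
move=> h; rewrite /amp bumpn_out ?mul0r// normrM normfV (gtr0_norm delta0).
by rewrite ltr_pdivlMr// mul1r.
Qed.

Section general_smoothness.
Variables (V : normedModType R) (r P M A : V -> R).
Hypotheses (sr : smooth r) (sP : smooth P) (sM : smooth M) (sA : smooth A).

Lemma smooth_carrier : smooth (fun z => expR (r z / 2) * bumpf ((r z - P z) / delta)).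
Proof.
apply: smoothM.
  by apply: smooth_expR; apply: smoothM => //; exact: smooth_cst.
apply: smooth_comp1; first exact: smooth_bump.
by apply: smoothM; [exact: smoothB|exact: smooth_cst].
Qed.

Lemma smooth_phase : smooth (fun z => M z * (r z - P z) + A z).
Proof. by apply: smoothD => //; apply: smoothM => //; exact: smoothB. Qed.

End general_smoothness.

Lemma test_packet t : lam * ell ord0 = 2 * pi -> delta < pos t -> test_cusp ell (packet t).
Proof.
move=> per pt; apply/test_cuspP.
have sS (k : 'I_n.+1) : smooth (fun z : R * R => mom t * (z.1 - pos t) + (act t + lam * z.2)).
  apply: smooth_phase; [exact: smooth_fst|exact: smooth_cst|exact: smooth_cst|].
  by apply: smoothD; [exact: smooth_cst|apply: smooth_scale; exact: smooth_snd].
have sC : smooth (fun z : R * R => expR (z.1 / 2) * bumpf ((z.1 - pos t) / delta)).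
  by apply: smooth_carrier; [exact: smooth_fst|exact: smooth_cst].
have supp : exists a b : R, 0 < a /\ forall x : point, amp 0 t x.1 != 0 -> a <= x.1 <= b.
  exists (pos t - delta), (pos t + delta); split; first by rewrite subr_gt0.
  move=> x; apply: contraNT => h; rewrite amp_out// ltNge.
  by apply: contra h; rewrite ler_norml => /andP[h1 h2]; apply/andP; split; lra.
have per2 (r s : R) : phase lam (mom t) (pos t) (act t) (r, ((ord0 : 'I_n.+1), s + ell ord0)) =
    phase lam (mom t) (pos t) (act t) (r, ((ord0 : 'I_n.+1), s)) + pi *+ 2.
  by rewrite /phase /= [lam * _]mulrDr per mulr_natl; ring.
split; split.
- move=> k; rewrite (_ : slice k _ = fun z => (k == ord0)%:R *
    (expR (z.1 / 2) * bumpf ((z.1 - pos t) / delta) *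
     cos (mom t * (z.1 - pos t) + (act t + lam * z.2)))).
    by apply: smooth_scale; apply: smoothM => //; apply: smooth_cos; exact: sS.
  apply/funext => z; rewrite /slice /rpart /packet /wave /rwave /phase /=.
  by rewrite amp0E [_ + (act t + _)]addrA; ring.
- move=> r k s; rewrite /rpart /packet /wave /= /rwave /=.
  have [->|_] := eqVneq k ord0; last by rewrite !mul0r.
  by rewrite per2 cosD2pi sinD2pi.
- have [a [b [a0 h]]] := supp; exists a, b; split => // x.
  move=> h'; apply: h; apply: contraNneq h' => h'.
  by rewrite /rpart /packet /wave /rwave /= h' !mul0r subr0 !mulr0.
- move=> k; rewrite (_ : slice k _ = fun z => (k == ord0)%:R *
    (expR (z.1 / 2) * bumpf ((z.1 - pos t) / delta) *
     sin (mom t * (z.1 - pos t) + (act t + lam * z.2)))).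
    by apply: smooth_scale; apply: smoothM => //; apply: smooth_sin; exact: sS.
  apply/funext => z; rewrite /slice /ipart /packet /wave /iwave /phase /=.
  by rewrite amp0E [_ + (act t + _)]addrA; ring.
- move=> r k s; rewrite /ipart /packet /wave /= /iwave /=.
  have [->|_] := eqVneq k ord0; last by rewrite !mul0r.
  by rewrite per2 cosD2pi sinD2pi.
- have [a [b [a0 h]]] := supp; exists a, b; split => // x.
  move=> h'; apply: h; apply: contraNneq h' => h'.
  by rewrite /ipart /packet /wave /iwave /= h' !mul0r addr0 !mulr0.
Qed.

End packet.

(** Everything can be computed at [s = 0], where packets are smooth in [(t, r)]. *)
Lemma wave_shift (R : realType) (n : nat) (lam Xi X Th : R) (A B : R -> R) (r s : R)
    (k : 'I_n.+1) :
  wave lam Xi X Th A B (r, (k, s)) =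
  wave lam Xi X Th A B (r, (k, 0)) * (cos (lam * s) +i* sin (lam * s))%C.
Proof.
apply: complexP; rewrite ?cReM ?cImM /= /rwave /iwave /phase /= mulr0 addr0;
  move: (Xi * _ + Th) => F; rewrite cosD sinD; ring.
Qed.

Section packet_dynamics.
Context {R : realType} {n : nat}.
Variables (lam mu delta : R).
Hypotheses (lam0 : 0 < lam) (mu0 : 0 < mu) (delta0 : 0 < delta).
Local Notation point := (R * ('I_n.+1 * R))%type.
Local Notation pos := (pos lam mu).
Local Notation mom := (mom mu).
Local Notation pot := (pot mu).
Local Notation act := (act mu).
Local Notation amp := (amp lam mu delta).
Local Notation packet := (@packet R n lam mu delta).

(** The time derivative of the phase [mom t * (r - pos t) + act t]. *)
Definition phase_rate (t r : R) : R :=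
  - 2 * pot t * (r - pos t) - mom t * (2 * mom t) + (mom t ^+ 2 - 4^-1 - pot t).

(** The time derivative of the packet. *)
Definition velocity (t : R) : point -> R[i] :=
  wave lam (mom t) (pos t) (act t) (fun r => - (2 * mom t) * amp 1 t r)
    (fun r => phase_rate t r * amp 0 t r).

(** Hamilton's equations cancel the terms of order [0] and [1] in [r - pos t], and
    the transport of the profile with speed [2 mom] cancels its first derivative. *)
Lemma residualE t x : velocity t x + 'i%C * neg_lap (packet t) x =
  wave lam (mom t) (pos t) (act t) (fun=> 0)
   (fun r => pot t * (expR (2 * (r - pos t)) - 1 - 2 * (r - pos t)) * amp 0 t r - amp 2 t r) x.
Proof.
have dA0 := is_derive_amp lam mu delta 0 t.
have dA1 := is_derive_amp lam mu delta 1 t.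
have d0 (r : R) : is_derive r 1 (fun=> 0 : R) 0 by exact: is_derive_cst.
rewrite /packet (neg_lap_wave lam (mom t) (pos t) (act t) dA0 d0 dA1 d0).
have := @waveZi R n lam (mom t) (pos t) (act t) 1; rewrite mulr1 => ->.
rewrite /velocity waveD; apply: wave_eq; first by ring.
rewrite /phase_rate.
have -> : lam ^+ 2 * expR (2 * x.1) = pot t * expR (2 * (x.1 - pos t)).
  rewrite -(pot_pos lam0 mu0) -mulrA -expRD; congr (_ * expR _); ring.
by field.
Qed.

Let a (z : R * R) : R :=
  expR (z.2 / 2) * bumpf ((z.2 - pos z.1) / delta) * cos (mom z.1 * (z.2 - pos z.1) + act z.1).
Let b (z : R * R) : R :=
  expR (z.2 / 2) * bumpf ((z.2 - pos z.1) / delta) * sin (mom z.1 * (z.2 - pos z.1) + act z.1).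

Let smooth_fst_comp (g : R -> R) : smooth g -> smooth (fun z : R * R => g z.1).
Proof. by move=> sg; apply: smooth_comp1 => //; exact: smooth_fst. Qed.

Let sa : smooth a.
Proof.
apply: smoothM.
  by apply: smooth_carrier; [exact: smooth_snd|exact: smooth_fst_comp (smooth_pos lam mu)].
apply: smooth_cos; apply: smooth_phase; [exact: smooth_snd| | |].
- exact: smooth_fst_comp (smooth_pos lam mu).
- exact: smooth_fst_comp (smooth_mom mu).
- exact: smooth_fst_comp (smooth_act mu).
Qed.

Let sb : smooth b.
Proof.
apply: smoothM.
  by apply: smooth_carrier; [exact: smooth_snd|exact: smooth_fst_comp (smooth_pos lam mu)].
apply: smooth_sin; apply: smooth_phase; [exact: smooth_snd| | |].
- exact: smooth_fst_comp (smooth_pos lam mu).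
- exact: smooth_fst_comp (smooth_mom mu).
- exact: smooth_fst_comp (smooth_act mu).
Qed.

Let packet0 (t r : R) : packet t (r, (ord0, 0)) = (a (t, r) +i* b (t, r))%C.
Proof.
rewrite /packet /wave /rwave /iwave /phase /a /b /= amp0E.
by congr (_ +i* _)%C; rewrite ?mulr0 ?addr0; ring.
Qed.

Let damp (t r : R) : is_derive t 1 (fun t => bumpf ((r - pos t) / delta))
  (- (2 * mom t) * amp 1 t r).
Proof.
have ? := is_derive_pos lam mu t.
have dl : is_derive t 1 (fun t => (r - pos t) / delta) (- (2 * mom t) / delta).
  by apply: is_derive_eq; rewrite /GRing.scale /=; ring.
have h := @is_derive_bumpn R 0 ((r - pos t) / delta).
have := @is_derive1_comp _ bumpf (fun t => (r - pos t) / delta) t _ _ h dl.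
rewrite /comp => ?; apply: is_derive_eq; rewrite ampE expr1; ring.
Qed.

Let dphase (t r : R) : is_derive t 1 (fun t => mom t * (r - pos t) + act t) (phase_rate t r).
Proof.
have ? := is_derive_pos lam mu t; have ? := is_derive_mom mu t.
have ? := is_derive_act mu t.
by apply: is_derive_eq; rewrite /GRing.scale /= /phase_rate; ring.
Qed.

Let velocity0 (t r : R) : velocity t (r, (ord0, 0)) =
  ('D_((1, 0) : R * R) a (t, r) +i* 'D_((1, 0) : R * R) b (t, r))%C.
Proof.
have da := derive_fst (t, r) sa; have db := derive_fst (t, r) sb.
have bd := damp t r; have dp := dphase t r.
have dc : is_derive t 1 (fun t => cos (mom t * (r - pos t) + act t))
   (- sin (mom t * (r - pos t) + act t) * phase_rate t r).
  exact: (@is_derive1_comp _ (@cos R) (fun t => mom t * (r - pos t) + act t)).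
have ds : is_derive t 1 (fun t => sin (mom t * (r - pos t) + act t))
   (cos (mom t * (r - pos t) + act t) * phase_rate t r).
  exact: (@is_derive1_comp _ (@sin R) (fun t => mom t * (r - pos t) + act t)).
have dprod (e : R) (f g : R -> R) df dg : is_derive t 1 f df -> is_derive t 1 g dg ->
    is_derive t 1 (fun t => e * f t * g t) (e * (df * g t + f t * dg)).
  by move=> ? ?; apply: is_derive_eq; rewrite /GRing.scale /=; ring.
have -> : 'D_((1, 0) : R * R) a (t, r) = expR (r / 2) *
    (- (2 * mom t) * amp 1 t r * cos (mom t * (r - pos t) + act t) -
     phase_rate t r * amp 0 t r * sin (mom t * (r - pos t) + act t)).
  rewrite -(@derive_val _ _ _ _ _ _ _ da) /a /=; apply: derive_val.
  by have h := dprod (expR (r / 2)) _ _ _ _ bd dc; apply: is_derive_eq; rewrite amp0E; ring.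
have -> : 'D_((1, 0) : R * R) b (t, r) = expR (r / 2) *
    (- (2 * mom t) * amp 1 t r * sin (mom t * (r - pos t) + act t) +
     phase_rate t r * amp 0 t r * cos (mom t * (r - pos t) + act t)).
  rewrite -(@derive_val _ _ _ _ _ _ _ db) /b /=; apply: derive_val.
  by have h := dprod (expR (r / 2)) _ _ _ _ bd ds; apply: is_derive_eq; rewrite amp0E; ring.
rewrite /velocity /wave /rwave /iwave /phase /=.
by congr (_ +i* _)%C; rewrite ?mulr0 ?addr0 mul1r.
Qed.

(** Where the packet vanishes throughout [0 <= t <= T] there is nothing to prove, and
    the remaining [r] form a bounded interval. *)
Lemma packet_taylor (T : R) : 0 <= T -> exists2 K, 0 <= K & forall (t tau : R) (x : point),
  0 <= t -> 0 <= tau -> t + tau <= T ->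
  normc (packet (t + tau) x - packet t x - tau%:C%C * velocity t x) <= K * tau ^+ 2.
Proof.
move=> T0.
(* all the positions reached before [T], up to the width of the packet *)
pose lo := ln (mu / lam) - 2 * mu * T - delta; pose hi := ln (mu / lam) + delta.
have [K1 K10 h1] := taylor_fst lo hi T0 sa.
have [K2 K20 h2] := taylor_fst lo hi T0 sb.
exists (K1 + K2); first exact: addr_ge0.
move=> t tau [r [k s]] t0 tau0 tT.
have tt : 0 <= t <= T by rewrite t0; lra.
have tauT : 0 <= tau <= T by rewrite tau0; lra.
rewrite /packet /velocity !(wave_shift _ _ _ _ _ _ r s k) mulrA -!mulrBl.
rewrite Normc.normcM (_ : normc (cos _ +i* sin _)%C = 1) ?mulr1; last first.
  by rewrite /= cos2Dsin2 sqrtr1.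
have [->|k0] := eqVneq k ord0; last first.
  have w0 (A B : R -> R) (M P Q : R) : wave lam M P Q A B (r, (k, 0)) = 0.
    by rewrite /wave /rwave /iwave /= (negbTE k0) !mul0r.
  by rewrite !w0 mulr0 !subr0 Normc.normc0 mulr_ge0 ?addr_ge0 ?sqr_ge0.
rewrite -[X in normc (X - _ - _)]/(packet (t + tau) (r, (ord0, 0))).
rewrite -[X in normc (_ - X - _)]/(packet t (r, (ord0, 0))).
rewrite -[X in normc (_ - _ * X)]/(velocity t (r, (ord0, 0))).
have [rr|rr] := boolP (lo <= r <= hi).
  rewrite !packet0 velocity0; apply: le_trans (normc_le_add _) _.
  rewrite mulrDl; apply: lerD.
    by have := h1 t tau r tt tauT rr; rewrite /= mul0r subr0.
  by have := h2 t tau r tt tauT rr; rewrite /= mul0r addr0.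
have out (t' : R) m : 0 <= t' -> t' <= T -> amp m t' r = 0.
  move=> t'0 t'T; apply: amp_out => //.
  have /andP[b1 b2] := pos_bounds lam0 mu0 t'0.
  rewrite ltNge; apply: contra rr; rewrite ler_norml => /andP[h3 h4].
  have : mu * t' <= mu * T by rewrite ler_pM2l.
  by rewrite /lo /hi => ?; apply/andP; split; lra.
have w0 (M P Q : R) : wave lam M P Q (fun=> 0) (fun=> 0) (r, ((ord0 : 'I_n.+1), 0)) = 0.
  by rewrite /wave /rwave /iwave /= !mul0r subr0 addr0 !mulr0.
have -> : packet (t + tau) (r, (ord0, 0)) = 0.
  rewrite -(w0 (mom (t + tau)) (pos (t + tau)) (act (t + tau))).
  by apply: wave_eq => //=; apply: out; rewrite ?addr_ge0.
have -> : packet t (r, (ord0, 0)) = 0.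
  rewrite -(w0 (mom t) (pos t) (act t)).
  by apply: wave_eq => //=; apply: out => //; lra.
have -> : velocity t (r, (ord0, 0)) = 0.
  rewrite -(w0 (mom t) (pos t) (act t)).
  by apply: wave_eq => /=; rewrite out ?mulr0//; lra.
by rewrite mulr0 !subr0 Normc.normc0 mulr_ge0 ?addr_ge0 ?sqr_ge0.
Qed.

End packet_dynamics.

(** * Size of the packets and of their residual *)

Section tubes.
Context {R : realType} {n : nat}.
Variable ell : 'I_n.+1 -> R.
Hypothesis ell0 : forall k, 0 < ell k.
Local Notation point := (R * ('I_n.+1 * R))%type.
Local Notation vol := (vol0 ell).

Definition tube (a b : R) : set point := `[a, b] `*` ([set ord0] `*` setT).

Let mexp : measurable_fun [set: measurableTypeR R] (fun r : measurableTypeR R => (expR (- r))%:E).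
Proof. by apply/measurable_EFinP; exact: measurableT_comp. Qed.

Lemma radial_itv_le (a b : R) : a <= b ->
  (@radial_measure R `[a, b] <= ((b - a) * expR (- a))%:E)%E.
Proof.
move=> ab; rewrite /radial_measure.
have mI : measurable (`[a, b] `&` `[0%R, +oo[ : set R) by exact: measurableI.
apply: (@le_trans _ _ (\int[lebesgue_measure]_(r in `[a, b] `&` `[0%R, +oo[) (cst (expR (- a))%:E r)))%E.
  apply: ge0_le_integral => //.
  - exact: (measurable_funTS mexp).
  - move=> r h; have /andP[ar _] : a <= r <= b by case: h.
    by rewrite lee_fin ler_expR lerN2.
rewrite integral_cst// mulrC EFinM lee_pmul2l ?lte_fin ?expR_gt0//.
apply: (@le_trans _ _ (lebesgue_measure (`[a, b] : set R))).
  by apply: le_measure; rewrite ?inE//; exact: subIsetl.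
by rewrite lebesgue_measure_itv /= lte_fin; case: ifPn => // _; rewrite lee_fin subr_ge0.
Qed.

Lemma radial_itv_ge (a b : R) : 0 <= a -> a <= b ->
  (((b - a) * expR (- b))%:E <= @radial_measure R `[a, b])%E.
Proof.
move=> a0 ab; rewrite /radial_measure.
have -> : `[a, b]%classic `&` `[0%R, +oo[%classic = `[a, b]%classic :> set R.
  apply/setIidPl => r /=; rewrite !in_itv/= andbT => /andP[ar _].
  exact: le_trans ar.
apply: (@le_trans _ _ (\int[lebesgue_measure]_(r in `[a, b]) (cst (expR (- b))%:E r)))%E.
  rewrite integral_cst// mulrC EFinM lee_pmul2l ?lte_fin ?expR_gt0//.
  have <- : lebesgue_measure (`[a, b] : set R) = (b - a)%:E; last exact: lexx.
  rewrite lebesgue_measure_itv /= lte_fin; case: ifPn => // /negPf h.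
  by move: ab; rewrite le_eqVlt h orbF => /eqP ->; rewrite subrr.
apply: ge0_le_integral => //.
- by move=> r _; rewrite lee_fin expR_ge0.
- exact: (measurable_funTS mexp).
- by move=> r /=; rewrite in_itv/= => /andP[_ rb]; rewrite lee_fin ler_expR lerN2.
Qed.

Lemma measurable_tube a b : measurable (tube a b).
Proof. by apply: measurableX => //; exact: measurableX. Qed.

Lemma vol_tube a b : vol (tube a b) = (@radial_measure R `[a, b] * (ell ord0)%:E)%E.
Proof.
have m0 : measurable ([set ord0] `*` setT : set ('I_n.+1 * R)) by exact: measurableX.
have hc : circle_measure ell ([set ord0] `*` setT) = (ell ord0)%:E.
  rewrite /circle_measure (bigD1 ord0)//= big1 ?adde0.
    rewrite (_ : xsection _ _ = setT) ?setTI.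
      by rewrite lebesgue_measure_itv /= lte_fin ell0 sube0.
    by apply/seteqP; split => // s _; rewrite /xsection /= inE.
  move=> k k0; rewrite (_ : xsection _ _ = set0) ?set0I ?measure0//.
  apply/seteqP; split => // s; rewrite /xsection /= inE => -[/= kk _].
  by rewrite kk eqxx in k0.
rewrite /tube [LHS](product_measure1E (@radial_measure R) (circle_measure ell))//.
by rewrite -hc.
Qed.

Lemma vol_tube_le a b : a <= b ->
  (vol (tube a b) <= ((b - a) * expR (- a) * ell ord0)%:E)%E.
Proof.
by move=> ab; rewrite vol_tube [leRHS]EFinM lee_wpmul2r ?radial_itv_le// lee_fin ltW.
Qed.

Lemma vol_tube_ge a b : 0 <= a -> a <= b ->
  (((b - a) * expR (- b) * ell ord0)%:E <= vol (tube a b))%E.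
Proof.
by move=> a0 ab; rewrite vol_tube EFinM lee_wpmul2r ?radial_itv_ge// lee_fin ltW.
Qed.

Lemma nsq_tube_le (f : point -> R[i]) (a b C V : R) : 0 <= C ->
  (vol (tube a b) <= V%:E)%E -> (forall x, normc (f x) <= C * \1_(tube a b) x) ->
  (nsq vol f <= (C ^+ 2 * V)%:E)%E.
Proof.
move=> C0 hV fC; have mt := measurable_tube a b.
apply: (@le_trans _ _ (\int[vol]_x ((C ^+ 2)%:E * (\1_(tube a b) x)%:E))%E).
  apply: ge0_le_integralT => x; first by rewrite lee_fin sqr_ge0.
  rewrite -EFinM lee_fin; apply: (@le_trans _ _ ((C * \1_(tube a b) x) ^+ 2)).
    by rewrite ler_pXn2r ?nnegrE ?normc_ge0// mulr_ge0.
  by rewrite exprMn ler_wpM2l ?sqr_ge0// indicE; case: (_ \in _); rewrite /= ?expr1n// expr0n.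
rewrite ge0_integralZl//; [|by apply/measurable_EFinP|by rewrite lee_fin sqr_ge0].
by rewrite integral_indic// setIT [leRHS]EFinM lee_wpmul2l// lee_fin sqr_ge0.
Qed.

Lemma nsq_tube_ge (f : point -> R[i]) (a b C V : R) : 0 <= C ->
  (V%:E <= vol (tube a b))%E -> (forall x, C * \1_(tube a b) x <= normc (f x)) ->
  ((C ^+ 2 * V)%:E <= nsq vol f)%E.
Proof.
move=> C0 hV fC; have mt := measurable_tube a b.
apply: (@le_trans _ _ (\int[vol]_x ((C ^+ 2)%:E * (\1_(tube a b) x)%:E))%E); last first.
  apply: ge0_le_integralT => x; first by rewrite -EFinM lee_fin mulr_ge0 ?sqr_ge0.
  rewrite -EFinM lee_fin; apply: (@le_trans _ _ ((C * \1_(tube a b) x) ^+ 2)).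
    by rewrite exprMn ler_wpM2l ?sqr_ge0// indicE; case: (_ \in _); rewrite /= ?expr1n// expr0n.
  by rewrite ler_pXn2r ?nnegrE ?normc_ge0// mulr_ge0.
rewrite ge0_integralZl//; [|by apply/measurable_EFinP|by rewrite lee_fin sqr_ge0].
by rewrite integral_indic// setIT [leLHS]EFinM lee_wpmul2l// lee_fin sqr_ge0.
Qed.

End tubes.

Lemma expR_taylor2 (R : realType) (z : R) : `|z| <= 1 ->
  `|expR z - 1 - z| <= expR 1 * z ^+ 2.
Proof.
move=> z1.
have d0 (y : R) : is_derive y 1 (fun y => expR y - y) (expR y - 1) by apply: is_derive_eq.
have e1 (y : R) : `|y| <= `|z| -> `|expR y| <= expR 1.
  move=> yz; rewrite ger0_norm ?expR_ge0// ler_expR.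
  by rewrite (le_trans (ler_norm _))// (le_trans yz).
have := @mvt_bound R _ _ z (expR 1 * `|z|) d0.
rewrite expR0 subr0 -[z ^+ 2]real_normK ?num_real// expr2 mulrA addrAC; apply => y yz.
have h := @mvt_bound R _ _ y (expR 1) (@is_derive_expR R).
move: h; rewrite expR0 => h; apply: (le_trans (h _)).
  by move=> x xy; apply: e1; exact: le_trans yz.
by rewrite ler_pM2l ?expR_gt0.
Qed.

Section wave_estimates.
Context {R : realType} {n : nat}.
Variable ell : 'I_n.+1 -> R.
Hypothesis ell0 : forall k, 0 < ell k.
Variables (lam delta : R).
Hypotheses (delta0 : 0 < delta) (delta2 : delta <= 2^-1).
Local Notation point := (R * ('I_n.+1 * R))%type.
Local Notation vol := (vol0 ell).
Local Notation e := (expR 1 : R).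

(** The squared [L^2] size of a wave of unit amplitude and radial width [delta],
    up to a constant: the factor [e^(r/2)] compensates the density [e^(-r)]. *)
Definition mass : R := 2 * e * ell ord0 * delta.

Lemma mass_gt0 : 0 < mass.
Proof. by rewrite !mulr_gt0 ?expR_gt0. Qed.

Lemma tube_mass (X : R) : (vol (tube (X - delta) (X + delta)) <= (mass * expR (- X))%:E)%E.
Proof.
have [d0 d2] := (delta0, delta2); have ab : X - delta <= X + delta by lra.
apply: le_trans (vol_tube_le ell0 ab) _.
rewrite lee_fin (_ : X + delta - (X - delta) = 2 * delta); last by ring.
rewrite (_ : - (X - delta) = - X + delta); last by ring.
rewrite expRD (_ : _ * ell ord0 = 2 * expR delta * ell ord0 * delta * expR (- X)); last by ring.
rewrite /mass ler_pM2r ?expR_gt0// ler_pM2r// ler_pM2r// ler_pM2l// ler_expR; lra.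
Qed.

Section a_wave.
Variables (Xi X Th : R) (A B : R -> R) (K : R).
Hypotheses (K0 : 0 <= K) (AB : forall r, `|A r| + `|B r| <= K).
Hypothesis out : forall r, delta < `|r - X| -> A r = 0 /\ B r = 0.
Local Notation wv := (@wave R n lam Xi X Th A B).

Lemma wave_pointwise (x : point) :
  normc (wv x) <= K * expR ((X + delta) / 2) * \1_(tube (X - delta) (X + delta)) x.
Proof.
rewrite normc_wave indicE.
have [k0|_] := eqVneq x.2.1 ord0; last by rewrite mul0r !mulr_ge0 ?expR_ge0.
rewrite mul1r.
have [d|d] := ltP delta `|x.1 - X|.
  have [-> ->] := out d.
  by rewrite [normc _]Normc.normc0 mulr0 !mulr_ge0 ?expR_ge0.
have h : X - delta <= x.1 <= X + delta.
  by move: d; rewrite ler_norml => /andP[h1 h2]; apply/andP; split; lra.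
rewrite mem_set; last by split; [rewrite /= in_itv|split].
rewrite mulr1 mulrC; apply: ler_pM; rewrite ?normc_ge0 ?expR_ge0//.
  by apply: le_trans (normc_le_add _) _; exact: AB.
by rewrite ler_expR ler_pM2r//; case/andP: h.
Qed.

(** The growth [e^r] of the squared modulus compensates the volume density [e^(- r)]:
    the bound does not depend on the position [X]. *)
Lemma wave_norm : (cLnorm vol 2%:E wv <= (K * Num.sqrt mass)%:E)%E.
Proof.
have m0 := ltW mass_gt0; have [d0 d2] := (delta0, delta2).
rewrite cLnorm2_le ?mulr_ge0 ?sqrtr_ge0//.
have := @nsq_tube_le R n ell wv (X - delta) (X + delta) (K * expR ((X + delta) / 2))
  (2 * expR delta * ell ord0 * delta * expR (- X)).
move=> /(_ (mulr_ge0 K0 (expR_ge0 _))) h; apply: le_trans (h _ wave_pointwise) _.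
  have ab : X - delta <= X + delta by lra.
apply: le_trans (vol_tube_le ell0 ab) _.
  rewrite lee_fin (_ : X + delta - (X - delta) = 2 * delta); last by ring.
  rewrite (_ : - (X - delta) = - X + delta); last by ring.
  by rewrite expRD; apply: eq_leW; ring.
rewrite lee_fin !exprMn sqr_sqrtr// -[leLHS]mulrA ler_wpM2l ?sqr_ge0//.
rewrite -expRM_natl (_ : 2 * ((X + delta) / 2) = X + delta); last by field.
rewrite expRD expRN (_ : _ * _ = expR delta * expR delta * (2 * ell ord0 * delta)); last first.
  by field; rewrite gt_eqF ?expR_gt0.
rewrite /mass (_ : 2 * e * _ * _ = e * (2 * ell ord0 * delta)); last by ring.
rewrite ler_pM2r ?mulr_gt0// -expRD ler_expR; lra.
Qed.

Lemma cmeasurable_wave : measurable_fun [set: R] A -> measurable_fun [set: R] B ->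
  cmeasurable wv.
Proof.
move=> mA mB.
have mx (f : R -> R) : measurable_fun [set: R] f ->
    measurable_fun [set: R * R] (fun z : R * R => f z.1).
  by move=> mf; apply: (measurableT_comp mf); exact: measurable_fst.
have mph : measurable_fun [set: R * R]
    (fun z : R * R => Xi * (z.1 - X) + Th + lam * z.2).
  apply: measurable_funD; last by apply: measurable_funM => //; exact: measurable_snd.
  apply: measurable_funD => //; apply: measurable_funM => //.
  by apply: measurable_funB => //; exact: measurable_fst.
have mcos : measurable_fun [set: R * R]
    (fun z : R * R => cos (Xi * (z.1 - X) + Th + lam * z.2)).
  apply: (@measurableT_comp _ _ _ _ _ _ (@cos R)) mph.
  by apply: continuous_measurable_fun; exact: continuous_cos.
have msin : measurable_fun [set: R * R]
    (fun z : R * R => sin (Xi * (z.1 - X) + Th + lam * z.2)).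
  apply: (@measurableT_comp _ _ _ _ _ _ (@sin R)) mph.
  by apply: continuous_measurable_fun; exact: continuous_sin.
have mexp : measurable_fun [set: R * R] (fun z : R * R => expR (z.1 / 2)).
  apply: measurableT_comp => //; apply: measurable_funM => //; exact: measurable_fst.
split; apply: measurable_cusp => k; rewrite /= /rwave /iwave /phase /=;
  apply: measurable_funM => //; apply: measurable_funM => //.
  by apply: measurable_funB; apply: measurable_funM => //; exact: mx.
by apply: measurable_funD; apply: measurable_funM => //; exact: mx.
Qed.

End a_wave.

End wave_estimates.

Section packet_estimates.
Context {R : realType} {n : nat}.
Variable ell : 'I_n.+1 -> R.
Hypothesis ell0 : forall k, 0 < ell k.
Variables (lam mu delta : R).
Hypotheses (lam0 : 0 < lam) (mu1 : 1 <= mu) (delta0 : 0 < delta) (delta2 : delta <= 2^-1).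
Hypothesis scaling : delta ^+ 2 * mu = 1.
Variables C0 C1 C2 : R.
Hypotheses (hC0 : forall y : R, `|bumpn 0 y| <= C0) (hC1 : forall y : R, `|bumpn 1 y| <= C1)
  (hC2 : forall y : R, `|bumpn 2 y| <= C2).
Local Notation point := (R * ('I_n.+1 * R))%type.
Local Notation vol := (vol0 ell).
Local Notation e := (expR 1 : R).
Local Notation pos := (pos lam mu).
Local Notation mom := (mom mu).
Local Notation pot := (pot mu).
Local Notation amp := (amp lam mu delta).
Local Notation packet := (@packet R n lam mu delta).
Local Notation velocity := (@velocity R n lam mu delta).
Local Notation size := (Num.sqrt (mass ell delta)).

Let mu0 : 0 < mu. Proof. exact: lt_le_trans mu1. Qed.
Let e0 : 0 < e. Proof. exact: expR_gt0. Qed.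

Let C00 : 0 <= C0. Proof. exact: le_trans (hC0 0). Qed.
Let C10 : 0 <= C1. Proof. exact: le_trans (hC1 0). Qed.
Let C20 : 0 <= C2. Proof. exact: le_trans (hC2 0). Qed.

Let inv_delta : delta^-1 <= mu.
Proof.
have -> : delta^-1 = delta * mu.
  by rewrite -[LHS]mulr1 -scaling; field; rewrite gt_eqF.
by rewrite -[leRHS]mul1r ler_pM2r//; apply: le_trans delta2 _; rewrite invf_le1// ler1n.
Qed.

Let inv_delta2 : delta ^- 2 = mu.
Proof.
by rewrite -[LHS]mulr1 -scaling; field; rewrite gt_eqF.
Qed.

Let amp0_le t r : `|amp 0 t r| <= C0.
Proof. by rewrite ampE expr0 divr1. Qed.

Let amp1_le t r : `|amp 1 t r| <= C1 * mu.
Proof.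
have d0 : 0 <= delta^-1 by rewrite invr_ge0 ltW.
by rewrite ampE expr1 normrM (ger0_norm d0) ler_pM.
Qed.

Let amp2_le t r : `|amp 2 t r| <= C2 * mu.
Proof. by rewrite ampE normrM inv_delta2 (gtr0_norm mu0) ler_pM2r. Qed.

Let near_pos t r : `|r - pos t| <= delta -> `|2 * (r - pos t)| <= 1.
Proof.
have d2 := delta2; move=> h; rewrite normrM ger0_norm//.
apply: le_trans (_ : 2 * 2^-1 <= 1); last by rewrite mulfV.
by rewrite ler_pM2l//; exact: le_trans h d2.
Qed.

Lemma packet_norm t : (cLnorm vol 2%:E (packet t) <= (C0 * size)%:E)%E.
Proof.
apply: (wave_norm ell0) => //.
- by move=> r; rewrite normr0 addr0.
- by move=> r h; rewrite amp_out.
Qed.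

Lemma packet_pointwise t (x : point) :
  normc (packet t x) <= C0 * expR ((pos t + delta) / 2) *
    \1_(tube (pos t - delta) (pos t + delta)) x.
Proof.
apply: wave_pointwise => //.
- by move=> r; rewrite normr0 addr0.
- by move=> r h; rewrite amp_out.
Qed.

(** On the width of the packet [pot * (e^z - 1 - z)], with [z = 2 (r - pos t)], is at
    most of order [mu^2 * delta^2 = mu], and the second derivative of the profile is
    of order [delta^-2 = mu]. *)
Lemma residual_norm t : (cLnorm vol 2%:E (fun x => (velocity t x + 'i%C * neg_lap (packet t) x)%R)
  <= ((4 * e * C0 + C2) * mu * size)%:E)%E.
Proof.
rewrite (_ : (fun x => _) = wave lam (mom t) (pos t) (act mu t) (fun=> 0)
   (fun r => pot t * (expR (2 * (r - pos t)) - 1 - 2 * (r - pos t)) * amp 0 t r - amp 2 t r)).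
  2: by apply/funext => x; rewrite residualE.
apply: (wave_norm ell0) => //.
- by rewrite mulr_ge0 ?addr_ge0 ?mulr_ge0 ?(ltW e0) ?(ltW mu0).
- move=> r; rewrite normr0 add0r.
  have [d|d] := ltP delta `|r - pos t|.
    rewrite !amp_out// mulr0 subr0 normr0.
    by rewrite mulr_ge0 ?addr_ge0 ?mulr_ge0 ?(ltW e0) ?(ltW mu0).
  rewrite [leRHS]mulrDl; apply: le_trans (ler_normB _ _) _; apply: lerD => //.
  rewrite normrM (_ : 4 * e * C0 * mu = 4 * e * mu * C0); last by ring.
  apply: ler_pM => //; rewrite normrM (ger0_norm (pot_ge0 mu t)).
  have -> : 4 * e * mu = mu ^+ 2 * (e * (4 * delta ^+ 2)).
    by rewrite -[LHS]mulr1 -scaling; ring.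
  apply: ler_pM; rewrite ?pot_ge0 ?pot_le//.
  apply: le_trans (expR_taylor2 (near_pos d)) _.
  rewrite ler_pM2l// exprMn -[_ ^+ 2 in X in _ <= X]/(delta ^+ 2).
  rewrite (_ : (2 : R) ^+ 2 = 4); last by ring.
  rewrite ler_pM2l// -[leLHS]real_normK ?num_real//.
  by rewrite ler_pXn2r ?nnegrE// ltW.
- by move=> r h; rewrite !amp_out// mulr0 subr0.
Qed.

Lemma energy_norm t : (cLnorm vol 2%:E (neg_lap (packet t))
  <= ((C2 + (2 + e) * C0 + 2 * C1) * mu ^+ 2 * size)%:E)%E.
Proof.
have dA0 := is_derive_amp lam mu delta 0 t.
have dA1 := is_derive_amp lam mu delta 1 t.
have d0 (r : R) : is_derive r 1 (fun=> 0 : R) 0 by exact: is_derive_cst.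
have m2 : mu <= mu ^+ 2 by rewrite expr2 ler_peMr// (ltW mu0).
have m12 : 1 <= mu ^+ 2 by exact: le_trans m2.
have K0 : 0 <= C2 + (2 + e) * C0 + 2 * C1.
  by rewrite !addr_ge0// mulr_ge0// addr_ge0// (ltW e0).
rewrite [neg_lap _](neg_lap_wave lam (mom t) (pos t) (act mu t) dA0 d0 dA1 d0).
apply: (wave_norm ell0) => //.
- by rewrite mulr_ge0// sqr_ge0.
- move=> r; rewrite mulr0 oppr0 addr0 mulr0 addr0 add0r.
  have [d|d] := ltP delta `|r - pos t|.
    rewrite !amp_out// !mulr0 oppr0 addr0 normr0.
    by rewrite addr0 mulr_ge0 ?sqr_ge0.
  have ->: lam ^+ 2 * expR (2 * r) = pot t * expR (2 * (r - pos t)).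
    rewrite -(pot_pos lam0 mu0) -mulrA -expRD; congr (_ * expR _); ring.
  rewrite [(C2 + _ + _) * _]mulrDl [(C2 + _) * _]mulrDl; apply: lerD.
    apply: le_trans (ler_normD _ _) _; apply: lerD.
      rewrite normrN; apply: le_trans (amp2_le _ _) _; exact: ler_wpM2l.
    rewrite normrM (_ : _ * C0 * mu ^+ 2 = (2 + e) * mu ^+ 2 * C0); last by ring.
    apply: ler_pM => //.
    have mm : mom t ^+ 2 <= mu ^+ 2.
      by rewrite -[leLHS]real_normK ?num_real// ler_pXn2r ?nnegrE ?mom_le// ltW.
    have pe : pot t * expR (2 * (r - pos t)) <= mu ^+ 2 * e.
      apply: ler_pM; rewrite ?pot_ge0 ?pot_le ?expR_ge0// ler_expR.
      exact: le_trans (ler_norm _) (near_pos d).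
    have := sqr_ge0 (mom t); have := pot_ge0 mu t; have := expR_ge0 (2 * (r - pos t)).
    move=> h1 h2 h3; have h4 : 0 <= (4^-1 : R) by rewrite invr_ge0.
    rewrite ger0_norm; last exact: addr_ge0 (addr_ge0 h4 h3) (mulr_ge0 h2 h1).
    lra.
  rewrite normrN normrM normrM (ger0_norm (_ : 0 <= 2))//.
  rewrite (_ : 2 * C1 * mu ^+ 2 = 2 * mu * (C1 * mu)); last by ring.
  by apply: ler_pM => //; rewrite ?mulr_ge0// ler_pM2l// mom_le.
- by move=> r h; rewrite !amp_out// !mulr0 oppr0 !addr0.
Qed.

(** Half of the packet, [pos t <= r <= pos t + delta / 2], is enough. *)
Lemma packet_mass t : 0 <= pos t ->
  ((expR (-2) ^+ 2 / (4 * e ^+ 2) * mass ell delta)%:E <= nsq vol (packet t))%E.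
Proof.
move=> p0; have [d0 d2] := (delta0, delta2).
have ab : pos t <= pos t + delta / 2 by lra.
have := @nsq_tube_ge R n ell (packet t) (pos t) (pos t + delta / 2)
  (expR (-2) * expR (pos t / 2)) _ _ (vol_tube_ge ell0 p0 ab).
move=> h; apply: le_trans (h _ _); last 2 first.
- by rewrite mulr_ge0 ?expR_ge0.
- move=> x; rewrite normc_wave indicE.
  have [|_] := boolP (x \in _); last first.
    by rewrite mulr0 !mulr_ge0 ?expR_ge0 ?normc_ge0.
  rewrite inE => -[/=]; rewrite in_itv/= => /andP[h1 h2] [-> _].
  rewrite eqxx mulr1 mul1r mulrC; apply: ler_pM; rewrite ?expR_ge0//.
    by rewrite ler_expR ler_pM2r.
  rewrite expr0n addr0 sqrtr_sqr amp0E; apply: le_trans (ler_norm _); apply: bump_low.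
  by rewrite normrM normfV (gtr0_norm delta0) ler_pdivrMr// ger0_norm; lra.
rewrite lee_fin !exprMn -[expR (pos t / 2) ^+ 2]expRM_natl.
rewrite (_ : 2 * (pos t / 2) = pos t); last by field.
have := sqr_ge0 (expR (-2) : R); move: (expR (-2) ^+ 2) => c c0.
rewrite (_ : pos t + delta / 2 - pos t = delta / 2); last by ring.
have -> : expR (- (pos t + delta / 2)) = expR (- (delta / 2)) / expR (pos t).
  by rewrite -expRN -expRD; congr expR; ring.
rewrite [leRHS](_ : _ = c * (delta / 2 * expR (- (delta / 2)) * ell ord0)); last first.
  by field; rewrite gt_eqF ?expR_gt0.
rewrite -mulrA ler_wpM2l// /mass.
rewrite (_ : _^-1 * _ = delta / 2 * e^-1 * ell ord0); last by field; rewrite gt_eqF.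
rewrite ler_pM2r// ler_pM2l ?divr_gt0// -expRN ler_expR; lra.
Qed.

End packet_estimates.

(** * The exact evolution of a packet *)

Section cutoff_symbol.
Context {R : realType}.

(** The value at [0] is [1], and the width [K] controls how flat the symbol is there. *)
Definition cutoff_symbol (K y : R) : R[i] := (bumpf (y / K) / bumpf 0)%:C%C.

Variables (K C1 : R).
Hypotheses (K0 : 0 < K) (hC1 : forall y : R, `|bumpn 1 y| <= C1).

Lemma cutoff_symbol_out y : cutoff_symbol K y != 0 -> `|y| <= K.
Proof.
apply: contraNT; rewrite -ltNge => h; rewrite /cutoff_symbol.
have -> : bumpf (y / K) = 0; last by rewrite mul0r.
apply: (bumpn_out 0).
by rewrite normrM normfV (gtr0_norm K0) ltr_pdivlMr// mul1r.
Qed.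

Lemma cutoff_symbol_le1 y : normc (cutoff_symbol K y) <= 1.
Proof.
have b0 := @bump0_gt0 R.
rewrite /cutoff_symbol normc_real ger0_norm; last by rewrite divr_ge0 ?bump_ge0.
by rewrite ler_pdivrMr// mul1r bump_le0.
Qed.

Lemma test_cutoff_symbol : test_line (cutoff_symbol K).
Proof.
split; last by exists K => y; exact: cutoff_symbol_out.
split; last exact: smooth_cst.
apply: smoothM; last exact: smooth_cst.
apply: smooth_comp1; first exact: smooth_bump.
by apply: smoothM; [exact: smooth_id|exact: smooth_cst].
Qed.

Lemma cutoff_symbol_near1 y :
  normc (1 - cutoff_symbol K y) <= C1 / (bumpf 0 * K) * `|y|.
Proof.
have b0 := @bump0_gt0 R.
have h := @mvt_bound R bumpf _ (y / K) C1 (is_derive_bumpn 0).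
have -> : 1 - cutoff_symbol K y = ((bumpf 0 - bumpf (y / K)) / bumpf 0)%:C%C.
  by rewrite /cutoff_symbol mulrBl divff ?gt_eqF// rmorphB.
rewrite normc_real normrM normfV (gtr0_norm b0) distrC.
have := h (fun z _ => hC1 z); rewrite normrM normfV (gtr0_norm K0) => h'.
rewrite ler_pdivrMr//; apply: le_trans h' _.
by apply: eq_leW; field; rewrite !gt_eqF.
Qed.

Lemma cmeasurable_cutoff_symbol (c : R) : cmeasurable (fun l => cutoff_symbol K (c * l)).
Proof.
apply: cmeasurable_real; apply: continuous_measurable_fun.
apply: (@smooth_continuous R R).
apply: smoothM; last exact: smooth_cst.
apply: smooth_comp1; first exact: smooth_bump.
by do !apply: smoothM; rewrite ?[smooth _]smooth_cst//; exact: smooth_id || exact: smooth_cst.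
Qed.

End cutoff_symbol.

Section tracking.
Context {R : realType} {n : nat}.
Variable ell : 'I_n.+1 -> R.
Hypothesis ell0 : forall k, 0 < ell k.
Variables (lam mu delta : R).
Hypotheses (lam0 : 0 < lam) (mu1 : 1 <= mu) (delta0 : 0 < delta) (delta2 : delta <= 2^-1).
Hypothesis scaling : delta ^+ 2 * mu = 1.
Hypothesis period : lam * ell ord0 = 2 * pi.
Variables C0 C1 C2 : R.
Hypotheses (hC0 : forall y : R, `|bumpn 0 y| <= C0) (hC1 : forall y : R, `|bumpn 1 y| <= C1)
  (hC2 : forall y : R, `|bumpn 2 y| <= C2).
Local Notation point := (R * ('I_n.+1 * R))%type.
Local Notation vol := (vol0 ell).
Local Notation e := (expR 1 : R).
Local Notation pos := (pos lam mu).
Local Notation mom := (mom mu).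
Local Notation pot := (pot mu).
Local Notation amp := (amp lam mu delta).
Local Notation packet := (@packet R n lam mu delta).
Local Notation velocity := (@velocity R n lam mu delta).
Local Notation size := (Num.sqrt (mass ell delta)).

Let mu0 : 0 < mu. Proof. exact: lt_le_trans mu1. Qed.

Let measurable_amp m t : measurable_fun [set: R] (amp m t).
Proof.
apply: continuous_measurable_fun => r; apply: differentiable_continuous.
by apply/derivable1_diffP; have [] := is_derive_amp lam mu delta m t r.
Qed.

Let cmeasurable_velocity t : cmeasurable (velocity t).
Proof.
apply: cmeasurable_wave; apply: measurable_funM => //.
rewrite /phase_rate; apply: measurable_funD => //; apply: measurable_funB => //.
by apply: measurable_funM => //; exact: measurable_funB.
Qed.

(** The error of one step is the residual of the equation plus a Taylor remainder
    in time. The constant [C] may depend on [h] in any way: it is multiplied by the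
    step size in [propagated_close]. *)
Lemma packet_step (T : R) : 0 <= T -> (forall t : R, 0 <= t <= T -> delta < pos t) ->
  exists C, forall t tau : R, 0 <= t -> 0 <= tau -> t + tau <= T ->
  (cLnorm vol 2%:E (fun x => (packet (t + tau) x - packet t x
      + 'i%C * tau%:C%C * neg_lap (packet t) x)%R)
   <= (tau * ((4 * e * C0 + C2) * mu * size) + C * tau ^+ 2)%:E)%E.
Proof.
move=> T0 far; have [K K0 hK] := @packet_taylor R n lam mu delta lam0 mu0 delta0 T T0.
have cm (t : R) : 0 <= t <= T -> cmeasurable (packet t).
  by move=> /far h; apply: in_L2_cmeasurable; apply: (test_in_L2 ell0); exact: test_packet.
have cmA (t : R) : 0 <= t <= T -> cmeasurable (neg_lap (packet t)).
  move=> /far h; apply: in_L2_cmeasurable; apply: (test_in_L2 ell0); apply: test_neg_lap.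
  exact: test_packet.
pose V := fine (vol [set: point]).
have VE : vol [set: point] = V%:E by rewrite fineK// ge0_fin_numE// vol0_fin.
have V0 : 0 <= V by exact: fine_ge0.
exists (K * Num.sqrt V) => t tau t0 tau0 tT.
have tt : 0 <= t <= T by rewrite t0 /=; lra.
have tt' : 0 <= t + tau <= T by rewrite addr_ge0.
pose f := fun x => packet (t + tau) x - packet t x - tau%:C%C * velocity t x.
pose g := fun x => tau%:C%C * (velocity t x + 'i%C * neg_lap (packet t) x).
have -> : (fun x => packet (t + tau) x - packet t x + 'i%C * tau%:C%C * neg_lap (packet t) x) =
    (fun x => f x + g x).
  by apply/funext => x; rewrite /f /g; ring.
have mg' : cmeasurable (fun x => velocity t x + 'i%C * neg_lap (packet t) x).
  apply: cmeasurableD => //; apply: cmeasurableM; [exact: cmeasurable_cst|exact: cmA].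
have mg : cmeasurable g by apply: cmeasurableM => //; exact: cmeasurable_cst.
have mf : cmeasurable f.
  rewrite /f (_ : (fun x => _) = (fun x => (packet (t + tau) x + (-1) * packet t x) +
    (-1) * (tau%:C%C * velocity t x))); last by apply/funext => x; rewrite !mulN1r.
  do ![apply: cmeasurableD|apply: cmeasurableM|exact: cmeasurable_cst] => //; exact: cm.
apply: le_trans (cLnormD _ mf mg) _; rewrite addeC [leRHS]EFinD; apply: leeD.
  apply: (@le_trans _ _ (tau%:E * cLnorm vol 2%:E (fun x => (velocity t x + 'i%C * neg_lap (packet t) x)%R))%E).
    by apply: le_cLnorm2 => // x; rewrite /g Normc.normcM normc_real ger0_norm.
  by rewrite [leRHS]EFinM; apply: lee_wpmul2l => //; exact: residual_norm.
rewrite cLnorm2_le; last by rewrite mulr_ge0 ?sqr_ge0// mulr_ge0 ?sqrtr_ge0.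
apply: (@le_trans _ _ (\int[vol]_x (cst ((K * tau ^+ 2) ^+ 2)%:E x))%E).
  apply: ge0_le_integralT => x; first by rewrite lee_fin sqr_ge0.
  rewrite lee_fin ler_pXn2r ?nnegrE ?normc_ge0 ?mulr_ge0 ?sqr_ge0//.
  exact: hK.
rewrite integral_cst// [X in (_ * X)%E]VE -EFinM lee_fin.
rewrite !exprMn sqr_sqrtr//; apply: eq_leW; ring.
Qed.

(** The two error terms are small for a short time [s] and a wide cutoff [K],
    uniformly in [mu]. *)
Lemma packet_tracking (S : spectral_rep vol (neg_Delta0 ell)) (K s t : R) :
  0 < K -> 0 <= s -> (forall t : R, 0 <= t <= s / mu -> delta < pos t) ->
  0 <= t <= s / mu ->
  let Psi := schrodinger S t (cutoff S (cutoff_symbol K) mu^-1 (packet 0)) in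
  in_L2 vol Psi /\
  (cLnorm vol 2%:E (fun x => (Psi x - packet t x)%R) <=
    ((s * (4 * e * C0 + C2) + C1 / (bumpf 0 * K) * (C2 + (2 + e) * C0 + 2 * C1)) * size)%:E)%E.
Proof.
move=> K0 s0 far /andP[t0 ts].
have far' (t' : R) : 0 <= t' <= t -> delta < pos t'.
  by move=> /andP[h1 h2]; apply: far; rewrite h1 (le_trans h2).
have [C hC] := packet_step t0 far'.
have test (t' : R) : 0 <= t' <= t -> test_cusp ell (packet t').
  by move=> /far' h; exact: test_packet.
have b0 := @bump0_gt0 R.
have c0 : 0 <= C1 / (bumpf 0 * K) * (mu^-1 ^+ 2).
  apply: mulr_ge0; last exact: sqr_ge0.
  by apply: divr_ge0; [exact: le_trans (hC1 0)|exact: ltW (mulr_gt0 b0 K0)].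
have phiK (l : R) : cutoff_symbol K (mu^-1 ^+ 2 * l) != 0 -> `|l| <= K * mu ^+ 2.
  move=> /(cutoff_symbol_out K0).
  by rewrite normrM ger0_norm ?sqr_ge0// exprVn ler_pdivrMl ?exprn_gt0// mulrC.
have near1 (l : R) : normc (1 - cutoff_symbol K (mu^-1 ^+ 2 * l)) <=
    C1 / (bumpf 0 * K) * mu^-1 ^+ 2 * `|l|.
  apply: le_trans (cutoff_symbol_near1 K0 hC1 _) _.
  by rewrite normrM (ger0_norm (sqr_ge0 _)) mulrA.
have [PL h] := @propagated_close _ _ _ _ _ S _ _ (cmeasurable_cutoff_symbol K (mu^-1 ^+ 2))
   (fun l => cutoff_symbol_le1 K _) phiK packet (fun t => neg_lap (packet t)) t _ _ _ t0
   (fun t' h => test_in_L2 ell0 (test t' h))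
   (fun t' h => test_in_L2 ell0 (test_neg_lap (test t' h)))
   (fun t' h => neg_Delta0_test ell0 (test t' h))
   (fun t' _ => packet_norm ell0 lam mu delta0 delta2 hC0 t') hC _ _ c0 near1
   (energy_norm ell0 lam0 mu1 delta0 delta2 scaling hC0 hC1 hC2 t).
split => //; apply: le_trans h _; rewrite lee_fin.
rewrite [leRHS]mulrDl; apply: lerD.
  have sz : 0 <= (4 * e * C0 + C2) * size.
    rewrite mulr_ge0 ?sqrtr_ge0// addr_ge0 ?(le_trans _ (hC2 0))//.
    by rewrite !mulr_ge0 ?expR_ge0 ?(le_trans _ (hC0 0)).
  rewrite (_ : t * _ = (t * mu) * ((4 * e * C0 + C2) * size)); last by ring.
  by rewrite -[leRHS]mulrA ler_wpM2r// -ler_pdivlMr.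
apply: eq_leW; field.
by rewrite !gt_eqF.
Qed.

End tracking.

(** * Lower bound for the exact evolution *)

Section mean_zero.
Context {R : realType} {n : nat}.
Variable ell : 'I_n.+1 -> R.
Hypothesis ell0 : forall k, 0 < ell k.
Variables (lam Xi X Th : R) (A : R -> R).
Hypotheses (lam0 : 0 < lam) (period : lam * ell ord0 = 2 * pi).
Local Notation wv := (@wave R n lam Xi X Th A (fun=> 0)).
Local Notation ph r a := (phase lam Xi X Th (r, a)).

Let phase_period (r : R) : ph r ((ord0 : 'I_n.+1), ell ord0) =
  ph r ((ord0 : 'I_n.+1), 0) + pi *+ 2.
Proof. by rewrite /phase /= mulr0 addr0 period mulr_natl. Qed.

Let bound (r : R) a : `|Re (wv (r, a))| <= expR (r / 2) * normc (A r +i* 0)%C /\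
  `|Im (wv (r, a))| <= expR (r / 2) * normc (A r +i* 0)%C.
Proof.
have h : normc (wv (r, a)) <= expR (r / 2) * normc (A r +i* 0)%C.
  rewrite normc_wave; case: (_ == _); rewrite ?mul1r// mul0r.
  by rewrite mulr_ge0 ?expR_ge0 ?normc_ge0.
by split; [apply: le_trans (Re_le_normc _) h|apply: le_trans (Im_le_normc _) h].
Qed.

(** A wave of nonzero frequency is the derivative of a periodic function. *)
Lemma wave_mean_Re (r : R) : (\int[circle_measure ell]_a (Re (wv (r, a)))%:E = 0)%E.
Proof.
apply: (@integral_circle_deriv R n ell (fun a => (a.1 == ord0)%:R *
    (expR (r / 2) * A r * lam^-1 * sin (ph r a))) _ _ ell0).
- by move=> a; exact: (bound r a).1.
- move=> k s /=; rewrite /rwave /phase /=; apply: is_derive_eq.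
  by rewrite /GRing.scale /=; field; rewrite gt_eqF.
- move=> k s; rewrite /= /rwave /phase /=; apply: differentiable_continuous.
  apply/derivable1_diffP.
  exact: (@ex_derive _ _ _ (s : R) 1).
- move=> k /=; have [->|_] := eqVneq k ord0; last by rewrite !mul0r.
  by rewrite phase_period sinD2pi.
Qed.

Lemma wave_mean_Im (r : R) : (\int[circle_measure ell]_a (Im (wv (r, a)))%:E = 0)%E.
Proof.
apply: (@integral_circle_deriv R n ell (fun a => (a.1 == ord0)%:R *
    (- (expR (r / 2) * A r * lam^-1 * cos (ph r a)))) _ _ ell0).
- by move=> a; exact: (bound r a).2.
- move=> k s /=; rewrite /iwave /phase /=; apply: is_derive_eq.
  by rewrite /GRing.scale /=; field; rewrite gt_eqF.
- move=> k s; rewrite /= /iwave /phase /=; apply: differentiable_continuous.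
  apply/derivable1_diffP.
  exact: (@ex_derive _ _ _ (s : R) 1).
- move=> k /=; have [->|_] := eqVneq k ord0; last by rewrite !mul0r.
  by rewrite phase_period cosD2pi.
Qed.

End mean_zero.

Section concentration.
Context {R : realType} {n : nat}.
Variable ell : 'I_n.+1 -> R.
Hypothesis ell0 : forall k, 0 < ell k.
Variables (lam mu delta : R).
Hypotheses (lam0 : 0 < lam) (delta0 : 0 < delta) (delta2 : delta <= 2^-1).
Hypothesis period : lam * ell ord0 = 2 * pi.
Variable C0 : R.
Hypotheses (C00 : 0 < C0) (hC0 : forall y : R, `|bumpn 0 y| <= C0).
Local Notation point := (R * ('I_n.+1 * R))%type.
Local Notation vol := (vol0 ell).
Local Notation e := (expR 1 : R).
Local Notation pos := (pos lam mu).
Local Notation packet := (@packet R n lam mu delta).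
Local Notation size := (Num.sqrt (mass ell delta)).
Let c1 : R := expR (-2) ^+ 2 / (4 * e ^+ 2).

(** The error, of relative size [eta], takes away at most half of the mass. *)
Lemma rip_tracked (Psi : point -> R[i]) (t eta : R) :
  delta < pos t -> in_L2 vol Psi -> 0 <= eta -> eta * C0 <= c1 / 2 ->
  (cLnorm vol 2%:E (fun x => (Psi x - packet t x)%R) <= (eta * size)%:E)%E ->
  c1 / 2 * mass ell delta <= rip vol Psi (packet t).
Proof.
move=> far PL eta0 small close.
have uL : in_L2 vol (packet t) by apply: (test_in_L2 ell0); exact: test_packet.
have m0 := mass_gt0 ell0 delta0.
have := @packet_mass R n ell ell0 lam mu delta delta0 delta2 t (ltW (lt_trans delta0 far)).
rewrite nsq_rip// lee_fin -/c1 => big.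
have := cauchy_schwarz (in_L2B PL uL) uL; rewrite ripBl// => cs.
have : `|rip vol Psi (packet t) - rip vol (packet t) (packet t)| <= eta * C0 * mass ell delta.
  rewrite -lee_fin; apply: le_trans cs _.
  have -> : eta * C0 * mass ell delta = (eta * size) * (C0 * size).
    by rewrite -{1}(sqr_sqrtr (ltW m0)); ring.
  rewrite EFinM; apply: lee_pmul; rewrite ?cLnorm_ge0//.
  exact: packet_norm.
have : eta * C0 * mass ell delta <= c1 / 2 * mass ell delta by rewrite ler_pM2r.
by rewrite ler_norml => h /andP[h1 h2]; lra.
Qed.

(** By duality with the packet, whose amplitude and support are explicit. *)
Lemma concentration (Psi : point -> R[i]) (t r1 q : R) :
  r1 + delta <= pos t -> delta < pos t -> in_L2 vol Psi -> 1 < q ->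
  c1 / 2 * mass ell delta <= rip vol Psi (packet t) ->
  ((c1 / 2 * mass ell delta)%:E <=
   (C0 * expR ((pos t + delta) / 2) * (mass ell delta * expR (- pos t)) `^ (1 - q^-1))%:E *
   cLnorm vol q%:E (Pic ell (restrict_ge r1 Psi)))%E.
Proof.
move=> far far0 PL q1 big.
have uL : in_L2 vol (packet t) by apply: (test_in_L2 ell0); exact: test_packet.
have supp x : packet t x != 0 -> tube (pos t - delta) (pos t + delta) x.
  move=> h; have := packet_pointwise lam mu delta0 hC0 t x.
  rewrite indicE; have [/[!inE]//|_] := boolP (x \in _).
  rewrite mulr0 => h'; have := normc_ge0 (packet t x); move=> h0.
  have : normc (packet t x) = 0 by apply/eqP; rewrite eq_le h' h0.
  by move/Normc.eq0_normc => h2; rewrite h2 eqxx in h.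
apply: (@le_trans _ _ (rip vol Psi (packet t))%:E); first by rewrite lee_fin.
apply: (Pic_lower ell0 (W := tube (pos t - delta) (pos t + delta))) => //.
- exact: in_L2_cmeasurable uL.
- by rewrite mulr_gt0 ?expR_gt0.
- by rewrite mulr_gt0 ?expR_gt0// mass_gt0.
- exact: measurable_tube.
- move=> x; apply: le_trans (packet_pointwise lam mu delta0 hC0 t x) _.
  apply: ler_piMr; first exact: mulr_ge0 (ltW C00) (expR_ge0 _).
  by rewrite indicE lern1 leq_b1.
- move=> x /supp [/=]; rewrite in_itv/= => /andP[h _] _; lra.
- by move=> x /supp [_ [/= -> _]].
- exact: tube_mass.
- by move=> r; exact: wave_mean_Re.
- by move=> r; exact: wave_mean_Im.
Qed.

End concentration.

(** * Comparison of the powers of h *)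

Section powers.
Context {R : realType}.
Implicit Types (a b x y : R).

Lemma powRD_gt0 x a b : 0 < x -> x `^ (a + b) = x `^ a * x `^ b.
Proof. by move=> x0; apply: powRD; rewrite (gt_eqF x0) implybT. Qed.

(** At the depth [X] in the cusp, the amplitude [e^(X/2)] of the packet and the power
    of its volume combine into a positive power of the thinness [e^(- X)]: this is the
    gain over a Euclidean packet. *)
Lemma duality_growth (C m B X a : R) : 0 <= C -> 0 < m -> a <= 2^-1 -> expR (- X) <= B ->
  C * expR (X / 2) * (m * expR (- X)) `^ (1 - a) <= C * m `^ (1 - a) * B `^ (2^-1 - a).
Proof.
move=> C0 m0 a2 XB.
have eX := expR_gt0 (- X).
have -> : expR (X / 2) = expR (- X) `^ (- 2^-1).
  by rewrite -expRM; congr expR; ring.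
rewrite powRM ?(ltW m0) ?(ltW eX)// (_ : 1 - a = 2^-1 + (2^-1 - a)); last by field.
rewrite [expR (- X) `^ (2^-1 + _)]powRD_gt0//.
have -> : C * expR (- X) `^ (- 2^-1) * (m `^ (2^-1 + (2^-1 - a)) *
    (expR (- X) `^ 2^-1 * expR (- X) `^ (2^-1 - a))) =
   C * m `^ (2^-1 + (2^-1 - a)) * (expR (- X) `^ (- 2^-1) * expR (- X) `^ 2^-1) *
     expR (- X) `^ (2^-1 - a) by ring.
rewrite -powRD_gt0// addNr powRr0 mulr1.
apply: ler_wpM2l; first by rewrite mulr_ge0 ?powR_ge0.
by apply: ge0_ler_powR; rewrite ?subr_ge0// nnegrE ?(le_trans (ltW eX) XB) ?(ltW eX).
Qed.

Lemma powR_blowup (c g A : R) : 0 < c -> 0 < g ->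
  \forall h \near 0^'+, A <= c * h `^ (- g).
Proof.
move=> c0 g0.
pose B := (`|A| + 1) / c.
have B0 : 0 < B by rewrite divr_gt0// ltr_pwDr.
have t0 : 0 < B `^ (- g^-1) by rewrite powR_gt0.
near=> h.
have h0 : 0 < h by near: h; exact: nbhs_right_gt.
have ht : h <= B `^ (- g^-1) by near: h; apply: nbhs_right_le.
have : B <= h `^ (- g).
  rewrite powRN -[leLHS]invrK lef_pV2 ?posrE ?invr_gt0 ?powR_gt0//.
  have -> : B^-1 = (B `^ (- g^-1)) `^ g.
    by rewrite -powRrM mulNr mulVf ?gt_eqF// powR_inv1// ltW.
  by apply: ge0_ler_powR; rewrite ?nnegrE ?powR_ge0// ltW.
rewrite -(ler_pM2l c0); apply: le_trans.
rewrite /B mulrC divfK ?gt_eqF//; apply: le_trans (ler_norm _) _.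
by rewrite lerDl.
Unshelve. all: by end_near. Qed.

End powers.

Section ereal_division.
Context {R : realType}.
Local Open Scope ereal_scope.

(** A vanishing denominator is allowed, its inverse being [+oo]. *)
Lemma le_quotient (N D : \bar R) (a b : R) : (0 <= a)%R -> (0 < b)%R -> 0 <= D ->
  a%:E <= N -> D <= b%:E -> (a / b)%:E <= N / D.
Proof.
move=> a0 b0 D0 aN Db.
have -> : (a / b)%:E = a%:E * (b%:E)^-1 by rewrite inver gt_eqF.
apply: lee_pmul => //; first by rewrite inve_ge0 lee_fin ltW.
by rewrite lee_pV2// !inE// lee_fin ltW.
Qed.

(** [p = +oo] would force [q = 2], and [q = +oo] would force [p = 2]: both are
    excluded. *)
Lemma admissible2_fin (p q : \bar R) : admissible2 p q -> 2%:E < q ->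
  exists p0 q0 : R, [/\ p = p0%:E, q = q0%:E, (0 < p0)%R, (2 < q0)%R &
    (p0^-1 = 2^-1 - q0^-1)%R].
Proof.
move=> [p2 _ npq pq] q2.
have half0 : (2^-1 != 0 :> R)%R by rewrite invr_eq0 pnatr_eq0.
have inv2 (x : R) : (x^-1 = 2^-1 -> x = 2)%R by move/invr_inj.
case: q q2 npq pq => [q0| |//]; last first.
  move=> _ npq; case: p p2 npq => [p0| |//] p2 npq; last first.
    by rewrite !invey adde0 => /eqP; rewrite eqe eq_sym (negPf half0).
  rewrite invey adde0 inver gt_eqF; last by move: p2; rewrite lee_fin; apply: lt_le_trans.
  by move=> -[] /inv2 p02; case: npq; rewrite p02.
rewrite lte_fin => q2 npq; have q0_gt0 : (0 < q0)%R by exact: lt_trans q2.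
rewrite [q0%:E^-1]inver gt_eqF//; case: p p2 npq => [p0| |//] p2 npq; last first.
  by rewrite invey add0e => -[] /inv2 q02; move: q2; rewrite q02 ltxx.
have p0_gt0 : (0 < p0)%R by move: p2; rewrite lee_fin; apply: lt_le_trans.
rewrite inver gt_eqF// => -[h].
by exists p0, q0; split => //; rewrite -h addrK.
Qed.

End ereal_division.

Section LpLq.
Context {d} {T : measurableType d} {R : realType} (mu : {measure set T -> \bar R}).
Local Notation leb := (@lebesgue_measure R).

(** The norm in space may depend on time in a non-measurable way, but [Lnorm] is
    monotone on arbitrary functions and can be compared with that of a step function. *)
Lemma LpLq_lower (h l p L : R) (q : \bar R) (Psi : R -> T -> R[i]) :
  0 <= l -> l <= h -> 0 < p -> 0 <= L ->
  (forall t, 0 <= t <= l -> (L%:E <= cLnorm mu q (Psi t))%E) ->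
  ((L * l `^ p^-1)%:E <= LpLq_norm mu h p%:E q Psi)%E.
Proof.
move=> l0 lh p0 L0 hL; rewrite /LpLq_norm.
have mI : measurable (`[0, l] : set (measurableTypeR R)) by exact: measurable_itv.
pose f := fun t : measurableTypeR R => (L * \1_(`[0, l] : set R) t)%:E.
apply: (@le_trans _ _ (Lnorm (mrestr leb (measurable_itv `[0, h])) p%:E f)); last first.
  apply: le_LnormT; first exact: ltW.
  move=> t; rewrite gee0_abs ?lee_fin ?mulr_ge0// gee0_abs ?cLnorm_ge0//.
  rewrite /f indicE; have [|_] := boolP (t \in _); last by rewrite mulr0 cLnorm_ge0.
  by rewrite inE mulr1 /= in_itv /=; exact: hL.
rewrite unlock /f.
have -> : (L * l `^ p^-1)%:E = ((L `^ p * l)%:E `^ p^-1)%E.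
  rewrite poweR_EFin powRM ?powR_ge0// -powRrM mulfV ?gt_eqF// powRr1//.
apply: gt0_ler_poweR; first by rewrite invr_ge0 ltW.
- by rewrite in_itv/= leey andbT lee_fin mulr_ge0 ?powR_ge0.
- by rewrite in_itv/= leey andbT integral_ge0// => x _; exact: poweR_ge0.
have -> : (fun t : measurableTypeR R => `|(L * \1_(`[0, l] : set R) t)%:E| `^ p)%E =
    (fun t : measurableTypeR R => (L `^ p)%:E * (\1_(`[0, l] : set R) t)%:E)%E.
  apply/funext => t; rewrite indicE; case: (_ \in _) => /=.
    by rewrite !mulr1 ger0_norm// mule1.
  by rewrite !mulr0 normr0 powR0 ?gt_eqF// mule0.
rewrite ge0_integralZl//; last by rewrite lee_fin powR_ge0.
  rewrite integral_indic// setIT [leLHS]EFinM lee_wpmul2l ?lee_fin ?powR_ge0//.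
  have sub : `[0, l]%classic `&` `[0, h]%classic = `[0, l]%classic :> set R.
    apply/setIidPl => x /=; rewrite !in_itv/= => /andP[-> h2] /=.
    exact: le_trans h2 lh.
  have <- : lebesgue_measure (`[0, l] : set R) = l%:E.
    rewrite lebesgue_measure_itv /= lte_fin; case: ifPn; first by rewrite sube0.
    by rewrite -leNgt => h'; congr EFin; apply/eqP; rewrite eq_le l0 h'.
  by rewrite -[X in lebesgue_measure X]sub.
by apply/measurable_EFinP; exact: measurable_indic.
Qed.

End LpLq.

(** The bookkeeping of the theorem, with [a = 1/q], volume width [m1 h^(1/2)] and
    [1/p = 1/2 - a]: the quotient of the lower and the upper bound is a constant times
    [h] to the power [sg - sigma_S]. *)
Lemma quotient_exponents (R : realType) (c C D m1 B s h a sg : R) : 0 < C -> 0 < D ->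
  0 < m1 -> 0 < B -> 0 < s -> 0 < h ->
  c * (m1 * Num.sqrt h) / (C * (m1 * Num.sqrt h) `^ (1 - a) * (h * B) `^ (2^-1 - a)) *
    (s * h) `^ (2^-1 - a) / (h `^ (- sg) * (D * Num.sqrt (m1 * Num.sqrt h))) =
  c / C * (s / B) `^ (2^-1 - a) / D * m1 `^ (a - 2^-1) * h `^ (- (2^-1 * (2^-1 - a) - sg)).
Proof.
move=> C0 D0 m0 B0 s0 h0.
have sq (x : R) : 0 < x -> Num.sqrt x = x `^ 2^-1 by move=> x0; rewrite powR12_sqrt// ltW.
have mh : 0 < m1 * Num.sqrt h by rewrite mulr_gt0// sqrtr_gt0.
rewrite (sq _ mh) (sq _ h0).
have [u ->] : exists u, m1 = expR u by exists (ln m1); rewrite lnK.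
have [v ->] : exists v, h = expR v by exists (ln h); rewrite lnK.
have [w ->] : exists w, B = expR w by exists (ln B); rewrite lnK.
have [z ->] : exists z, s = expR z by exists (ln s); rewrite lnK.
rewrite -[(expR w)^-1]expRN -!(expRM, expRD).
have key : expR ((z - w) * (2^-1 - a)) * expR (u * (a - 2^-1)) *
     expR (v * - (2^-1 * (2^-1 - a) - sg)) *
    (expR ((u + v / 2) * (1 - a)) * expR ((v + w) * (2^-1 - a)) *
     (expR (v * - sg) * expR ((u + v / 2) / 2))) =
    expR (u + v / 2) * expR ((z + v) * (2^-1 - a)).
  by rewrite -!expRD; congr expR; field.
have [n1 n2] : expR ((u + v / 2) * (1 - a)) != 0 /\ expR ((v + w) * (2^-1 - a)) != 0.
  by rewrite !gt_eqF ?expR_gt0.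
have [n3 n4] : expR (v * - sg) != 0 /\ expR ((u + v / 2) / 2) != 0.
  by rewrite !gt_eqF ?expR_gt0.
have nC : C != 0 by rewrite gt_eqF.
have nD : D != 0 by rewrite gt_eqF.
move: (expR _) (expR _) (expR _) (expR _) (expR _) (expR _) (expR _) (expR _) (expR _) key n1 n2 n3 n4.
move=> e9 e1 e2 e3 e4 e5 e6 e7 e8 key n5 n4 n3 n2.
transitivity (c / (C * D) * (e1 * e9) / (e5 * e4 * e3 * e2)).
  by field; rewrite nC nD n2 n3 n4 n5.
by rewrite -key; field; rewrite nC nD n2 n3 n4 n5.
Qed.

Section at_scale.
Context {R : realType} {n : nat}.
Variable ell : 'I_n.+1 -> R.
Hypothesis ell0 : forall k, 0 < ell k.
Variables lam C0 C1 C2 h r1 K s : R.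
Hypotheses (lam0 : 0 < lam) (period : lam * ell ord0 = 2 * pi).
Hypotheses (C00 : 0 < C0) (C10 : 0 < C1) (C20 : 0 < C2).
Hypotheses (hC0 : forall y : R, `|bumpn 0 y| <= C0) (hC1 : forall y : R, `|bumpn 1 y| <= C1)
  (hC2 : forall y : R, `|bumpn 2 y| <= C2).
Hypotheses (r10 : 0 < r1) (h0 : 0 < h) (h4 : h <= 4^-1) (hl : h * lam <= expR (- (r1 + 3))).
Hypotheses (K0 : 0 < K) (s0 : 0 < s) (s1 : s <= 1).
Local Notation point := (R * ('I_n.+1 * R))%type.
Local Notation vol := (vol0 ell).
Local Notation e := (expR 1 : R).
Local Notation delta := (Num.sqrt h).
Local Notation pos := (pos lam h^-1).
Local Notation packet := (@packet R n lam h^-1 delta).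
Local Notation size := (Num.sqrt (mass ell delta)).
Local Notation c1 := (expR (-2) ^+ 2 / (4 * e ^+ 2)).
Local Notation energy := (C2 + (2 + e) * C0 + 2 * C1).

Let mu1 : 1 <= h^-1.
Proof. by rewrite invf_ge1//; apply: le_trans h4 _; rewrite invf_le1// ler1n. Qed.

Let delta0 : 0 < delta. Proof. by rewrite sqrtr_gt0. Qed.

Let delta2 : delta <= 2^-1.
Proof.
rewrite -(@ler_pXn2r _ 2) ?nnegrE ?sqrtr_ge0 ?invr_ge0// sqr_sqrtr ?(ltW h0)//.
by apply: le_trans h4 _; rewrite exprVn -natrX.
Qed.

Let scaling : delta ^+ 2 * h^-1 = 1.
Proof. by rewrite sqr_sqrtr ?(ltW h0)// mulfV// gt_eqF. Qed.

Let log_bound t : 0 <= t <= s * h -> - ln (h * lam) - 2 <= pos t.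
Proof.
move=> /andP[t0 ts].
have hi0 : 0 < h^-1 by rewrite invr_gt0.
have /andP[b _] := pos_bounds lam0 hi0 t0; apply: le_trans b.
rewrite -invfM lnV ?posrE ?mulr_gt0// lerD2l lerN2 -[leRHS]mulr1 -mulrA ler_pM2l//.
by rewrite ler_pdivrMl// mulr1; apply: le_trans ts _; rewrite ler_piMl// ltW.
Qed.

(** By [hl] the turning point lies beyond [r1 + 3], and the packet moves by at most [2]
    before the time [s h]. *)
Lemma packet_far t : 0 <= t <= s * h -> r1 + 1 <= pos t.
Proof.
move=> /log_bound; apply: le_trans.
have : ln (h * lam) <= - (r1 + 3).
  by rewrite -[leRHS]expRK ler_ln ?posrE ?expR_gt0// mulr_gt0.
lra.
Qed.

(** The thinness of the cusp at the packet is of order [h]. *)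
Lemma packet_depth t : 0 <= t <= s * h -> expR (- pos t) <= h * (lam * expR 2).
Proof.
move=> /log_bound b; have hl0 : 0 < h * lam by rewrite mulr_gt0.
rewrite mulrA -[h * lam]lnK// -expRD ler_expR; lra.
Qed.

Let far t : 0 <= t <= s * h -> delta < pos t.
Proof.
move=> /packet_far; apply: lt_le_trans; have d2 := delta2; have r := r10.
lra.
Qed.

Let zero_in : 0 <= (0 : R) <= s * h.
Proof. by rewrite lexx mulr_ge0// ltW. Qed.

Lemma test_initial : test_cusp ell (packet 0).
Proof. by apply: test_packet => //; exact: far. Qed.

Lemma initial_neq0 : exists x, packet 0 x != 0.
Proof.
exists (pos 0, (ord0, 0)); apply/eqP => /(congr1 (@Normc.normc R)).
rewrite normc_wave Normc.normc0 eqxx mul1r => /eqP.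
rewrite mulf_eq0 gt_eqF ?expR_gt0//= expr0n addr0 sqrtr_sqr normr_eq0.
by rewrite amp0E subrr mul0r gt_eqF// bump0_gt0.
Qed.

Lemma strichartz_lower (S : spectral_rep vol (neg_Delta0 ell)) (q t : R) : 2 < q ->
  (s * (4 * e * C0 + C2) + C1 / (bumpf 0 * K) * energy) * C0 <= c1 / 2 ->
  0 <= t <= s * h ->
  ((c1 / 2 * mass ell delta / (C0 * e * mass ell delta `^ (1 - q^-1) *
      (h * (lam * expR 2)) `^ (2^-1 - q^-1)))%:E <=
   cLnorm vol q%:E (Pic ell (restrict_ge r1
     (schrodinger S t (cutoff S (cutoff_symbol K) h (packet 0))))))%E.
Proof.
move=> q2 small tt; have m0 := mass_gt0 ell0 delta0.
have farmu (t' : R) : 0 <= t' <= s / h^-1 -> delta < pos t' by rewrite invrK => /far.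
have ttmu : 0 <= t <= s / h^-1 by rewrite invrK.
have [] := packet_tracking ell0 lam0 mu1 delta0 delta2 scaling period hC0 hC1 hC2 S
  K0 (ltW s0) farmu ttmu.
rewrite invrK; set Psi := schrodinger _ _ _ => PL close.
have eta0 : 0 <= s * (4 * e * C0 + C2) + C1 / (bumpf 0 * K) * energy.
  have b0 := @bump0_gt0 R; have e0 := expR_gt0 (1 : R).
  have A0 : 0 < 4 * e * C0 + C2 by rewrite addr_gt0// !mulr_gt0.
  have E0 : 0 < energy by rewrite addr_gt0 ?mulr_gt0// addr_gt0 ?mulr_gt0// addr_gt0.
  apply: addr_ge0 (mulr_ge0 (ltW s0) (ltW A0)) (mulr_ge0 _ (ltW E0)).
  exact: divr_ge0 (ltW C10) (mulr_ge0 (ltW b0) (ltW K0)).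
have big := rip_tracked ell0 delta0 delta2 period hC0 (far tt) PL eta0 small close.
have q1 : 1 < q by lra.
have r1d : r1 + delta <= pos t.
  by apply: le_trans (packet_far tt); rewrite lerD2l (le_trans delta2)// invf_le1// ler1n.
have := concentration ell0 lam0 delta0 delta2 period C00 hC0 r1d (far tt) PL q1 big.
set L := cLnorm _ _ _; set m := mass _ _.
have B0 : 0 < h * (lam * expR 2) by rewrite !mulr_gt0 ?expR_gt0.
have G0 : 0 < C0 * e * m `^ (1 - q^-1) * (h * (lam * expR 2)) `^ (2^-1 - q^-1).
  by rewrite !mulr_gt0 ?expR_gt0 ?powR_gt0.
move=> conc; rewrite mulrC EFinM lee_pdivrMl//; apply: le_trans conc _.
apply: lee_wpmul2r; first exact: cLnorm_ge0.
rewrite lee_fin.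
have q2' : q^-1 <= 2^-1 by rewrite lef_pV2 ?posrE ?(ltW q2)//; lra.
apply: le_trans (duality_growth (mulr_ge0 (ltW C00) (expR_ge0 1)) m0 q2' (packet_depth tt)).
rewrite ler_wpM2r ?powR_ge0// -mulrA ler_pM2l// -expRD ler_expR.
have d2 := delta2; lra.
Qed.

Lemma sobolev_upper (S : spectral_rep vol (neg_Delta0 ell)) (sigma sigma' : R) :
  sigma <= sigma' -> 0 <= sigma' <= 2 ->
  (sobolev_norm S sigma (packet 0) <=
    (h `^ (- sigma') * ((2 * C0 + energy) * size))%:E)%E.
Proof.
move=> ss s02; have test := test_initial.
have uL := test_in_L2 ell0 test; have wL := test_in_L2 ell0 (test_neg_lap test).
have h01 : 0 < h <= 1 by rewrite h0 /= -invf_ge1.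
have sy0 : {ae sr_meas S, forall y, 0 <= symb S y}.
  by apply: symb_ge0 => u w Huw _ _; exact: neg_Delta0_ge0 Huw.
have := sobolev_le sy0 (neg_Delta0_test ell0 test) uL wL ss s02 h01
  (packet_norm ell0 lam h^-1 delta0 delta2 hC0 0)
  (energy_norm ell0 lam0 mu1 delta0 delta2 scaling hC0 hC1 hC2 0).
rewrite /sobolev_norm => /le_trans; apply; rewrite lee_fin.
apply: eq_leW; field.
by rewrite gt_eqF.
Qed.

End at_scale.

Theorem theorem1p5 (R : realType) (n : nat) (ell : 'I_n.+1 -> R)
    (hell : forall k, 0 < ell k) (r1 : R) (hr1 : 0 < r1) :
  exists (phi : R -> R[i]) (h0 : R) (psi : R -> R * ('I_n.+1 * R) -> R[i]),
    [/\ test_line phi, 0 < h0,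
        forall h, 0 < h <= h0 -> test_cusp ell (psi h) /\ exists x, psi h x != 0
      & forall (S : spectral_rep (vol0 ell) (neg_Delta0 ell)) (p q : \bar R) (sigma : R),
          admissible2 p q -> (2%:E < q)%E ->
          (sigma%:E < (2^-1)%:E * ((2^-1)%:E - q^-1))%E ->
          (LpLq_norm (vol0 ell) h p q (fun t =>
             Pic ell (restrict_ge r1 (schrodinger S t (cutoff S phi h (psi h)))))
           / sobolev_norm S sigma (psi h))%E @[h --> 0^'+] --> +oo%E].
Proof.
have bounded m : exists2 C : R, 0 < C & forall y : R, `|bumpn m y| <= C by exact: bumpn_bounded.
have [C0 C00 hC0] := bounded 0%N.
have [C1 C10 hC1] := bounded 1%N.
have [C2 C20 hC2] := bounded 2.
pose e : R := expR 1; have e0 : 0 < e := expR_gt0 1.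
pose c1 : R := expR (-2) ^+ 2 / (4 * e ^+ 2).
have c10 : 0 < c1 by rewrite divr_gt0 ?exprn_gt0 ?expR_gt0// mulr_gt0// exprn_gt0.
pose A := 4 * e * C0 + C2; have A0 : 0 < A by rewrite addr_gt0 ?mulr_gt0.
pose E := C2 + (2 + e) * C0 + 2 * C1.
have E0 : 0 < E by rewrite addr_gt0 ?mulr_gt0// addr_gt0 ?mulr_gt0// addr_gt0.
have b0 := @bump0_gt0 R.
pose lam := 2 * pi / ell ord0.
have lam0 : 0 < lam by rewrite divr_gt0// mulr_gt0// pi_gt0.
have period : lam * ell ord0 = 2 * pi by rewrite divfK// gt_eqF.
(* [K] and [s] make each of the two errors of [packet_tracking] at most a quarter of
   the bound [c1] of [packet_mass] *)
pose K := C1 * E * C0 * 4 / (bumpf 0 * c1).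
have K0 : 0 < K.
  by apply: divr_gt0 (mulr_gt0 (mulr_gt0 (mulr_gt0 C10 E0) C00) _) (mulr_gt0 b0 c10).
pose s := Num.min 1 (c1 / (4 * A * C0)).
have s0 : 0 < s by rewrite lt_min ltr01 divr_gt0// mulr_gt0// mulr_gt0.
have s1 : s <= 1 by rewrite ge_min lexx.
have small : (s * A + C1 / (bumpf 0 * K) * E) * C0 <= c1 / 2.
  have : s * A * C0 <= c1 / 4.
    have : s <= c1 / (4 * A * C0) by rewrite ge_min lexx orbT.
    rewrite -[s * _ * _]mulrA -(ler_pM2r (mulr_gt0 A0 C00)) => /le_trans; apply.
    by apply: eq_leW; field; rewrite !gt_eqF.
  have -> : (s * A + C1 / (bumpf 0 * K) * E) * C0 = s * A * C0 + c1 / 4.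
    by rewrite /K; field; rewrite !gt_eqF.
  lra.
pose psi (h : R) := @packet R n lam h^-1 (Num.sqrt h) 0.
(* the width [h^(1/2)] is at most [1/2], and the turning point is beyond [r1 + 3] *)
pose h0 := Num.min 4^-1 (expR (- (r1 + 3)) / lam).
have h00 : 0 < h0 by rewrite lt_min invr_gt0 ltr0n/= divr_gt0 ?expR_gt0.
have h0P (h : R) : h <= h0 -> h <= 4^-1 /\ h * lam <= expR (- (r1 + 3)).
  by rewrite le_min => /andP[h1 h2]; split => //; rewrite -ler_pdivlMr.
exists (cutoff_symbol K), h0, psi; split => //.
- exact: test_cutoff_symbol.
- move=> h /andP[hp /h0P[h4 hl]]; split; last exact: initial_neq0.
  exact: (test_initial lam0 period hr1 hp h4 hl s0 s1).
move=> S p q sigma /admissible2_fin adm q2.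
have [p0 [q0 [-> qE p00 q02 pq]]] := adm q2; rewrite {}qE in q2 *.
have q00 : 0 < q0 by exact: lt_trans q02.
rewrite inver gt_eqF// -EFinB -EFinM lte_fin => hsigma.
pose beta := 2^-1 - q0^-1.
have beta0 : 0 < beta by rewrite /beta -pq invr_gt0.
(* negative orders are bounded by the order [0], which is below [sigma_S] *)
pose sigma' := Num.max sigma 0.
have ss : sigma <= sigma' by rewrite le_max lexx.
have s'beta : sigma' < 2^-1 * beta by rewrite gt_max hsigma mulr_gt0// invr_gt0.
have s'02 : 0 <= sigma' <= 2.
  rewrite le_max lexx orbT /=; apply/ltW/(lt_le_trans s'beta).
  have : 0 < q0^-1 by rewrite invr_gt0.
  by rewrite /beta; lra.
pose m1 := 2 * e * ell ord0.
have m10 : 0 < m1 by rewrite !mulr_gt0.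
pose D := 2 * C0 + E; have D0 : 0 < D by rewrite addr_gt0// mulr_gt0.
pose B := lam * expR 2; have B0 : 0 < B by rewrite mulr_gt0// expR_gt0.
pose c := c1 / 2 / (C0 * e) * (s / B) `^ beta / D * m1 `^ (q0^-1 - 2^-1).
have c0 : 0 < c.
  apply: mulr_gt0; last exact: powR_gt0.
  apply: divr_gt0 D0; apply: mulr_gt0; last exact: powR_gt0 (divr_gt0 s0 B0).
  by apply: divr_gt0 (mulr_gt0 C00 e0); exact: divr_gt0.
apply/cvgeyPge => M; have gap : 0 < 2^-1 * beta - sigma' by rewrite subr_gt0.
have blow := powR_blowup M c0 gap.
near=> h.
have hp : 0 < h by near: h; exact: nbhs_right_gt.
have [h4 hl] : h <= 4^-1 /\ h * lam <= expR (- (r1 + 3)).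
  by apply: h0P; near: h; exact: nbhs_right_le.
have hM : M <= c * h `^ (- (2^-1 * beta - sigma')) by near: h.
apply: (@le_trans _ _ (c * h `^ (- (2^-1 * beta - sigma')))%:E); first by rewrite lee_fin.
rewrite /c /beta -(@quotient_exponents R (c1 / 2) (C0 * e) D m1 B s h q0^-1 sigma' (mulr_gt0 C00 e0) D0 m10 B0 s0 hp).
have sh0 : 0 < s * h by rewrite mulr_gt0.
have mh : 0 < m1 * Num.sqrt h by rewrite mulr_gt0// sqrtr_gt0.
set num := c1 / 2 * _ / _.
have num0 : 0 <= num.
  apply: divr_ge0; first by apply: mulr_ge0 (ltW mh); apply: divr_ge0 => //; exact: ltW.
  by rewrite mulr_ge0 ?powR_ge0// mulr_ge0 ?powR_ge0// ltW// mulr_gt0.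
apply: le_quotient.
- by rewrite mulr_ge0 ?powR_ge0.
- by apply: mulr_gt0; [exact: powR_gt0|apply: mulr_gt0 => //; rewrite sqrtr_gt0].
- exact: cLnorm_ge0.
- rewrite -pq; apply: LpLq_lower => //.
  + exact: ltW.
  + by rewrite ler_piMl// ltW.
  + move=> t tt.
    exact: (strichartz_lower hell lam0 period C00 C10 C20 hC0 hC1 hC2 hr1 hp h4 hl K0 s0 s1 S q02 small tt).
- exact: (sobolev_upper hell lam0 period hC0 hC1 hC2 hr1 hp h4 hl s0 s1 S ss s'02).
Unshelve. all: by end_near. Qed.
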